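(* For the speed-scaling scheduling problems $P|size_j,pmtn*,r_j=r,d_j|E$ (common release time $r$, individual deadlines) and $P|size_j,pmtn*,r_j,d_j=d|E$ (individual release times, common deadline $d$), with preemption allowed but no migration, there is an algorithm running in $O(n^2)$ time that returns a feasible schedule whose total energy consumption is at most $\left(3-\frac{4}{m+1}\right)^{\alpha-1}$ times the minimum possible total energy consumption.
   Context: A system has $m$ identical parallel processors whose speeds can be changed dynamically over a continuous spectrum. A set $\mathcal{J}=\{1,\dots,n\}$ of rigid parallel jobs is given; job $j$ has a release time $r_j$, a deadline $d_j$, a processing volume (work) $W_j>0$ and a size $size_j\in\{1,\dots,m\}$, the number of processors it requires simultaneously. Any subset of $size_j$ processors may be used to execute job $j$, but migration is forbidden: job $j$ is executed throughout on one fixed set of $size_j$ processors. All processors executing the same job at the same time run at the same speed; the speed of a job is the rate at which its work is completed. Running a processor at speed $s$ consumes power $s^\alpha$, where $\alpha>1$ is a constant, and energy is power integrated over time (summed over all processors). A schedule is feasible if each processor executes at most one job at a time and each job $j$ has its whole work $W_j$ processed within $[r_j,d_j)$. The objective $E$ is to minimize the total energy consumption. In the notation, $pmtn*$ means preemption of jobs is allowed (but not migration); $r_j=r$ (resp. $d_j=d$) means all jobs have the same release time (resp. deadline). *)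

(* Defs.v *)
From HB Require Import structures.
From mathcomp Require Import all_boot all_order all_algebra.
From mathcomp Require Import all_classical all_reals all_analysis.

Set Implicit Arguments.
Unset Strict Implicit.
Unset Printing Implicit Defensive.
Import Order.TTheory GRing.Theory Num.Theory.
Import numFieldNormedType.Exports.
Local Open Scope classical_set_scope.
Local Open Scope ring_scope.

Record instance (R : realType) := Instance {
  njobs : nat;
  nprocs : nat;
  size_of : 'I_njobs -> nat;
  release : 'I_njobs -> R;
  deadline : 'I_njobs -> R;
  work : 'I_njobs -> R
}.

Definition valid (R : realType) (I : instance R) : Prop :=
  [/\ (0 < njobs I)%N, (0 < nprocs I)%N &
      forall j : 'I_(njobs I),
        [/\ (0 < size_of j <= nprocs I)%N,
            release j < deadline j & 0 < work j]].

Definition common_release (R : realType) (I : instance R) : Prop :=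
  exists r : R, forall j : 'I_(njobs I), release j = r.

Definition common_deadline (R : realType) (I : instance R) : Prop :=
  exists d : R, forall j : 'I_(njobs I), deadline j = d.

(* The processor set of a job does not depend on time: no migration.  Job j is
   being executed at time t iff speed j t > 0; the times at which it is
   executed may form any measurable set, so preemption is unrestricted, and
   the speed may vary over time. *)
Record schedule (R : realType) (n m : nat) := Schedule {
  procs : 'I_n -> {set 'I_m};
  speed : 'I_n -> R -> R
}.

Definition feasible (R : realType) (I : instance R)
    (S : schedule R (njobs I) (nprocs I)) : Prop :=
  [/\ forall j, #|procs S j| = size_of j,
      forall j, measurable_fun setT (speed S j) /\ forall t, 0 <= speed S j t,
      forall j t, 0 < speed S j t -> release j <= t < deadline j,
      forall t (p : 'I_(nprocs I)) i j,
        p \in procs S i -> p \in procs S j ->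
        0 < speed S i t -> 0 < speed S j t -> i = j &
      forall j, (\int[@lebesgue_measure R]_(t in `[release j, deadline j[)
                   (speed S j t)%:E = (work j)%:E)%E].

(* In a feasible schedule at most one term of the sum is nonzero. *)
Definition proc_speed (R : realType) (n m : nat) (S : schedule R n m)
    (p : 'I_m) (t : R) : R :=
  \sum_(j < n | p \in procs S j) speed S j t.

Definition energy (R : realType) (alpha : R) (n m : nat)
    (S : schedule R n m) : \bar R :=
  (\sum_(p < m) \int[@lebesgue_measure R]_t
     ((proc_speed S p t) `^ alpha)%:E)%E.

Definition min_energy (R : realType) (alpha : R) (I : instance R) : \bar R :=
  ereal_inf [set energy alpha S | S in @feasible R I].

(* A real RAM with unit-cost operations, programmed in a while language.  The
   memory consists of arrays of naturals and arrays of reals.  Arrays are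
   named by constants of the program text, so a program uses finitely many of
   them; cells are addressed indirectly, by computed natural indices.
   Naturals only support addition, truncated subtraction and comparison (no
   multiplication), and reals the field operations and comparison (no
   rounding to a natural). *)
Inductive nexp :=
| NConst of nat
| NGet of nat & nexp
| NAdd of nexp & nexp
| NSub of nexp & nexp.

Inductive rexp :=
| ROfNat of nexp
| RGet of nat & nexp
| RAdd of rexp & rexp
| RSub of rexp & rexp
| RMul of rexp & rexp
| RDiv of rexp & rexp.

Inductive bexp :=
| BLeN of nexp & nexp
| BLeR of rexp & rexp
| BNot of bexp
| BAnd of bexp & bexp.

Inductive cmd :=
| Skip
| NSet of nat & nexp & nexp
| RSet of nat & nexp & rexp
| Seq of cmd & cmd
| If of bexp & cmd & cmd
| While of bexp & cmd.

Record memory (R : realType) := Memory {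
  nmem : nat -> nat -> nat;
  rmem : nat -> nat -> R
}.

Fixpoint neval (R : realType) (s : memory R) (e : nexp) : nat :=
  match e with
  | NConst k => k
  | NGet a i => nmem s a (neval s i)
  | NAdd e1 e2 => (neval s e1 + neval s e2)%N
  | NSub e1 e2 => (neval s e1 - neval s e2)%N
  end.

(* Division by zero yields zero. *)
Fixpoint reval (R : realType) (s : memory R) (e : rexp) : R :=
  match e with
  | ROfNat i => (neval s i)%:R
  | RGet a i => rmem s a (neval s i)
  | RAdd e1 e2 => reval s e1 + reval s e2
  | RSub e1 e2 => reval s e1 - reval s e2
  | RMul e1 e2 => reval s e1 * reval s e2
  | RDiv e1 e2 => reval s e1 / reval s e2
  end.

Fixpoint beval (R : realType) (s : memory R) (e : bexp) : bool :=
  match e with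
  | BLeN e1 e2 => (neval s e1 <= neval s e2)%N
  | BLeR e1 e2 => reval s e1 <= reval s e2
  | BNot b => ~~ beval s b
  | BAnd b1 b2 => beval s b1 && beval s b2
  end.

Fixpoint ncost (e : nexp) : nat :=
  match e with
  | NConst _ => 1
  | NGet _ i => (ncost i).+1
  | NAdd e1 e2 | NSub e1 e2 => (ncost e1 + ncost e2).+1
  end.

Fixpoint rcost (e : rexp) : nat :=
  match e with
  | ROfNat i | RGet _ i => (ncost i).+1
  | RAdd e1 e2 | RSub e1 e2 | RMul e1 e2 | RDiv e1 e2 =>
      (rcost e1 + rcost e2).+1
  end.

Fixpoint bcost (e : bexp) : nat :=
  match e with
  | BLeN e1 e2 => (ncost e1 + ncost e2).+1
  | BLeR e1 e2 => (rcost e1 + rcost e2).+1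
  | BNot b => (bcost b).+1
  | BAnd b1 b2 => (bcost b1 + bcost b2).+1
  end.

Definition update (T : Type) (f : nat -> nat -> T) (a i : nat) (x : T) :
    nat -> nat -> T :=
  fun b k => if (b == a) && (k == i) then x else f b k.

(* exec c s t s': started in memory s, the program c halts in memory s' after
   t elementary operations. *)
Inductive exec (R : realType) :
    cmd -> memory R -> nat -> memory R -> Prop :=
| ExecSkip s : exec Skip s 1 s
| ExecNSet s a i e :
    exec (NSet a i e) s (ncost i + ncost e).+1
      (Memory (update (nmem s) a (neval s i) (neval s e)) (rmem s))
| ExecRSet s a i e :
    exec (RSet a i e) s (ncost i + rcost e).+1
      (Memory (nmem s) (update (rmem s) a (neval s i) (reval s e)))
| ExecSeq c1 c2 s s1 s2 t1 t2 :
    exec c1 s t1 s1 -> exec c2 s1 t2 s2 -> exec (Seq c1 c2) s (t1 + t2) s2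
| ExecIfTrue b c1 c2 s s1 t :
    beval s b -> exec c1 s t s1 -> exec (If b c1 c2) s (bcost b + t).+1 s1
| ExecIfFalse b c1 c2 s s1 t :
    ~~ beval s b -> exec c2 s t s1 -> exec (If b c1 c2) s (bcost b + t).+1 s1
| ExecWhileTrue b c s s1 s2 t1 t2 :
    beval s b -> exec c s t1 s1 -> exec (While b c) s1 t2 s2 ->
    exec (While b c) s (bcost b + t1 + t2).+1 s2
| ExecWhileFalse b c s :
    ~~ beval s b -> exec (While b c) s (bcost b).+1 s.

Lemma exec_det (R : realType) c (s : memory R) t1 t2 s1 s2 :
  exec c s t1 s1 -> exec c s t2 s2 -> t1 = t2 /\ s1 = s2.
Proof.
move=> H; elim: H t2 s2 => {c s t1 s1};
  intros; match goal with H : exec _ _ _ _ |- _ => inversion H; subst end;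
  repeat match goal with
  | IH : forall _ _, exec ?c ?s _ _ -> _, X : exec ?c ?s _ _ |- _ =>
      destruct (IH _ _ X); clear IH; subst
  | X : is_true (beval ?s ?b), Y : is_true (~~ beval ?s ?b) |- _ =>
      by rewrite X in Y
  end; by [].
Qed.

Definition tabulate (T : Type) (x0 : T) (n : nat) (f : 'I_n -> T) (k : nat) : T :=
  oapp f x0 (insub k).

Definition input (R : realType) (alpha : R) (I : instance R) : memory R :=
  Memory
    (fun a k => match a, k with
                | 0%N, 0%N => njobs I
                | 0%N, 1%N => nprocs I
                | 1%N, k => tabulate 0%N (@size_of R I) k
                | _, _ => 0%N
                end)
    (fun a k => match a, k with
                | 0%N, 0%N => alpha
                | 1%N, k => tabulate 0 (@release R I) k
                | 2%N, k => tabulate 0 (@deadline R I) k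
                | 3%N, k => tabulate 0 (@work R I) k
                | _, _ => 0
                end).

(* The output is a list of K = nmem 2 0 execution pieces and a list of
   L = nmem 2 1 processor blocks.  Piece k runs job nmem 3 k during
   [rmem 4 k, rmem 5 k) at speed rmem 6 k (overlapping pieces of a job add up).
   Block l gives job nmem 4 l the consecutive processors
   nmem 5 l, ..., nmem 5 l + nmem 6 l - 1; listing processors one by one
   instead could take time proportional to the number of processors. *)
Definition output (R : realType) (n m : nat) (s : memory R) : schedule R n m :=
  Schedule
    (fun j : 'I_n => [set p : 'I_m | [exists l : 'I_(nmem s 2 1),
       (nmem s 4 l == j) && (nmem s 5 l <= p < nmem s 5 l + nmem s 6 l)%N]]%SET)
    (fun (j : 'I_n) (t : R) =>
       \sum_(k < nmem s 2 0 | (nmem s 3 k == j) &&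
                              (rmem s 4 k <= t < rmem s 5 k)) rmem s 6 k).

(* C is uniform in the instance, in particular in the number of processors. *)
Definition quadratic_time_approximation (R : realType) (alpha : R)
    (problem : instance R -> Prop) (ratio : nat -> R) : Prop :=
  exists (P : cmd) (C : nat), forall I : instance R, valid I -> problem I ->
    exists (t : nat) (s : memory R),
      let S := output (njobs I) (nprocs I) s in
      [/\ exec P (input alpha I) t s,
          (t <= C * njobs I ^ 2)%N,
          feasible S &
          (energy alpha S <= (ratio (nprocs I))%:E * min_energy alpha I)%E].

(* Main.v *)
(* Order the jobs by the length D_j of their windows, which are nested.  If s_j is the
   speed of job j and w_j = size_j W_j, then the processor times x_j = w_j / s_j of a
   feasible schedule satisfy x_j <= size_j D_j and, for every k, the sum of the first k
   of them is at most m D_k.  The relaxed problem, to minimize the sum of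
   w_j s_j^(alpha-1) under these constraints, is solved exactly by adding the jobs in
   turn: job k enters at its least possible speed W_k / D_k, and if the k-th constraint
   fails then all speeds are raised to max(s_j, v) for the right level v.  The optimum
   does not depend on alpha, and it bounds the energy of any schedule from below by the
   tangent inequality u^alpha >= alpha s^(alpha-1) u - (alpha-1) s^alpha.

   Multiply the optimal speeds by rho = 3 - 4/(m+1); this costs the factor
   rho^(alpha-1).  The small jobs (2 size_j <= m) are started in order, each as soon as
   enough processors are free, so that at least (m+1)/2 processors are busy before the
   start of each of them; each big job preempts them all and runs after the small jobs
   before it in the order.  If l is the small job that ends last among the first k jobs,
   whose processor time is now x_l/rho, then the first k jobs are complete by time
   (2/(m+1) (m D_k - x_l) + x_l/size_l) / rho <= D_k, as x_l/size_l <= D_k.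
   With a common deadline, time is reversed. *)
Require Import Defs.
From mathcomp Require Import all_boot all_order all_algebra.
From mathcomp Require Import all_classical all_reals all_analysis.
From mathcomp Require Import measurable_realfun lra zify ring.
Set Implicit Arguments.
Unset Strict Implicit.
Unset Printing Implicit Defensive.
Import Order.TTheory GRing.Theory Num.Theory.
Import numFieldNormedType.Exports.
Local Open Scope classical_set_scope.
Local Open Scope ring_scope.

(** * Total correctness with a time bound *)

(** The machine has no powers, so the speeds must be found by field operations alone. This is
    possible because optimality of the relaxed problem is carried as one variational inequality for
    all nondecreasing nonnegative weights at once; that family is closed under the truncation which
    raising the speeds to a level brings in, and the power with exponent alpha enters only as one
    member of it. Migration is the second obstacle. Small jobs are timed as if big jobs did not
    exist, so each occupies a single interval and its processors can be fixed when it starts. The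
    big jobs then only cut this time axis and insert pauses common to all small jobs, which disturbs
    no processor set. The running time may not depend on m. Processors are therefore kept in
    intervals with equal last completion time; a small job takes whole intervals and splits at most
    one, so there are at most n + 1 of them. Jobs stay sorted by speed under a raise, so every job
    costs linear time in each phase. A small job may be cut into linearly many pieces, which the
    quadratic bound still allows. *)

Section HoareLogic.
Context {R : realType}.
Implicit Types (s : memory R) (Q : memory R -> Prop) (c : cmd) (B : nat).

(** By [exec_det] the run asserted to exist is the only one, so this is total correctness. [B] is
    only an upper bound, which lets budgets be rounded up. *)
Definition runs c s B Q :=
  exists t s', [/\ exec c s t s', (t <= B)%N & Q s'].

Lemma runs_weaken c s B B' Q Q' :
  runs c s B Q -> (B <= B')%N -> (forall s', Q s' -> Q' s') -> runs c s B' Q'.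
Proof.
move=> [t [s' [e tB q]]] BB' QQ'; exists t, s'; split => //.
  exact: leq_trans tB BB'.
exact: QQ'.
Qed.

Lemma runs_skip s B Q : (0 < B)%N -> Q s -> runs Skip s B Q.
Proof. by move=> B0 q; exists 1%N, s; split => //; constructor. Qed.

Lemma runs_nset a i e s B Q : (ncost i + ncost e < B)%N ->
  Q (Memory (update (nmem s) a (neval s i) (neval s e)) (rmem s)) ->
  runs (NSet a i e) s B Q.
Proof. by move=> cB q; do 2 eexists; split; [constructor|exact: cB|]. Qed.

Lemma runs_rset a i e s B Q : (ncost i + rcost e < B)%N ->
  Q (Memory (nmem s) (update (rmem s) a (neval s i) (reval s e))) ->
  runs (RSet a i e) s B Q.
Proof. by move=> cB q; do 2 eexists; split; [constructor|exact: cB|]. Qed.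

Lemma runs_seq c1 c2 s B1 B Q : (B1 <= B)%N ->
  runs c1 s B1 (fun s1 => runs c2 s1 (B - B1) Q) -> runs (Seq c1 c2) s B Q.
Proof.
move=> B1B [t [s1 [e1 tB1 [t' [s2 [e2 tB2 q]]]]]].
exists (t + t')%N, s2; split => //; first exact: ExecSeq e1 e2.
by rewrite -(subnKC B1B) leq_add.
Qed.

Lemma runs_nset_seq a i e c s B Q : ((ncost i + ncost e).+1 <= B)%N ->
  runs c (Memory (update (nmem s) a (neval s i) (neval s e)) (rmem s))
    (B - (ncost i + ncost e).+1) Q ->
  runs (Seq (NSet a i e) c) s B Q.
Proof. by move=> cB q; apply: (runs_seq cB); apply: runs_nset. Qed.

Lemma runs_rset_seq a i e c s B Q : ((ncost i + rcost e).+1 <= B)%N ->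
  runs c (Memory (nmem s) (update (rmem s) a (neval s i) (reval s e)))
    (B - (ncost i + rcost e).+1) Q ->
  runs (Seq (RSet a i e) c) s B Q.
Proof. by move=> cB q; apply: (runs_seq cB); apply: runs_rset. Qed.

Lemma runs_if b c1 c2 s B Q : (bcost b < B)%N ->
  (beval s b -> runs c1 s (B - (bcost b).+1) Q) ->
  (~~ beval s b -> runs c2 s (B - (bcost b).+1) Q) ->
  runs (If b c1 c2) s B Q.
Proof.
move=> cB r1 r2; case/boolP: (beval s b) => bs.
- have [t [s' [e tB q]]] := r1 bs.
  exists (bcost b + t).+1, s'; split => //; first exact: ExecIfTrue.
  by rewrite -addSn -leq_subRL.
- have [t [s' [e tB q]]] := r2 bs.
  exists (bcost b + t).+1, s'; split => //; first exact: ExecIfFalse.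
  by rewrite -addSn -leq_subRL.
Qed.

(** The index of [Inv] is a fuel that drops by one per round and must be positive whenever the guard
    holds; the loop may stop with fuel left over. *)
Lemma runs_while (Inv : nat -> memory R -> Prop) b c B v s B' Q :
  (v.+1 * (bcost b + B).+1 <= B')%N ->
  (forall v s, Inv v s -> ~~ beval s b -> Q s) ->
  (forall v s, Inv v s -> beval s b ->
     (0 < v)%N /\ runs c s B (fun s' => Inv v.-1 s')) ->
  Inv v s -> runs (While b c) s B' Q.
Proof.
move=> leB' exitQ body I.
suff r : runs (While b c) s (v.+1 * (bcost b + B).+1) Q by exact: runs_weaken r _ _.
elim: v s I {leB'} => [|v IH] s I.
  case/boolP: (beval s b) => bs; first by have [] := body _ _ I bs.
  exists (bcost b).+1, s; split; last exact: exitQ I bs.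
    exact: ExecWhileFalse.
  by rewrite mul1n ltnS leq_addr.
case/boolP: (beval s b) => bs; last first.
  exists (bcost b).+1, s; split; last exact: exitQ I bs.
    exact: ExecWhileFalse.
  by rewrite mulSn -addSn; lia.
have [_ [t1 [s1 [e1 t1B I1]]]] := body _ _ I bs.
have [t2 [s2 [e2 t2B q]]] := IH _ I1.
exists (bcost b + t1 + t2).+1, s2; split => //; first exact: ExecWhileTrue e1 e2.
by rewrite mulSn addSn ltnS; apply: leq_add => //; rewrite leq_add2l.
Qed.

End HoareLogic.

Definition Var x := NGet x (NConst 0).
Definition RVar x := RGet x (NConst 0).
Definition BLtN e1 e2 := BLeN (NAdd e1 (NConst 1)) e2.
Definition For x e c :=
  Seq (NSet x (NConst 0) (NConst 0))
      (While (BLtN (Var x) e) (Seq c (NSet x (NConst 0) (NAdd (Var x) (NConst 1))))).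
Declare Scope cmd_scope.
Delimit Scope cmd_scope with cmd.
Local Notation "c1 ;; c2" := (Seq c1 c2) (at level 90, right associativity) : cmd_scope.
Bind Scope cmd_scope with cmd.

Definition nset (R : realType) (s : memory R) a i x :=
  Memory (update (nmem s) a i x) (rmem s).

(** The limit [e] is evaluated afresh in every round, hence the premise that the invariant fixes its
    value. [Inv i.+1] is asked of the memory after the increment, so the body accounts for the
    loop's own write to [x]. The 18 more than covers guard and increment. *)
Lemma runs_for (R : realType) x e c (B N : nat)
    (Inv : nat -> memory R -> Prop) (s : memory R) B' Q :
  (N.+1 * (B + ncost e + 18) <= B')%N ->
  (forall i s, Inv i s -> neval s e = N) ->
  Inv 0%N (nset s x 0 0) ->
  (forall i s, (i < N)%N -> nmem s x 0 = i -> Inv i s ->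
     runs c s B (fun s' => nmem s' x 0 = i /\ Inv i.+1 (nset s' x 0 i.+1))) ->
  (forall s, nmem s x 0 = N -> Inv N s -> Q s) ->
  runs (For x e c) s B' Q.
Proof.
move=> leB' eN I0 body exitQ; apply: runs_nset_seq; first by rewrite /=; lia.
pose J v s := let i := nmem s x 0 in (i + v = N)%N /\ Inv i s.
apply: (@runs_while _ J _ _ (B + 6) N).
- have : (N.+1 * (bcost (BLtN (Var x) e) + (B + 6)).+1 <= N.+1 * (B + ncost e + 15))%N.
    by rewrite leq_mul //=; lia.
  by move: leB'; rewrite /= => leB' /leq_trans; apply; lia.
- move=> v s1 [iv Ii] /=; rewrite (eN _ _ Ii) => lt_iN.
  have xN : nmem s1 x 0 = N by lia.
  by apply: exitQ; rewrite // -[in Inv _](xN).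
- move=> v s1 [iv Ii] /=; rewrite (eN _ _ Ii) => lt_iN.
  set i := nmem s1 x 0 in iv Ii lt_iN; split; first by lia.
  apply: (@runs_seq _ _ _ _ B); first by lia.
  apply: (runs_weaken (body i s1 _ _ Ii)); [lia|by []|by []|].
  move=> s2 [xi Is2]; apply: runs_nset => /=; first by lia.
  rewrite /J /= {1}/update !eqxx /= xi addn1; split; first by lia.
  by rewrite /update !eqxx.
by rewrite /J /= /update !eqxx.
Qed.

(** * Frame conditions: arrays that a program leaves unchanged *)

Section Agreement.
Context {R : realType}.
Implicit Types (s : memory R) (na ra : seq nat).

Definition agree na ra s0 s :=
  {in na, forall a, nmem s a = nmem s0 a} /\ {in ra, forall a, rmem s a = rmem s0 a}.

Lemma agree_refl na ra s : agree na ra s s.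
Proof. by split. Qed.

Lemma agree_trans na ra na' ra' s0 s1 s2 :
  agree na' ra' s0 s1 -> agree na ra s1 s2 ->
  all (mem na') na && all (mem ra') ra -> agree na ra s0 s2.
Proof.
move=> [n1 r1] [n2 r2] /andP[/allP nn /allP rr]; split => a ia.
  by rewrite n2 // n1 //; apply: nn.
by rewrite r2 // r1 //; apply: rr.
Qed.

Lemma agree_sub na ra na' ra' s0 s1 :
  agree na' ra' s0 s1 -> all (mem na') na && all (mem ra') ra -> agree na ra s0 s1.
Proof. by move=> a1; apply: agree_trans a1 (agree_refl _ _ _). Qed.

Lemma agree_nset na ra s0 f g a i x : agree na ra s0 (Memory f g) -> a \notin na ->
  agree na ra s0 (Memory (update f a i x) g).
Proof.
move=> [n1 r1] /negP a_na; split => // b bn /=.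
rewrite -(n1 b bn); apply: funext => q; rewrite /update.
by case: eqP bn => // ->.
Qed.

Lemma agree_rset na ra s0 f g a i x : agree na ra s0 (Memory f g) -> a \notin ra ->
  agree na ra s0 (Memory f (update g a i x)).
Proof.
move=> [n1 r1] /negP a_na; split => // b bn /=.
rewrite -(r1 b bn); apply: funext => q; rewrite /update.
by case: eqP bn => // ->.
Qed.

(* A multirule, so that one rewrite brings all the preserved arrays back to
   the initial memory. *)
Fixpoint rules (P : nat -> Prop) na : Type :=
  if na is a :: na' then (if na' is [::] then P a else P a * rules P na')%type
  else True.

Lemma rules_in (P : nat -> Prop) na : {in na, forall a, P a} -> rules P na.
Proof.
elim: na => [|a [|b na] IH] Pna //=; first by apply: Pna; rewrite inE.
split; first by apply: Pna; rewrite inE eqxx.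
by apply: IH => c cna; apply: Pna; rewrite inE cna orbT.
Qed.

Lemma agreeE na ra s0 s : agree na ra s0 s ->
  rules (fun a => nmem s a = nmem s0 a) na * rules (fun a => rmem s a = rmem s0 a) ra.
Proof. by move=> [n1 r1]; split; apply: rules_in. Qed.

Lemma agree_nmem na ra s0 s a : agree na ra s0 s -> a \in na -> nmem s a = nmem s0 a.
Proof. by move=> [n1 _] /n1. Qed.

Lemma agree_rmem na ra s0 s a : agree na ra s0 s -> a \in ra -> rmem s a = rmem s0 a.
Proof. by move=> [_ r1] /r1. Qed.

End Agreement.

(* Arrays of naturals are named a*, arrays of reals r*, and scalars, kept in cell 0
   of an array of their own, v*.  The k-th job in the order of the windows is
   aJob[k]; the arrays rSpeed to rVol are indexed by that rank k. *)
Local Notation aDim := 0%N (only parsing).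
Local Notation aSize := 1%N (only parsing).
Local Notation aCount := 2%N (only parsing).
Local Notation aPieceJob := 3%N (only parsing).
Local Notation aBlockJob := 4%N (only parsing).
Local Notation aBlockStart := 5%N (only parsing).
Local Notation aBlockLen := 6%N (only parsing).
Local Notation aJob := 10%N (only parsing).
Local Notation aBySpeed := 11%N (only parsing).
Local Notation aByEnd := 12%N (only parsing).
Local Notation aSegStart := 13%N (only parsing).
Local Notation aSegLen := 14%N (only parsing).
Local Notation vk := 20%N (only parsing).
Local Notation vi := 21%N (only parsing).
Local Notation vq := 22%N (only parsing).
Local Notation vh := 23%N (only parsing).
Local Notation vAvail := 24%N (only parsing).
Local Notation vNeed := 25%N (only parsing).
Local Notation vg := 26%N (only parsing).
Local Notation vSegs := 27%N (only parsing).
Local Notation vPlaced := 28%N (only parsing).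
Local Notation vTake := 29%N (only parsing).
Local Notation rRelease := 1%N (only parsing).
Local Notation rDeadline := 2%N (only parsing).
Local Notation rWork := 3%N (only parsing).
Local Notation rPieceStart := 4%N (only parsing).
Local Notation rPieceEnd := 5%N (only parsing).
Local Notation rPieceSpeed := 6%N (only parsing).
Local Notation rSpan := 10%N (only parsing).
Local Notation rSpeed := 11%N (only parsing).
Local Notation rDur := 12%N (only parsing).
Local Notation rStart := 13%N (only parsing).
Local Notation rEnd := 14%N (only parsing).
Local Notation rFront := 15%N (only parsing).
Local Notation rShift := 16%N (only parsing).
Local Notation rSegLoad := 17%N (only parsing).
Local Notation rVol := 18%N (only parsing).
Local Notation vPool := 20%N (only parsing).
Local Notation vRest := 21%N (only parsing).
Local Notation vLevel := 22%N (only parsing).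
Local Notation vRatio := 23%N (only parsing).
Local Notation vCur := 24%N (only parsing).
Local Notation vLo := 25%N (only parsing).
Local Notation vHi := 26%N (only parsing).
Local Notation vTarget := 27%N (only parsing).

Definition njobs_ := NGet aDim (NConst 0).
Definition nprocs_ := NGet aDim (NConst 1).
Definition job_ := NGet aJob (Var vk).
Definition size_ := NGet aSize job_.

(** * Insertion into a sorted array *)


Definition insert arr key len :=
  (NSet vi (NConst 0) len ;;
   While (BAnd (BLtN (NConst 0) (Var vi))
               (BNot (BLeR (RGet key (NGet arr (NSub (Var vi) (NConst 1))))
                           (RGet key (Var vk)))))
     (NSet arr (Var vi) (NGet arr (NSub (Var vi) (NConst 1))) ;;
      NSet vi (NConst 0) (NSub (Var vi) (NConst 1))) ;;
   NSet arr (Var vi) (Var vk))%cmd.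

Definition insert_at (T : Type) i (x : T) l := take i l ++ x :: drop i l.

Lemma size_insert_at (T : Type) i (x : T) l : size (insert_at i x l) = (size l).+1.
Proof. by rewrite /insert_at size_cat /= addnS -size_cat cat_take_drop. Qed.

Lemma perm_insert_at (T : eqType) i (x : T) l : perm_eq (insert_at i x l) (x :: l).
Proof. by rewrite /insert_at perm_catC /= perm_cons perm_catC cat_take_drop. Qed.

Lemma take_insert_at (T : Type) h i (x : T) l : (h <= i <= size l)%N ->
  take h (insert_at i x l) = take h l.
Proof.
move=> /andP[hi il]; rewrite /insert_at take_cat size_takel //.
case: ltngtP hi => // [hi _|-> _]; first by rewrite take_takel // ltnW.
by rewrite subnn take0 cats0.
Qed.

Lemma drop_insert_at (T : eqType) h i (x : T) l : (h <= i <= size l)%N ->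
  perm_eq (drop h (insert_at i x l)) (x :: drop h l).
Proof.
move=> /andP[hi il]; rewrite /insert_at drop_cat size_takel //.
case: ltngtP hi => // [hi _|-> _]; last by rewrite subnn drop0.
rewrite perm_catC /= perm_cons perm_catC -[l in X in perm_eq _ X](cat_take_drop i l).
by rewrite (drop_cat h (take i l)) size_takel // hi.
Qed.

Lemma pairwise_insert_at (T : Type) (r : rel T) i x l : (i <= size l)%N ->
  pairwise r l -> all (r^~ x) (take i l) -> all (r x) (drop i l) ->
  pairwise r (insert_at i x l).
Proof.
move=> il pl lx xl; have := pl; rewrite -[in X in X -> _](cat_take_drop i l).
rewrite pairwise_cat => /and3P[rr rt rd].
by rewrite /insert_at pairwise_cat /= rt rd xl allrel_consr rr lx.
Qed.

(** The strict inequality to the right of position [i] says that the new entry goes behind all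
    entries with an equal key; the timing phase relies on this. [arr] must differ from [vk] and
    [vi], which the loop reads while it writes to [arr]. *)
Lemma runs_insert (R : realType) arr key len (s : memory R) k Q :
  let l := mkseq (nmem s arr) (neval s len) in
  let f := rmem s key in
  arr \notin [:: vk; vi] -> ncost len = 2%N -> nmem s vk 0 = k ->
  pairwise (relpre f <=%R) l ->
  (forall i s', rmem s' = rmem s ->
     (forall a, a \notin [:: arr; vi] -> nmem s' a = nmem s a) ->
     (i <= size l)%N ->
     mkseq (nmem s' arr) (size l).+1 = insert_at i k l ->
     all (fun x => f x <= f k) (take i l) -> all (fun x => f k < f x) (drop i l) ->
     Q s') ->
  runs (insert arr key len) s (50 * (size l).+1) Q.
Proof.
move=> l f; rewrite !inE negb_or => /andP[/negbTE a_vk /negbTE a_vi] clen vk_k sl exitQ.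
have sz_l : size l = neval s len by rewrite size_mkseq.
apply: runs_nset_seq; first by rewrite /= clen; lia.
set s0 := Memory _ _; rewrite /= clen.
have nth_l q : (q < size l)%N -> nth 0%N l q = nmem s arr q.
  by rewrite sz_l => ?; rewrite nth_mkseq.
(* Cell [v] is a hole: below it the array is untouched, and the old entries from [v] on have moved
   up by one, all of them with a key above that of [k]. *)
pose J v (s1 : memory R) := [/\ nmem s1 vi 0 = v, (v <= size l)%N, rmem s1 = rmem s,
  forall a, a \notin [:: arr; vi] -> nmem s1 a = nmem s a &
  [/\ forall q, (q < v)%N -> nmem s1 arr q = nmem s arr q,
  forall q, (v <= q < size l)%N -> nmem s1 arr q.+1 = nmem s arr q &
  forall q, (v <= q < size l)%N -> f k < f (nmem s arr q)]].
apply: (@runs_seq _ _ _ _ ((size l).+1 * 33)); first by lia.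
apply: (@runs_while _ J _ _ 14 (size l)); first by rewrite /=; lia.
- move=> v s1 [vE vl r1 n1 [lo sh big]] /=; rewrite vE => stop.
  apply: runs_nset => /=; first by lia.
  have k1 : nmem s1 vk 0 = k by rewrite n1 // !inE eq_sym a_vk.
  rewrite vE k1.
  apply: (exitQ v) => //=.
  + move=> a; rewrite !inE negb_or => /andP[/negbTE aa /negbTE av].
    apply: funext => q; rewrite /update aa /=; apply: (congr1 (@^~ q)); apply: n1.
    by rewrite !inE aa av.
  + apply: (@eq_from_nth _ 0%N); rewrite size_mkseq ?size_insert_at // => q ql.
    rewrite nth_mkseq // /insert_at nth_cat size_takel // /update eqxx /=.
    case: ltngtP => [qv|vq|->]; last by rewrite subnn.
      by rewrite nth_take // nth_l ?lo //; lia.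
    case: q ql vq => // q ql vq; rewrite subSn //= nth_drop subnKC // nth_l ?sh //; lia.
  + apply/(all_nthP 0%N) => q; rewrite size_takel // => qv.
    rewrite nth_take // nth_l; last by lia.
    have le : f (nmem s arr v.-1) <= f k.
      move: stop; rewrite negb_and negbK -leqNgt; case/orP; first by lia.
      by rewrite r1 k1 subn1 lo //; lia.
    apply: le_trans le.
    case: (ltngtP q v.-1) => [qv1||->] //; last by lia.
    have ql : (q < size l)%N by lia.
    have vl' : (v.-1 < size l)%N by lia.
    by move/(pairwiseP 0%N): sl => /(_ q v.-1 ql vl' qv1) /=; rewrite !nth_l.
  + apply/(all_nthP 0%N) => q; rewrite size_drop => qv.
    by rewrite nth_drop nth_l ?big //; lia.
- move=> v s1 [vE vl r1 n1 [lo sh big]] /=; rewrite vE => /andP[v0].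
  have k1 : nmem s1 vk 0 = k by rewrite n1 // !inE eq_sym a_vk.
  rewrite r1 k1 subn1 -ltNge lo => [lt|]; last by lia.
  split; first by lia.
  apply: runs_nset_seq => //=; apply: runs_nset => //=.
  rewrite vE subn1 /update (eq_sym vi) a_vi /= vE subn1.
  split => //=; first by lia.
    move=> a; rewrite !inE negb_or => /andP[/negbTE aa /negbTE av].
    apply: funext => q; rewrite aa av /=; apply: (congr1 (@^~ q)); apply: n1.
    by rewrite !inE aa av.
  rewrite a_vi eqxx /=; split.
  + by move=> q qv; case: eqP => [|_]; [lia|rewrite lo //; lia].
  + move=> q qv; case: eqP => [qE|qE]; last by rewrite sh //; lia.
    by rewrite (_ : q = v.-1) ?lo //; lia.
  + move=> q qv; case: (leqP v q) => [vq|vq]; first by apply: big; lia.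
    by rewrite (_ : q = v.-1) //; lia.
- rewrite /J /s0 /=; split => //.
    move=> a; rewrite !inE negb_or => /andP[/negbTE aa /negbTE av].
    by apply: funext => q; rewrite /update av.
  rewrite /update a_vi /=; split => // q; lia.
Qed.

(** * Optimal speeds of the relaxed problem *)

Section Levels.
Context {R : realType} (w cap T : nat -> R).
Implicit Types (s X : nat -> R) (f : R -> R).

(** The last clause is the first-order optimality condition of the relaxed problem, in the processor
    times [X], asked for every nondecreasing nonnegative weight [f]. It replaces Lagrange
    multipliers, and quantifying over [f] is what makes the induction on [k] possible. *)
Definition optimal_levels s k :=
  [/\ forall i, (i < k)%N -> 0 < s i,
      forall i, (i < k)%N -> w i / s i <= cap i,
      forall i, (i < k)%N -> \sum_(l < i.+1) w l / s l <= T i &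
      forall f X, {homo f : x y / x <= y} -> (forall x, 0 <= f x) ->
        (forall i, (i < k)%N -> X i <= cap i) ->
        (forall i, (i < k)%N -> \sum_(l < i.+1) X l <= T i) ->
        \sum_(i < k) f (s i) * (X i - w i / s i) <= 0].

(** A weight splits as f(max(s, v)) = f(v) + max(f(s) - f(v), 0). The constant part is controlled by
    the new constraint, which is tight after a raise, and the truncated part is again an admissible
    weight, evaluated at the old speeds. The level 0 encodes that no raise was necessary. *)
Lemma optimal_levels_step s s' k v :
  (forall i, (i <= k)%N -> 0 < w i) -> 0 < cap k -> optimal_levels s k ->
  s k = w k / cap k -> 0 <= v ->
  (forall i, (i <= k)%N -> s' i = Num.max (s i) v) ->
  (if v == 0 then \sum_(i < k.+1) w i / s i <= T k
   else \sum_(i < k.+1) w i / s' i == T k) ->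
  optimal_levels s' k.+1.
Proof.
move=> w0 cap0 [s0 sc sT sX] sk v0 s'E sumT.
have spos i : (i <= k)%N -> 0 < s i.
  by rewrite leq_eqVlt => /orP[/eqP->|/s0//]; rewrite sk divr_gt0 ?w0.
have s'pos i : (i <= k)%N -> 0 < s' i.
  by move=> ik; rewrite s'E // lt_max spos.
have x'x i : (i <= k)%N -> w i / s' i <= w i / s i.
  move=> ik; rewrite ler_wpM2l ?(ltW (w0 _ _)) // lef_pV2 ?posrE ?s'pos ?spos //.
  by rewrite s'E // le_max lexx.
have xk : w k / s k = cap k.
  by rewrite sk invf_div mulrCA divff ?mulr1 // gt_eqF ?w0.
have xc i : (i <= k)%N -> w i / s i <= cap i.
  by rewrite leq_eqVlt => /orP[/eqP->|/sc//]; rewrite xk.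
split => //.
- by move=> i ik; apply: le_trans (xc _ _); rewrite ?x'x.
- move=> i; rewrite ltnS leq_eqVlt => /orP[/eqP->|ik].
    case: ifP sumT => [/eqP v_0 sumT|_ /eqP->//]; apply: le_trans sumT.
    by apply: ler_sum => l _; rewrite x'x // -ltnS.
  apply: le_trans (sT _ ik); apply: ler_sum => l _; apply: x'x.
  by rewrite (leq_trans _ (ltnW ik)) // -ltnS.
move=> f X fle f0 Xc XT.
(* Before the raise the new job contributes nothing positive: it enters with processor time exactly
   [cap k], and [X k] is at most [cap k]. *)
have old g : {homo g : x y / x <= y} -> (forall x, 0 <= g x) ->
    \sum_(i < k.+1) g (s i) * (X i - w i / s i) <= 0.
  move=> gle g0; rewrite big_ord_recr /= -[leRHS]addr0 lerD //.
    by apply: sX => // i ik; [apply: Xc|apply: XT]; rewrite ltnW.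
  by rewrite mulr_ge0_le0 // subr_le0 xk Xc.
have [v_0|v_neq0] := eqVneq v 0.
  have -> : \sum_(i < k.+1) f (s' i) * (X i - w i / s' i) =
            \sum_(i < k.+1) f (s i) * (X i - w i / s i).
    apply: eq_bigr => i _; have ik : (i <= k)%N by rewrite -ltnS.
    by rewrite s'E // v_0 max_l // ltW // spos.
  exact: old.
rewrite (negbTE v_neq0) in sumT; move/eqP in sumT.
(* [g (s i)] vanishes for the jobs that are raised, and the other jobs keep their processor time;
   hence the old times may stand next to [g] below. *)
pose g x := Num.max (f x - f v) 0.
have gle : {homo g : x y / x <= y}.
  move=> x y /fle xy; rewrite /g ge_max !le_max lexx orbT andbT.
  by rewrite lerD2r xy.
have -> : \sum_(i < k.+1) f (s' i) * (X i - w i / s' i) =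
    f v * (\sum_(i < k.+1) X i - T k) + \sum_(i < k.+1) g (s i) * (X i - w i / s i).
  rewrite -sumT -sumrB mulr_sumr -big_split /=; apply: eq_bigr => i _.
  have ik : (i <= k)%N by rewrite -ltnS.
  rewrite s'E // /g; case: (leP (s i) v) => [/fle siv|/ltW/fle vsi].
    by rewrite max_r ?subr_le0 // mul0r addr0.
  by rewrite max_l ?subr_ge0 //; ring.
rewrite -[leRHS]addr0 lerD ?old //; last by move=> x; rewrite /g le_max lexx orbT.
by rewrite mulr_ge0_le0 // subr_le0 XT.
Qed.

End Levels.

Lemma pairwise_mono (A : eqType) (r r' : rel A) (l : seq A) :
  {in l &, subrel r r'} -> pairwise r l -> pairwise r' l.
Proof.
elim: l => //= x l IH rr' /andP[/allP xl pl]; apply/andP; split.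
  apply/allP => y yl; apply: rr' (xl _ yl); rewrite inE ?eqxx ?yl ?orbT //.
by apply: IH pl => y z yl zl; apply: rr'; rewrite inE ?yl ?zl orbT.
Qed.

Lemma sum_perm_iota (R : realType) (F : nat -> R) (l : seq nat) k :
  perm_eq l (iota 0 k) -> \sum_(x <- l) F x = \sum_(i < k) F i.
Proof.
move=> pl; rewrite (perm_big _ pl) /= -{1}[k]subn0.
by rewrite -[iota 0 (k - 0)]/(index_iota 0 k) big_mkord.
Qed.

(** The pool [take q l] holds the slowest jobs, which are to share the speed [v] that makes the
    total processor time equal to [target]. The last two premises, the exit test and the last failed
    test of the loop, place [v] between the largest speed in the pool and the least speed outside,
    so replacing the pool's speeds by [v] is a maximum with [v]. An empty pool gives [G = 0] and
    hence [v = 0]. *)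
Lemma pool_level (R : realType) (w sp : nat -> R) (target : R) (l : seq nat) k q :
  let G := \sum_(x <- take q l) w x in
  let r := \sum_(x <- drop q l) w x / sp x in
  let v := G / (target - r) in
  let sp' i := if i \in take q l then v else sp i in
  perm_eq l (iota 0 k.+1) -> pairwise (relpre sp <=%R) l ->
  (forall i, (i <= k)%N -> 0 < sp i) -> (forall i, (i <= k)%N -> 0 < w i) ->
  0 < target -> (q <= k.+1)%N ->
  ((q <= k)%N -> G / sp (nth 0%N l q) + r <= target) ->
  ((0 < q)%N -> target < G / sp (nth 0%N l q.-1) + r) ->
  [/\ 0 <= v, forall i, (i <= k)%N -> sp' i = Num.max (sp i) v,
      (if v == 0 then \sum_(i < k.+1) w i / sp i <= target
       else \sum_(i < k.+1) w i / sp' i == target) &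
      G / v + r = \sum_(i < k.+1) w i / sp' i].
Proof.
move=> G r v sp' pl sl sp0 w0 t0 qk stop cont.
have szl : size l = k.+1 by rewrite (perm_size pl) size_iota.
have inl i : (i \in l) = (i <= k)%N by rewrite (perm_mem pl) mem_iota.
have ul : uniq l by rewrite (perm_uniq pl) iota_uniq.
have lp : pairwise (fun x y => sp x <= sp y) (take q l ++ drop q l).
  by rewrite cat_take_drop.
move: lp; rewrite pairwise_cat => /and3P[/allrelP tdr _ pd].
have uq : uniq (take q l ++ drop q l) by rewrite cat_take_drop.
have dnt i : i \in drop q l -> i \notin take q l.
  move=> id; move: uq; rewrite cat_uniq => /and3P[_ /hasPn nd _].
  exact: nd.
have tin i : i \in take q l -> (i <= k)%N by rewrite -inl; apply: mem_take.
have din i : i \in drop q l -> (i <= k)%N by rewrite -inl; apply: mem_drop.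
have sum' : \sum_(i < k.+1) w i / sp' i = G / v + r.
  rewrite -(sum_perm_iota (fun i => w i / sp' i) pl) -[in LHS](cat_take_drop q l) big_cat /=.
  congr (_ + _).
    rewrite /G mulr_suml !big_seq; apply: eq_bigr => i it.
    by rewrite /sp' it.
  rewrite /r !big_seq; apply: eq_bigr => i id.
  by rewrite /sp' (negbTE (dnt _ id)).
have rest0 : 0 <= r.
  rewrite /r big_seq; apply: sumr_ge0 => i /din ik.
  by rewrite divr_ge0 // ltW ?w0 ?sp0.
have [q0|q_gt0] := posnP q.
  have G0 : G = 0 by rewrite /G q0 take0 big_nil.
  have v0 : v = 0 by rewrite /v G0 mul0r.
  have t0n i : i \in take q l = false by rewrite q0 take0.
  split; rewrite ?v0 ?eqxx //.
  - by move=> i ik; rewrite /sp' t0n max_l // ltW // sp0.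
  - have := stop; rewrite q0 => /(_ isT); rewrite G0 mul0r add0r.
    by rewrite /r q0 drop0 (sum_perm_iota (fun i => w i / sp i) pl).
  - by rewrite sum' v0.
have lastq : nth 0%N l q.-1 \in take q l.
  by rewrite -(nth_take 0%N (n0 := q)) ?mem_nth ?size_takel ?szl //; lia.
have G0 : 0 < G.
  rewrite /G (big_rem _ lastq) /= ltr_pwDl ?w0 ?tin //.
  by rewrite big_seq; apply: sumr_ge0 => i /mem_rem /tin ik; rewrite ltW ?w0.
(* Some processor time is left for the pool: either the pool contains every job and [r] is 0, or the
   exit test makes room for the positive volume [G]. *)
have tr : 0 < target - r.
  rewrite subr_gt0; move: qk; rewrite leq_eqVlt => /orP[/eqP qE|qk].
    by rewrite /r qE drop_oversize ?szl // big_nil.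
  apply: lt_le_trans (stop _); rewrite ?ltnS // ltrDr divr_gt0 // sp0 //.
  by rewrite -inl mem_nth // szl.
have v0 : 0 < v by rewrite divr_gt0.
have Gv : G / v + r = target.
  by rewrite /v invf_div mulrCA divff ?gt_eqF // mulr1 subrK.
split; rewrite ?(gt_eqF v0) ?sum' ?Gv // ?ltW // => i ik.
have : i \in l by rewrite inl.
rewrite -[in X in X -> _](cat_take_drop q l) mem_cat /sp'.
have [it _|_ /= id] := boolP (i \in take q l).
  rewrite max_r //.
  have siq : sp i <= sp (nth 0%N l q.-1).
    move: (it) => /(nthP 0%N)[j]; rewrite size_takel ?szl // => jq <-.
    rewrite (nth_take _ jq); have [-> |jq1] := eqVneq j q.-1; first exact: lexx.
    have {}jq1 : (j < q.-1)%N by rewrite ltn_neqAle jq1 -ltnS prednK.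
    have jl : (j < size l)%N by rewrite szl (leq_trans jq).
    have ql : (q.-1 < size l)%N by rewrite szl prednK.
    by have /(pairwiseP 0%N)/(_ j q.-1 jl ql jq1) := sl.
  have sq := sp0 _ (tin _ lastq).
  apply: le_trans siq _; rewrite /v ler_pdivlMr // mulrC -ler_pdivlMr //.
  by rewrite lerBlDr ltW // cont.
rewrite max_l //.
have qk' : (q <= k)%N.
  by rewrite leqNgt; apply: contraL id => kq; rewrite drop_oversize // szl.
have dE : drop q l = nth 0%N l q :: drop q.+1 l by rewrite -drop_nth // szl ltnS.
have sqi : sp (nth 0%N l q) <= sp i.
  move: id pd; rewrite dE inE => /orP[/eqP->//|id] /= /andP[/allP/(_ _ id)].
  by [].
have sq : 0 < sp (nth 0%N l q) by rewrite sp0 // din // dE inE eqxx.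
apply: le_trans sqi; rewrite /v ler_pdivrMr // mulrC -ler_pdivrMr //.
by rewrite lerBrDr stop.
Qed.

(** * Loops that find the level and raise the slowest jobs to it *)

Definition pool_loop :=
  (While (BAnd (BLeN (Var vq) (Var vk))
               (BNot (BLeR (RAdd (RDiv (RVar vPool) (RGet rSpeed (NGet aBySpeed (Var vq))))
                                 (RVar vRest)) (RVar vTarget))))
     (RSet vPool (NConst 0) (RAdd (RVar vPool) (RGet rVol (NGet aBySpeed (Var vq)))) ;;
      RSet vRest (NConst 0)
        (RSub (RVar vRest) (RDiv (RGet rVol (NGet aBySpeed (Var vq)))
                                 (RGet rSpeed (NGet aBySpeed (Var vq))))) ;;
      NSet vq (NConst 0) (NAdd (Var vq) (NConst 1))))%cmd.

Definition raise_loop :=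
  For vg (Var vq) (RSet rSpeed (NGet aBySpeed (Var vg)) (RVar vLevel)).

Section SpeedLoops.
Context {R : realType}.

Lemma runs_pool_loop (s : memory R) k Q :
  let l := mkseq (nmem s aBySpeed) k.+1 in
  let w := rmem s rVol in let sp := rmem s rSpeed in
  let target := rmem s vTarget 0 in
  nmem s vk 0 = k -> nmem s vq 0 = 0%N -> rmem s vPool 0 = 0 ->
  rmem s vRest 0 = \sum_(x <- l) w x / sp x ->
  {in l, forall x, 0 < sp x} ->
  (forall s' q,
     agree [:: aDim; aSize; aJob; aBySpeed; vk]
           [:: rRelease; rDeadline; rWork; rSpan; rSpeed; rVol; vTarget] s s' ->
     let G := rmem s' vPool 0 in let r := rmem s' vRest 0 in
     nmem s' vq 0 = q -> (q <= k.+1)%N ->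
     G = \sum_(x <- take q l) w x ->
     r = \sum_(x <- drop q l) w x / sp x ->
     ((q <= k)%N -> G / sp (nth 0%N l q) + r <= target) ->
     ((0 < q)%N -> target < G / sp (nth 0%N l q.-1) + r) ->
     Q s') ->
  runs pool_loop s (60 * k.+2) Q.
Proof.
move=> l w sp target ks qs Gs rs sp0 exitQ.
have [l' l'E] : {l' | l' = l} by exists l.
have sz_l : size l = k.+1 by rewrite size_mkseq.
rewrite -l'E in rs sp0 exitQ sz_l *.
have nth_l q : (q <= k)%N -> nth 0%N l' q = nmem s aBySpeed q.
  by move=> qk; rewrite l'E nth_mkseq.
move: l {l'E} => _; rename l' into l.
pose J v (s1 : memory R) := let q := nmem s1 vq 0 in
  [/\ (q + v = k.+1)%N,
   agree [:: aDim; aSize; aJob; aBySpeed; vk]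
         [:: rRelease; rDeadline; rWork; rSpan; rSpeed; rVol; vTarget] s s1,
   rmem s1 vPool 0 = \sum_(x <- take q l) w x,
   rmem s1 vRest 0 = \sum_(x <- drop q l) w x / sp x &
   (0 < q)%N -> target < rmem s1 vPool 0 / sp (nth 0%N l q.-1) + rmem s1 vRest 0].
apply: (@runs_while _ J _ _ 35 k.+1); first by rewrite /=; lia.
- move=> v s1 [qv ag GE rE lt].
  have /= E := agreeE ag.
  rewrite /= !E -/sp -/target ks => stop.
  apply: (exitQ s1 (nmem s1 vq 0)) => //; first by lia.
  move=> qk; move: stop; rewrite qk /= negbK.
  by rewrite nth_l.
- move=> v s1 [qv ag GE rE lt].
  have /= E := agreeE ag.
  rewrite /= !E -/sp -/target ks => /andP[qk].
  rewrite -ltNge => cont; split; first by lia.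
  set q := nmem s1 vq 0 in qv GE rE lt qk cont *.
  apply: runs_rset_seq => //=; apply: runs_rset_seq => //=.
  apply: runs_nset => //=.
  have nthq := nth_l _ qk.
  have dE : drop q l = nmem s aBySpeed q :: drop q.+1 l.
    by rewrite (drop_nth 0%N) ?nthq // sz_l ltnS.
  rewrite !E -/sp -/w.
  have sq : 0 < sp (nmem s aBySpeed q).
    by apply: sp0; rewrite -nthq mem_nth // sz_l ltnS.
  rewrite /J addn1; split.
  + by rewrite /update /=; lia.
  + by do ![apply: agree_nset => //|apply: agree_rset => //].
  + by rewrite /update /= (take_nth 0%N) ?sz_l ?ltnS // big_rcons /= nthq GE.
  + by rewrite /update /= !E rE -/q dE big_cons addrC addKr.
  (* A job that joins the pool at its own speed leaves the total processor time as it was, so the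
     test that failed for [q] is the lower estimate for [q.+1]. *)
  + move=> _; rewrite /update /= !E nthq; apply: lt_le_trans cont _.
    by rewrite mulrDl -/q -/w -/sp; lra.
rewrite /J qs /= take0 drop0 big_nil; split => //; exact: agree_refl.
Qed.

Lemma runs_raise_loop (s : memory R) q Q :
  let so := nmem s aBySpeed in
  nmem s vq 0 = q ->
  (forall s', agree [:: aDim; aSize; aJob; aBySpeed; vk]
                    [:: rRelease; rDeadline; rWork; rSpan; rVol; vRest] s s' ->
     (forall x, rmem s' rSpeed x = if x \in mkseq so q then rmem s vLevel 0
                                   else rmem s rSpeed x) -> Q s') ->
  runs raise_loop s (60 * q.+1) Q.
Proof.
move=> so qs exitQ.
pose J i (s1 : memory R) :=
   agree [:: aDim; aSize; aJob; aBySpeed; vk; vq]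
         [:: rRelease; rDeadline; rWork; rSpan; rVol; vRest; vLevel] s s1 /\
   (forall x, rmem s1 rSpeed x = if x \in mkseq so i then rmem s vLevel 0
                                   else rmem s rSpeed x).
apply: (@runs_for _ _ _ _ 20 q J) => //.
- rewrite /=; lia.
- by move=> i s1 [ag _]; have /= E := agreeE ag; rewrite /= !E.
- by split => //; apply: agree_nset => //; exact: agree_refl.
- move=> i s1 iq gi [ag sE]; apply: runs_rset => //=; split => //; split.
    by do ![apply: agree_nset => //|apply: agree_rset => //].
  move=> x; have /= E := agreeE ag; rewrite /= /update eqxx /= gi !E.
  by rewrite sE mkseqS mem_rcons inE; case: eqP.
- move=> s1 _ [ag sE]; apply: exitQ => //; exact: agree_sub ag _.
Qed.

End SpeedLoops.

(** * Sorting the jobs by window length *)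

Definition sort_phase :=
  For vk njobs_
    (RSet rSpan (Var vk) (RSub (RGet rDeadline (Var vk)) (RGet rRelease (Var vk))) ;;
     insert aJob rSpan (Var vk))%cmd.

Lemma runs_sort_phase (R : realType) (s0 : memory R) Q :
  let n := nmem s0 aDim 0 in
  let D j := rmem s0 rDeadline j - rmem s0 rRelease j in
  (forall s, agree [:: aDim; aSize] [:: rRelease; rDeadline; rWork] s0 s ->
     (forall j, (j < n)%N -> rmem s rSpan j = D j) ->
     perm_eq (mkseq (nmem s aJob) n) (iota 0 n) ->
     pairwise (relpre D <=%R) (mkseq (nmem s aJob) n) -> Q s) ->
  runs sort_phase s0 (100 * n.+1 ^ 2) Q.
Proof.
move=> n D exitQ.
pose J k (s : memory R) := [/\
  agree [:: aDim; aSize] [:: rRelease; rDeadline; rWork] s0 s,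
  forall j, (j < k)%N -> rmem s rSpan j = D j,
  perm_eq (mkseq (nmem s aJob) k) (iota 0 k) &
  pairwise (relpre D <=%R) (mkseq (nmem s aJob) k)].
apply: (@runs_for _ _ _ _ (60 * n.+1) n J).
- by rewrite /=; clear; nia.
- by move=> i s [ag _ _ _]; have /= E := agreeE ag; rewrite /= E.
- by split => //; rewrite /nset; apply: agree_nset => //; exact: agree_refl.
- move=> k s lt_kn ks [ag span pl sl].
  have /= E := agreeE ag.
  apply: runs_rset_seq; first by rewrite /=; lia.
  set s1 := Memory _ _.
  have szl : size (mkseq (nmem s1 aJob) k) = k by rewrite size_mkseq.
  have span1 j : (j <= k)%N -> rmem s1 rSpan j = D j.
    rewrite /= /update /= !E ks leq_eqVlt => /orP[/eqP->|jk]; first by rewrite eqxx.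
    by rewrite (ltn_eqF jk) span.
  have inl j : (j \in mkseq (nmem s aJob) k) = (j < k)%N.
    by rewrite (perm_mem pl) mem_iota.
  have ag1 : agree [:: aDim; aSize] [:: rRelease; rDeadline; rWork] s0 s1.
    by do ![apply: agree_nset => //|apply: agree_rset => //].
  have k1 : nmem s1 vk 0 = k by [].
  have job1 : nmem s1 aJob = nmem s aJob by [].
  set B := (_ - _)%N.
  have leB : (50 * k.+1 <= B)%N by rewrite /B /=; clear -lt_kn; lia.
  move: B leB; clearbody s1 => B leB.
  apply: (@runs_weaken _ _ _ (50 * k.+1) _ _ _ _ _ (fun _ => id)) => //.
  rewrite -{1}szl -{1}k1; apply: runs_insert => //=; rewrite k1 // job1.
    apply: pairwise_mono sl => i j; rewrite !inl => ik jk.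
    move=> le_ij; have : D i <= D j := le_ij.
    by rewrite -(span1 i (ltnW ik)) -(span1 j (ltnW jk)).
  rewrite size_mkseq => p s2 r2 n2 pk l2E lte ltd.
  have pl2 : perm_eq (mkseq (nmem s2 aJob) k.+1) (iota 0 k.+1).
    rewrite l2E (perm_trans (perm_insert_at _ _ _)) // -[k.+1]addn1 iotaD add0n cats1.
    by rewrite perm_sym perm_rcons perm_cons perm_sym.
  split; first by rewrite n2.
  split.
  + rewrite /nset; apply: agree_nset => //.
    by apply: agree_trans ag1 _ _ => //; split => a ia; rewrite ?r2 // n2 //;
      move: ia; rewrite !inE => /orP[] /eqP->.
  + by move=> j jk; rewrite /= r2 span1.
  + by [].
  + rewrite [nmem _ _]/= l2E; apply: pairwise_insert_at => //.
    * by rewrite size_mkseq.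
    * apply/allP => j jp; have := allP lte _ jp.
      by rewrite span1 ?span1 //; apply: ltnW; rewrite -inl; exact: mem_take jp.
    * apply/allP => j jp; have /ltW := allP ltd _ jp.
      by rewrite span1 ?span1 //; apply: ltnW; rewrite -inl; exact: mem_drop jp.
- by move=> s _ [a1 a2 a3 a4]; apply: exitQ.
Qed.

(** * Computing the speeds, one job at a time *)

Definition level_body :=
  (RSet rSpeed (Var vk) (RDiv (RGet rWork job_) (RGet rSpan job_)) ;;
   RSet rVol (Var vk) (RMul (ROfNat size_) (RGet rWork job_)) ;;
   RSet vRest (NConst 0)
     (RAdd (RVar vRest) (RDiv (RGet rVol (Var vk)) (RGet rSpeed (Var vk)))) ;;
   RSet vTarget (NConst 0) (RMul (ROfNat nprocs_) (RGet rSpan job_)) ;;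
   RSet vPool (NConst 0) (ROfNat (NConst 0)) ;;
   NSet vq (NConst 0) (NConst 0) ;;
   insert aBySpeed rSpeed (Var vk) ;;
   pool_loop ;;
   RSet vLevel (NConst 0) (RDiv (RVar vPool) (RSub (RVar vTarget) (RVar vRest))) ;;
   RSet vRest (NConst 0) (RAdd (RDiv (RVar vPool) (RVar vLevel)) (RVar vRest)) ;;
   raise_loop)%cmd.

Definition level_phase :=
  (RSet vRest (NConst 0) (ROfNat (NConst 0)) ;; For vk njobs_ level_body)%cmd.

Section LevelPhase.
Context {R : realType} (s0 : memory R).
Let n := nmem s0 aDim 0.
Let m := nmem s0 aDim 1.
Let job := nmem s0 aJob.
Let sz k := nmem s0 aSize (job k).
Let W k := rmem s0 rWork (job k).
Let D k := rmem s0 rSpan (job k).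
Let w k := (sz k)%:R * W k.
Let cap k := (sz k)%:R * D k.
Let T k := m%:R * D k.

Definition level_inv k (s : memory R) :=
  let sp := rmem s rSpeed in let l := mkseq (nmem s aBySpeed) k in
  [/\ agree [:: aDim; aSize; aJob] [:: rRelease; rDeadline; rWork; rSpan] s0 s,
      optimal_levels w cap T sp k,
      forall i, (i < k)%N -> rmem s rVol i = w i,
      rmem s vRest 0 = \sum_(i < k) w i / sp i &
      perm_eq l (iota 0 k) /\ pairwise (relpre sp <=%R) l].

(** Between rounds [vRest] is the total processor time of the jobs added so far. If the pool is
    empty, then [vLevel] is 0 and [vPool / vLevel] is 0 by the convention on division, so the update
    of [vRest] is right in this case too. *)
Lemma runs_level_body k (s : memory R) Q :
  (0 < m)%N ->
  (forall i, (i <= k)%N -> [/\ (0 < sz i)%N, 0 < W i & 0 < D i]) ->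
  nmem s vk 0 = k -> level_inv k s ->
  (forall s', nmem s' vk 0 = k -> level_inv k.+1 s' -> Q s') ->
  runs level_body s (400 * k.+1) Q.
Proof.
move=> m0 pos ks [ag opt vol rest [pl sl]] exitQ.
have w0 i : (i <= k)%N -> 0 < w i by move=> /pos[? ? ?]; rewrite mulr_gt0 // ltr0n.
have cap0 : 0 < cap k by have [? ? ?] := pos k (leqnn k); rewrite mulr_gt0 // ltr0n.
have T0 : 0 < T k by have [? ? ?] := pos k (leqnn k); rewrite mulr_gt0 // ltr0n.
pose sp i := if i == k then W k / D k else rmem s rSpeed i.
have spk : sp k = w k / cap k.
  have [sz0 _ D0] := pos k (leqnn k).
  rewrite /sp eqxx /w /cap invfM mulrACA divff ?mul1r //.
  by rewrite pnatr_eq0 -lt0n.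
have sp_lt i : (i < k)%N -> sp i = rmem s rSpeed i.
  by rewrite /sp => /ltn_eqF ->.
have sp0 i : (i <= k)%N -> 0 < sp i.
  rewrite leq_eqVlt => /orP[/eqP->|ik]; first by rewrite spk divr_gt0 // w0.
  by rewrite sp_lt //; case: opt => + _ _ _; apply.
have /= E := agreeE ag.
have jobE : neval s job_ = job k by rewrite /= ks E.
have sum_sp : \sum_(i < k.+1) w i / sp i = rmem s vRest 0 + w k / (W k / D k).
  rewrite big_ord_recr /= {2}/sp eqxx rest; congr (_ + _).
  by apply: eq_bigr => i _; rewrite sp_lt.
(* The budget is split into the insertion, the pool loop, the raising loop (with at most k + 1
   rounds) and a remainder for the single assignments. *)
rewrite (_ : 400 * k.+1 = 60 + (50 * k.+1 + 60 * k.+2 + 60 * k.+2 + (230 * k.+1 - 180)))%N; last by lia.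
do 5 (apply: runs_rset_seq; first by rewrite /=; lia).
apply: runs_nset_seq; first by rewrite /=; lia.
apply: (@runs_seq _ _ _ _ (50 * k.+1)); first by rewrite /=; lia.
set s1 := Memory _ _.
have sp1 : rmem s1 rSpeed = sp.
  by apply: funext => i; rewrite /= /update /= !E ks.
have vol1 i : (i <= k)%N -> rmem s1 rVol i = w i.
  rewrite /= /update /= !E ks leq_eqVlt => /orP[/eqP->|ik]; first by rewrite eqxx.
  by rewrite (ltn_eqF ik) vol.
have rest1 : rmem s1 vRest 0 = \sum_(i < k.+1) w i / sp i.
  by rewrite sum_sp /= /update /= !E ks !eqxx.
have target1 : rmem s1 vTarget 0 = T k by rewrite /= /update /= !E ks.
have pool1 : rmem s1 vPool 0 = 0 by [].
have by1 : nmem s1 aBySpeed = nmem s aBySpeed by [].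
have ag1 : agree [:: aDim; aSize; aJob] [:: rRelease; rDeadline; rWork; rSpan] s0 s1.
  by do ![apply: agree_nset => //|apply: agree_rset => //].
have k1 : nmem s1 vk 0 = k by [].
have q1 : nmem s1 vq 0 = 0%N by [].
set rem := (_ - _)%N.
have : (60 * k.+2 + 60 * k.+2 + (230 * k.+1 - 180) <= rem)%N.
  by rewrite /rem /=; clear; lia.
move: rem; move: s1 sp1 vol1 rest1 target1 pool1 by1 ag1 k1 q1.
move=> s1 sp1 vol1 rest1 target1 pool1 by1 ag1 k1 q1 B leB.
have szl : size (mkseq (nmem s1 aBySpeed) k) = k by rewrite size_mkseq.
rewrite -[X in (50 * X.+1)%N]szl -{1}k1.
apply: runs_insert => //=; rewrite k1 //.
  rewrite by1 sp1; apply: pairwise_mono sl => i j.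
  by rewrite !(perm_mem pl) !mem_iota /= add0n => ik jk; rewrite !sp_lt.
rewrite szl by1 sp1 => p s2 r2 n2 pk l2E lte ltd.
have szk : size (mkseq (nmem s aBySpeed) k) = k by rewrite size_mkseq.
have pl2 : perm_eq (mkseq (nmem s2 aBySpeed) k.+1) (iota 0 k.+1).
  rewrite l2E (perm_trans (perm_insert_at _ _ _)) // -[k.+1]addn1 iotaD add0n cats1.
  by rewrite perm_sym perm_rcons perm_cons perm_sym.
have sl2 : pairwise (relpre sp <=%R) (mkseq (nmem s2 aBySpeed) k.+1).
  rewrite l2E; apply: pairwise_insert_at => //.
  - by rewrite szk.
  - apply: pairwise_mono sl => i j.
    by rewrite !(perm_mem pl) !mem_iota /= add0n => ik jk; rewrite !sp_lt.
  - by apply: sub_all ltd => x /ltW.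
have k2 : nmem s2 vk 0 = k by rewrite n2.
have q2 : nmem s2 vq 0 = 0%N by rewrite n2.
have ag2 : agree [:: aDim; aSize; aJob] [:: rRelease; rDeadline; rWork; rSpan] s0 s2.
  by apply: agree_trans ag1 _ _ => //; split => a ia; rewrite ?r2 // n2 //;
     move: ia; rewrite !inE => /or3P[] /eqP->.
apply: (@runs_seq _ _ _ _ (60 * k.+2)); first by clear -leB; lia.
have target2 : rmem s2 vTarget 0 = T k by rewrite r2.
have rest2 : rmem s2 vRest 0 = \sum_(i < k.+1) w i / sp i by rewrite r2.
apply: runs_pool_loop => //.
- by rewrite r2.
- rewrite rest2 -(sum_perm_iota (fun i => w i / sp i) pl2) !big_seq.
  apply: eq_bigr => i; rewrite (perm_mem pl2) mem_iota add0n => /andP[_ ik].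
  by rewrite r2 vol1 // sp1.
- move=> i; rewrite (perm_mem pl2) mem_iota add0n r2 sp1 => /andP[_ ik].
  exact: sp0.
rewrite r2 sp1 target1.
set l := mkseq _ _ in pl2 sl2 *.
move=> s3 q ag3 /= q3 qk G3 R3 stop cont.
have inl i : i \in l -> (i <= k)%N.
  by rewrite (perm_mem pl2) mem_iota add0n => /andP[].
have volE : {in l, rmem s1 rVol =1 w} by move=> i /inl; exact: vol1.
have {}G3 : rmem s3 vPool 0 = \sum_(x <- take q l) w x.
  rewrite G3 !big_seq; apply: eq_bigr => i it; apply: volE.
  exact: mem_take it.
have {}R3 : rmem s3 vRest 0 = \sum_(x <- drop q l) w x / sp x.
  rewrite R3 !big_seq; apply: eq_bigr => i it; rewrite volE //.
  exact: mem_drop it.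
rewrite G3 R3 in stop cont.
have [v0 spE lev sumE] := pool_level pl2 sl2 sp0 w0 T0 qk stop cont.
have /= E3 := agreeE ag3.
have ag3' : agree [:: aDim; aSize; aJob] [:: rRelease; rDeadline; rWork; rSpan] s0 s3.
  by apply: agree_trans ag2 _ _; [exact: agree_sub ag3 _|].
do 2 (apply: runs_rset_seq; first by rewrite /=; clear -leB; lia).
set s4 := Memory _ _.
have k4 : nmem s4 vk 0 = k by rewrite /= E3.
have q4 : nmem s4 vq 0 = q by [].
have by4 : nmem s4 aBySpeed = nmem s2 aBySpeed by rewrite /= E3.
have sp4 : rmem s4 rSpeed = sp by rewrite /= /update /= E3 r2 sp1.
have vol4 : rmem s4 rVol = rmem s1 rVol by rewrite /= /update /= E3 r2.
have lev4 : rmem s4 vLevel 0 = rmem s3 vPool 0 / (T k - rmem s3 vRest 0).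
  by rewrite /= /update /= E3 r2 target1.
have rest4 : rmem s4 vRest 0 = rmem s3 vPool 0 / rmem s4 vLevel 0 + rmem s3 vRest 0.
  by rewrite lev4 /= /update /= E3 r2 target1.
have ag4 : agree [:: aDim; aSize; aJob] [:: rRelease; rDeadline; rWork; rSpan] s0 s4.
  by do ![apply: agree_nset => //|apply: agree_rset => //].
clearbody s4; set B' := (_ - _)%N.
have B'E : (60 * q.+1 <= B')%N by rewrite /B' /=; clear -leB qk; lia.
rewrite G3 R3 in lev4 rest4.
apply: runs_weaken B'E (fun _ => id); apply: (runs_raise_loop q4).
rewrite by4 sp4 lev4 => s5 ag5 sp5.
have takeE : take q l = mkseq (nmem s2 aBySpeed) q.
  by rewrite /l -map_take take_iota; congr map; congr iota; apply/minn_idPl.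
rewrite -takeE in sp5.
have /= E5 := agreeE ag5.
pose v := (\sum_(x <- take q l) w x) / (T k - \sum_(x <- drop q l) w x / sp x).
have sp5E : forall i, (i <= k)%N -> rmem s5 rSpeed i = Num.max (sp i) v.
  by move=> i ik; rewrite sp5; apply: spE.
apply: exitQ; first by rewrite E5.
have l5 : mkseq (nmem s5 aBySpeed) k.+1 = l by rewrite E5 by4.
split; rewrite ?l5.
- by apply: agree_trans ag4 _ _; [exact: agree_sub ag5 _|].
- apply: (optimal_levels_step w0 cap0 _ spk v0) => //.
    case: opt => o1 o2 o3 o4; split.
    + by move=> i ik; rewrite sp_lt // o1.
    + by move=> i ik; rewrite sp_lt // o2.
    + move=> i ik; apply: le_trans (o3 _ ik); apply: ler_sum => j _.
      by rewrite sp_lt // (leq_trans (ltn_ord j)).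
    + move=> f X f1 f2 X1 X2; apply: le_trans (o4 f X f1 f2 X1 X2).
      by apply: ler_sum => j _; rewrite sp_lt.
  move: lev; case: ifP => // _ /eqP <-; apply/eqP/eq_bigr => i _.
  by rewrite sp5.
- by move=> i ik; rewrite E5 vol4 vol1.
- rewrite E5 rest4 lev4 sumE; apply: eq_bigr => i _.
  by rewrite sp5.
(* A maximum with a constant preserves order, so [aBySpeed] stays sorted after the raise and each
   job costs a single insertion. *)
- split => //; apply: pairwise_mono sl2 => i j /inl ik /inl jk /= le_ij.
  by rewrite !sp5E // ge_max !le_max le_ij lexx orbT.
Qed.

Lemma runs_level_phase Q :
  (0 < m)%N ->
  (forall i, (i < n)%N -> [/\ (0 < sz i)%N, 0 < W i & 0 < D i]) ->
  (forall s, agree [:: aDim; aSize; aJob] [:: rRelease; rDeadline; rWork; rSpan] s0 s ->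
     optimal_levels w cap T (rmem s rSpeed) n -> Q s) ->
  runs level_phase s0 (500 * n.+1 ^ 2) Q.
Proof.
move=> m0 pos exitQ; apply: runs_rset_seq; first by rewrite /=; lia.
apply: (@runs_for _ _ _ _ (400 * n.+1) n level_inv).
- by rewrite /=; nia.
- by move=> i s [ag _ _ _ _]; have /= E := agreeE ag; rewrite /= E.
- split => //=.
  + rewrite /nset; do ![apply: agree_nset => //|apply: agree_rset => //]; exact: agree_refl.
  + by split => // f X _ _ _ _; rewrite big_ord0.
  + by rewrite big_ord0.
- move=> i s lt_in ki inv.
  apply: runs_weaken (runs_level_body m0 _ ki inv (Q := _) _) _ (fun _ => id).
  + by move=> j ji; apply: pos; apply: leq_ltn_trans ji lt_in.
  + move=> s' k' [a1 a2 a3 a4 a5]; split; first exact: k'.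
    by split => //; rewrite /nset; do ![apply: agree_nset => //|apply: agree_rset => //].
  + by rewrite leq_mul // ltnS ltnW.
- by move=> s _ [a1 a2 _ _ _]; apply: exitQ.
Qed.

End LevelPhase.

(** * Starting times of the small jobs *)

Section Clock.
Context {R : realType} (sz : nat -> nat) (m : nat).
Implicit Types (e : seq nat) (C : nat -> R) (A cur : R) (h avail : nat).

(* The jobs in e are sorted by completion time, the first h of them are known to
   be complete at the current time cur, and A bounds the processor time of the
   started jobs.  The last inequality says that more than half of the processors
   have been busy until cur. *)
Definition clock e C A h cur avail :=
  [/\ (h <= size e)%N, {in take h e, forall x, C x <= cur},
      {in drop h e, forall x, cur <= C x},
      (avail + \sum_(x <- drop h e) sz x)%N = m &
      0 <= cur /\
      cur * (m.+1)%:R / 2 + \sum_(x <- drop h e) (sz x)%:R * (C x - cur) <= A].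

(** Fewer than [z] processors are free and [z] is at most m/2, so at least (m+1)/2 are busy; in
    particular some job is still running. Moving the clock to its end therefore adds to the first
    term of the area inequality no more than the remaining processor time loses. *)
Lemma clock_release e C A h cur avail z :
  pairwise (relpre C <=%R) e -> clock e C A h cur avail ->
  (avail < z)%N -> (z + z <= m)%N ->
  (h < size e)%N /\
  clock e C A h.+1 (C (nth 0%N e h)) (avail + sz (nth 0%N e h)).
Proof.
move=> se [hs done busy sumz [cur0 area]] az zm.
have h_lt : (h < size e)%N.
  rewrite ltnNge; apply/negP => eh; move: sumz.
  by rewrite drop_oversize // big_nil => sumz; lia.
split => //; set x := nth 0%N e h.
have dE : drop h e = x :: drop h.+1 e by rewrite -drop_nth.
have curx : cur <= C x by apply: busy; rewrite dE inE eqxx.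
have later y : y \in drop h.+1 e -> C x <= C y.
  have : pairwise (relpre C <=%R) (drop h e).
    by move: se; rewrite -{1}(cat_take_drop h e) pairwise_cat => /and3P[].
  by rewrite dE /= => /andP[/allP xle _] /xle.
split => //.
- move=> y; rewrite (take_nth 0%N) // mem_rcons inE => /orP[/eqP->//|/done ycur].
  exact: le_trans ycur curx.
- by rewrite -addnA -sumz dE big_cons.
split; first exact: le_trans curx.
apply: le_trans area; rewrite dE big_cons.
have -> : \sum_(y <- drop h.+1 e) (sz y)%:R * (C y - cur) =
   \sum_(y <- drop h.+1 e) (sz y)%:R * (C y - C x) +
   (\sum_(y <- drop h.+1 e) sz y)%:R * (C x - cur).
  rewrite natr_sum mulr_suml -big_split /=; apply: eq_bigr => y _.
  by rewrite -mulrDr addrA subrK.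
move: sumz; rewrite dE big_cons; set rest := (\sum_(y <- _) sz y)%N => sumz.
set tail := \sum_(y <- _) _.
have : (m.+1)%:R / 2 <= (sz x + rest)%:R :> R.
  rewrite ler_pdivrMr // -natrM ler_nat; lia.
move=> half; have := mulr_ge0 (_ : 0 <= (sz x + rest)%:R - (m.+1)%:R / 2 :> R)
  (_ : 0 <= C x - cur).
rewrite !subr_ge0 => /(_ half curx); rewrite natrD => ?.
nra.
Qed.

(** The job starts at the current time, so both sides of the area inequality grow by [z * P].
    Inserting it behind position [h] keeps the completed jobs a prefix of the list. *)
Lemma clock_place e C C' A h cur avail z k p P :
  clock e C A h cur avail -> (z <= avail)%N -> sz k = z -> 0 <= P ->
  C' k = cur + P -> {in e, C' =1 C} -> (h <= p <= size e)%N ->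
  clock (insert_at p k e) C' (A + z%:R * P) h cur (avail - z).
Proof.
move=> [hs done busy sumz [cur0 area]] za szk P0 Ck CC hp.
have pd := drop_insert_at k hp.
split.
- by rewrite size_insert_at; apply: leqW.
- rewrite take_insert_at // => x xt.
  by rewrite CC ?done // (mem_take xt).
- move=> x; rewrite (perm_mem pd) inE => /orP[/eqP->|xd].
    by rewrite Ck lerDl.
  by rewrite CC ?busy // (mem_drop xd).
- by rewrite (perm_big _ pd) /= big_cons szk; lia.
split => //; rewrite (perm_big _ pd) /= big_cons szk Ck.
rewrite [X in _ + (_ + X)](_ : _ = \sum_(x <- drop h e) (sz x)%:R * (C x - cur)).
  by rewrite (addrC cur) addrK [X in _ + X]addrC addrA lerD2r.
rewrite !big_seq; apply: eq_bigr => x xd.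
by rewrite CC // (mem_drop xd).
Qed.

(** These are the two facts that [timing] records of a start. The second is only an inequality, as a
    job that ends exactly at [cur] may not have been released yet. *)
Lemma clock_bounds e C A h cur avail :
  clock e C A h cur avail ->
  cur * (m.+1)%:R / 2 <= A /\ (avail + \sum_(x <- e | (cur < C x)%R) sz x <= m)%N.
Proof.
move=> [hs done busy sumz [cur0 area]]; split.
  apply: le_trans area; rewrite lerDl big_seq; apply: sumr_ge0 => x /busy xle.
  by rewrite mulr_ge0 // subr_ge0.
rewrite -[in leqRHS]sumz leq_add2l -{1}(cat_take_drop h e) big_cat /=.
rewrite big_seq_cond big_pred0 ?add0n.
  by rewrite big_mkcond /=; apply: leq_sum => x _; case: ifP.
by move=> x; apply/negP => /andP[/done xle]; rewrite ltNge xle.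
Qed.

End Clock.

(** * Program for the starting times *)

Definition release_loop :=
  (While (BLtN (Var vAvail) size_)
     (RSet vCur (NConst 0) (RGet rEnd (NGet aByEnd (Var vh))) ;;
      NSet vAvail (NConst 0)
        (NAdd (Var vAvail) (NGet aSize (NGet aJob (NGet aByEnd (Var vh))))) ;;
      NSet vh (NConst 0) (NAdd (Var vh) (NConst 1))))%cmd.

Definition small_ := BLeN (NAdd size_ size_) nprocs_.
Definition next_ := NAdd (Var vk) (NConst 1).

Definition timing_body :=
  (RSet rDur (Var vk)
     (RDiv (RGet rWork job_) (RMul (RVar vRatio) (RGet rSpeed (Var vk)))) ;;
   If small_
     (release_loop ;;
      RSet rStart (Var vk) (RVar vCur) ;;
      RSet rEnd (Var vk) (RAdd (RVar vCur) (RGet rDur (Var vk))) ;;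
      NSet vAvail (NConst 0) (NSub (Var vAvail) size_) ;;
      insert aByEnd rEnd (Var vPlaced) ;;
      NSet vPlaced (NConst 0) (NAdd (Var vPlaced) (NConst 1)) ;;
      RSet rShift next_ (RGet rShift (Var vk)) ;;
      If (BLeR (RGet rFront (Var vk)) (RGet rEnd (Var vk)))
        (RSet rFront next_ (RGet rEnd (Var vk)))
        (RSet rFront next_ (RGet rFront (Var vk))))
     (RSet rShift next_ (RAdd (RGet rShift (Var vk)) (RGet rDur (Var vk))) ;;
      RSet rFront next_ (RGet rFront (Var vk))))%cmd.

Definition timing_phase :=
  (RSet vRatio (NConst 0)
     (RSub (ROfNat (NConst 3))
           (RDiv (ROfNat (NConst 4)) (ROfNat (NAdd nprocs_ (NConst 1))))) ;;
   RSet vCur (NConst 0) (ROfNat (NConst 0)) ;;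
   NSet vAvail (NConst 0) nprocs_ ;;
   NSet vh (NConst 0) (NConst 0) ;;
   NSet vPlaced (NConst 0) (NConst 0) ;;
   RSet rFront (NConst 0) (ROfNat (NConst 0)) ;;
   RSet rShift (NConst 0) (ROfNat (NConst 0)) ;;
   For vk njobs_ timing_body)%cmd.

(* The small jobs alone would run without interruption, job i during
   [start i, finish i); front i is when the small jobs before i are complete,
   and shift i is the total duration of the big jobs before i. *)
Record timing (R : realType) (m : nat) (sz : nat -> nat)
    (dur start finish front shift : nat -> R) (k : nat) : Prop := Timing {
  timing_start : forall i, (i < k)%N -> (sz i + sz i <= m)%N ->
    [/\ 0 <= start i, finish i = start i + dur i,
        start i * (m.+1)%:R / 2 <= \sum_(l < i | (sz l + sz l <= m)%N) (sz l)%:R * dur l &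
        (sz i + \sum_(l < i | (sz l + sz l <= m) && (start i < finish l)%R) sz l <= m)%N];
  timing_front0 : front 0%N = 0;
  timing_shift0 : shift 0%N = 0;
  timing_front : forall i, (i < k)%N ->
    front i.+1 = if (sz i + sz i <= m)%N then Num.max (front i) (finish i) else front i;
  timing_shift : forall i, (i < k)%N ->
    shift i.+1 = if (sz i + sz i <= m)%N then shift i else shift i + dur i }.

Section TimingPhase.
Context {R : realType} (s0 : memory R).
Let n := nmem s0 aDim 0.
Let m := nmem s0 aDim 1.
Let job := nmem s0 aJob.
Let sz k := nmem s0 aSize (job k).
Let W k := rmem s0 rWork (job k).
Let ratio : R := 3 - 4 / (m + 1)%:R.
Let dur k := W k / (ratio * rmem s0 rSpeed k).
Let area k := \sum_(l < k | (sz l + sz l <= m)%N) (sz l)%:R * dur l.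

Local Notation keepN := [:: aDim; aSize; aJob].
Local Notation keepR := [:: rRelease; rDeadline; rWork; rSpeed; vRatio].

Definition timing_inv k (s : memory R) :=
  let e := mkseq (nmem s aByEnd) (nmem s vPlaced 0) in
  [/\ agree keepN [:: rRelease; rDeadline; rWork; rSpeed] s0 s /\ rmem s vRatio 0 = ratio,
      (forall i, (i < k)%N -> rmem s rDur i = dur i) /\
      timing m sz dur (rmem s rStart) (rmem s rEnd) (rmem s rFront) (rmem s rShift) k,
      perm_eq e [seq i <- iota 0 k | (sz i + sz i <= m)%N],
      pairwise (relpre (rmem s rEnd) <=%R) e &
      clock sz m e (rmem s rEnd) (area k) (nmem s vh 0) (rmem s vCur 0) (nmem s vAvail 0)].

Lemma eq_timing k start finish front shift start' finish' front' shift' :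
  timing m sz dur start finish front shift k ->
  (forall i, (i < k)%N -> start' i = start i) ->
  (forall i, (i < k)%N -> finish' i = finish i) ->
  (forall i, (i <= k)%N -> front' i = front i) ->
  (forall i, (i <= k)%N -> shift' i = shift i) ->
  timing m sz dur start' finish' front' shift' k.
Proof.
move=> [t1 t2 t3 t4 t5] es ef efr esh; split.
- move=> i ik ismall; have [a b c d] := t1 i ik ismall; rewrite es // ef //.
  split=> //; apply: leq_trans d; rewrite leq_add2l.
  rewrite big_mkcond [leqRHS]big_mkcond /=; apply: leq_sum => l _.
  by rewrite ef // (ltn_trans _ ik).
- by rewrite efr.
- by rewrite esh.
- by move=> i ik; rewrite !efr ?ef ?t4 // ltnW.
- by move=> i ik; rewrite !esh ?t5 // ltnW.
Qed.

Lemma runs_release_loop k (s : memory R) A Q :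
  let e := mkseq (nmem s aByEnd) (nmem s vPlaced 0) in
  let C := rmem s rEnd in
  (forall a, a \in keepN -> nmem s a = nmem s0 a) ->
  nmem s vk 0 = k -> (sz k + sz k <= m)%N -> pairwise (relpre C <=%R) e ->
  clock sz m e C A (nmem s vh 0) (rmem s vCur 0) (nmem s vAvail 0) ->
  (forall s',
     agree [:: aDim; aSize; aJob; aByEnd; vk; vPlaced]
           [:: rRelease; rDeadline; rWork; rSpeed; vRatio; rDur; rStart; rEnd; rFront; rShift] s s' ->
     clock sz m e C A (nmem s' vh 0) (rmem s' vCur 0) (nmem s' vAvail 0) ->
     (sz k <= nmem s' vAvail 0)%N -> Q s') ->
  runs release_loop s (40 * (size e).+1) Q.
Proof.
move=> e C nE ks ksmall se cl exitQ.
have szE x : nmem s aSize (nmem s aJob x) = sz x by rewrite !nE.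
have sze : size e = nmem s vPlaced 0 by rewrite size_mkseq.
have nthe q : (q < size e)%N -> nth 0%N e q = nmem s aByEnd q.
  by rewrite sze => ?; rewrite nth_mkseq.
clearbody e.
pose J v (s1 : memory R) := [/\ (nmem s1 vh 0 + v = size e)%N,
  agree [:: aDim; aSize; aJob; aByEnd; vk; vPlaced]
        [:: rRelease; rDeadline; rWork; rSpeed; vRatio; rDur; rStart; rEnd; rFront; rShift] s s1 &
  clock sz m e C A (nmem s1 vh 0) (rmem s1 vCur 0) (nmem s1 vAvail 0)].
apply: (@runs_while _ J _ _ 30 (size e - nmem s vh 0)).
- by rewrite /=; clear; nia.
- move=> v s1 [hv ag1 cl1]; have /= E := agreeE ag1.
  rewrite /= !E ks szE addn1 -leqNgt => le.
  exact: exitQ le.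
- move=> v s1 [hv ag1 cl1]; have /= E := agreeE ag1.
  have se1 := se.
  rewrite /= !E ks szE addn1 => lt.
  have [h_lt] := clock_release se1 cl1 lt ksmall.
  rewrite nthe // => cl2; split; first by clear -hv h_lt; lia.
  apply: runs_rset_seq => //=; apply: runs_nset_seq => //=.
  apply: runs_nset => //=; split.
  + by rewrite /update /=; clear -hv h_lt; lia.
  + by do ![apply: agree_nset => //|apply: agree_rset => //].
  + by rewrite /update /= !E addn1 szE.
split; last by [].
- by rewrite subnKC //; case: cl.
- exact: agree_refl.
Qed.

Lemma filter_iotaS k :
  [seq i <- iota 0 k.+1 | (sz i + sz i <= m)%N] =
  [seq i <- iota 0 k | (sz i + sz i <= m)%N] ++
  (if (sz k + sz k <= m)%N then [:: k] else [::]).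
Proof. by rewrite -{1}[k.+1]addn1 iotaD add0n filter_cat. Qed.

Lemma areaS k : area k.+1 =
  area k + if (sz k + sz k <= m)%N then (sz k)%:R * dur k else 0.
Proof. by rewrite /area big_mkcond big_ord_recr -big_mkcond. Qed.

Lemma sum_small_iota e k (P : pred nat) :
  perm_eq e [seq i <- iota 0 k | (sz i + sz i <= m)%N] ->
  (\sum_(x <- e | P x) sz x = \sum_(l < k | (sz l + sz l <= m) && P l) sz l)%N.
Proof.
move=> pe; rewrite (perm_big _ pe) /= big_filter_cond -{1}[k]subn0.
by rewrite -[iota 0 (k - 0)]/(index_iota 0 k) big_mkord.
Qed.

Lemma runs_timing_body k (s : memory R) Q :
  0 < dur k ->
  nmem s vk 0 = k -> timing_inv k s ->
  (forall s', nmem s' vk 0 = k -> timing_inv k.+1 s' -> Q s') ->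
  runs timing_body s (300 * k.+1) Q.
Proof.
move=> dur0 ks [[ag ratioE] [durE tm] pe se cl] exitQ.
have /= E := agreeE ag.
apply: runs_rset_seq; first by rewrite /=; lia.
set s1 := Memory _ _.
have dur1 i : (i <= k)%N -> rmem s1 rDur i = dur i.
  rewrite /= /update /= !E ks leq_eqVlt => /orP[/eqP->|ik].
    by rewrite eqxx ratioE.
  by rewrite (ltn_eqF ik) durE.
have ag1 : agree keepN [:: rRelease; rDeadline; rWork; rSpeed] s0 s1.
  by do ![apply: agree_nset => //|apply: agree_rset => //].
have eE : mkseq (nmem s1 aByEnd) (nmem s1 vPlaced 0) =
          mkseq (nmem s aByEnd) (nmem s vPlaced 0) by [].
have C1 : rmem s1 rEnd = rmem s rEnd by [].
have S1 : rmem s1 rStart = rmem s rStart by [].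
have F1 : rmem s1 rFront = rmem s rFront by [].
have H1 : rmem s1 rShift = rmem s rShift by [].
have rat1 : rmem s1 vRatio 0 = ratio by [].
have k1 : nmem s1 vk 0 = k by [].
rewrite -{}eE -{}C1 -{}S1 -{}F1 -{}H1 in tm pe se cl.
rewrite -[nmem s vh 0]/(nmem s1 vh 0) -[nmem s vAvail 0]/(nmem s1 vAvail 0)
  -[rmem s vCur 0]/(rmem s1 vCur 0) in cl.
set B := (_ - _)%N.
have leB : (250 * k.+1 + 20 <= B)%N by rewrite /B /=; clear; lia.
move: B leB; clearbody s1 => {E ks ag durE ratioE} B leB.
have /= E := agreeE ag1.
have sizeE : neval s1 size_ = sz k by rewrite /= k1 !E.
have smallE : beval s1 small_ = (sz k + sz k <= m)%N.
  by rewrite -sizeE /= !E.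
apply: runs_if; rewrite ?smallE; [|move=> ksmall|move=> kbig].
- by rewrite /=; clear -leB; lia.
- set e := mkseq _ _ in pe se cl.
  have sze : (size e <= k)%N.
    by rewrite (perm_size pe) size_filter (leq_trans (count_size _ _)) ?size_iota.
  have ine x : x \in e -> (x < k)%N.
    by rewrite (perm_mem pe) mem_filter mem_iota => /andP[].
  apply: (@runs_seq _ _ _ _ (40 * (size e).+1)).
    by rewrite [bcost _]/=; clear -leB sze; lia.
  apply: (runs_release_loop _ k1 ksmall se cl); first by move=> a ia; case: ag1 => + _; apply.
  rewrite -/e => s2 ag2 cl2 szav.
  have /= E2 := agreeE ag2.
  have ag2' : agree keepN [:: rRelease; rDeadline; rWork; rSpeed] s0 s2.
    by apply: agree_trans ag1 _ _; [exact: agree_sub ag2 _|].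
  have /= E2' := agreeE ag2'.
  do 2 (apply: runs_rset_seq; first by rewrite /=; clear -leB sze; lia).
  apply: runs_nset_seq; first by rewrite /=; clear -leB sze; lia.
  apply: (@runs_seq _ _ _ _ (50 * (size e).+1)).
    by rewrite /=; clear -leB sze; lia.
  set s3 := Memory _ _.
  have k3 : nmem s3 vk 0 = k by rewrite /= /update /= !E2.
  have e3 : mkseq (nmem s3 aByEnd) (nmem s3 vPlaced 0) = e by rewrite /= /update /= !E2.
  have p3 : nmem s3 vPlaced 0 = size e by rewrite /= /update /= !E2 size_mkseq.
  have cur0 : 0 <= rmem s2 vCur 0 by case: cl2 => _ _ _ _ [].
  have C3 i : rmem s3 rEnd i = if i == k then rmem s2 vCur 0 + dur k else rmem s1 rEnd i.
    by rewrite /= /update /= !E2 k1; case: eqP => // _; rewrite dur1.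
  have S3 i : rmem s3 rStart i = if i == k then rmem s2 vCur 0 else rmem s1 rStart i.
    by rewrite /= /update /= !E2 k1.
  have d3 : rmem s3 rDur = rmem s1 rDur by rewrite /= /update /= E2.
  have F3 : rmem s3 rFront = rmem s1 rFront by rewrite /= /update /= E2.
  have H3 : rmem s3 rShift = rmem s1 rShift by rewrite /= /update /= E2.
  have rat3 : rmem s3 vRatio 0 = ratio by rewrite /= /update /= E2.
  have h3 : nmem s3 vh 0 = nmem s2 vh 0 by [].
  have cur3 : rmem s3 vCur 0 = rmem s2 vCur 0 by [].
  have av3 : nmem s3 vAvail 0 = (nmem s2 vAvail 0 - sz k)%N.
    by rewrite /= /update /= !E2 k1 !E.
  have ag3 : agree keepN [:: rRelease; rDeadline; rWork; rSpeed] s0 s3.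
    by do ![apply: agree_nset => //|apply: agree_rset => //].
  clearbody s3; set B' := (_ - _)%N.
  have leB' : (50 <= B')%N by rewrite /B' /=; clear -leB sze; lia.
  move: B' leB' => B' leB'.
  rewrite -{1}e3.
  have se3 : pairwise (relpre (rmem s3 rEnd) <=%R) e.
    apply: pairwise_mono se => x y /ine xk /ine yk.
    by rewrite /= !C3 (ltn_eqF xk) (ltn_eqF yk).
  apply: runs_insert => //=; rewrite ?k3 ?e3 //.
  move=> p s4 r4 n4 pe4 e4 lte ltd.
  have e4' : mkseq (nmem s4 aByEnd) (nmem s4 vPlaced 0).+1 = insert_at p k e.
    by rewrite (n4 vPlaced) // p3.
  (* Released jobs end no later than [vCur], hence no later than the new job, while everything
     behind the insertion point ends strictly later. So the new job is not inserted among the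
     released ones. *)
  have hp : (nmem s2 vh 0 <= p)%N.
    rewrite leqNgt; apply/negP => ph.
    have [hs done _ _ _] := cl2.
    have pin : nth 0%N e p \in take (nmem s2 vh 0) e.
      by rewrite -(nth_take 0%N ph) mem_nth // size_takel.
    have pe' : (p < size e)%N by exact: leq_trans ph hs.
    have : nth 0%N e p \in drop p e.
      by rewrite (drop_nth 0%N) // inE eqxx.
    move=> /(allP ltd); rewrite /= !C3 eqxx (ltn_eqF (ine _ (mem_nth _ pe'))).
    rewrite ltNge => /negP; apply; apply: le_trans (done _ pin) _.
    by rewrite lerDl ltW.
  have cl4 : clock sz m (insert_at p k e) (rmem s3 rEnd) (area k.+1)
      (nmem s2 vh 0) (rmem s2 vCur 0) (nmem s2 vAvail 0 - sz k).
    rewrite areaS ksmall; apply: clock_place cl2 szav _ _ _ _ _ => //.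
    - exact: ltW.
    - by rewrite C3 eqxx.
    - by move=> x /ine xk; rewrite C3 (ltn_eqF xk).
    - by rewrite hp.
  have pe5 : perm_eq (insert_at p k e) [seq i <- iota 0 k.+1 | (sz i + sz i <= m)%N].
    rewrite filter_iotaS ksmall (perm_trans (perm_insert_at _ _ _)) //.
    by rewrite cats1 perm_sym perm_rcons perm_cons perm_sym.
  have se4 : pairwise (relpre (rmem s3 rEnd) <=%R) (insert_at p k e).
    apply: pairwise_insert_at => //.
    by apply: sub_all ltd => x /ltW.
  have ag4 : agree keepN [:: rRelease; rDeadline; rWork; rSpeed] s0 s4.
    by apply: agree_trans ag3 _ _ => //; split => a ia; rewrite ?r4 // n4 //;
      move: ia; rewrite !inE => /or3P[] /eqP->.
  apply: runs_nset_seq; first by rewrite /=; clear -leB'; lia.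
  apply: runs_rset_seq; first by rewrite /=; clear -leB'; lia.
  have k4 : nmem s4 vk 0 = k by rewrite n4.
  have [bound1 bound2] := clock_bounds cl2.
  have sumk : (\sum_(l < k | (sz l + sz l <= m) && (rmem s2 vCur 0 < rmem s1 rEnd l)%R) sz l =
     \sum_(x <- e | (rmem s2 vCur 0 < rmem s1 rEnd x)%R) sz x)%N.
    by rewrite (sum_small_iota _ pe).
  set front' := fun i => if i == k.+1 then Num.max (rmem s1 rFront k) (rmem s3 rEnd k)
                         else rmem s1 rFront i.
  set shift' := fun i => if i == k.+1 then rmem s1 rShift k else rmem s1 rShift i.
  have tm' : timing m sz dur (rmem s3 rStart) (rmem s3 rEnd) front' shift' k.+1.
    have : timing m sz dur (rmem s3 rStart) (rmem s3 rEnd) front' shift' k.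
      apply: eq_timing tm _ _ _ _ => i ik.
      - by rewrite S3 (ltn_eqF ik).
      - by rewrite C3 (ltn_eqF ik).
      - by rewrite /front' (ltn_eqF (_ : i < k.+1)%N).
      - by rewrite /shift' (ltn_eqF (_ : i < k.+1)%N).
    case=> t1 t2 t3 t4 t5; split => // i; rewrite ltnS leq_eqVlt => /orP[/eqP->|ik].
    - move=> _; rewrite S3 C3 eqxx; split => //.
      apply: leq_trans bound2; rewrite -sumk leq_add //.
      rewrite big_mkcond [leqRHS]big_mkcond /=; apply: leq_sum => l _.
      by rewrite C3 (ltn_eqF (ltn_ord l)).
    - exact: t1.
    - by rewrite ksmall /front' eqxx (ltn_eqF (ltnSn k)).
    - exact: t4.
    - by rewrite ksmall /shift' eqxx (ltn_eqF (ltnSn k)).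
    - exact: t5.
  set s5 := Memory _ _.
  have B'lt : (20 <= B' - (ncost (NConst 0) + ncost (NAdd (Var vPlaced) (NConst 1))).+1 -
    (ncost next_ + rcost (RGet rShift (Var vk))).+1)%N by rewrite /=; clear -leB'; lia.
  (* Both branches of the conditional store the maximum of the old front and the new completion
     time, so the final memory is treated once, with the stored value [x] abstract. *)
  suff final (x : R) : x = Num.max (rmem s1 rFront k) (rmem s3 rEnd k) ->
      Q (Memory (nmem s5) (update (rmem s5) rFront (neval s5 next_) x)).
    apply: runs_if => [|le_FC|le_FC].
    + by rewrite [bcost _]/=; clear -B'lt; lia.
    + apply: runs_rset; first by rewrite [bcost _]/= [ncost _]/= [rcost _]/=; clear -B'lt; lia.
      apply: final; rewrite /= /update /= k4 r4; move: le_FC.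
      by rewrite /= /update /= k4 r4 F3 => ?; rewrite max_r.
    + apply: runs_rset; first by rewrite [bcost _]/= [ncost _]/= [rcost _]/=; clear -B'lt; lia.
      apply: final; rewrite /= /update /= k4 r4 F3; move: le_FC.
      by rewrite /= /update /= k4 r4 F3 -ltNge => /ltW ?; rewrite max_l.
  move=> xE; apply: exitQ; first by rewrite /= /update /= k4.
  split.
  + split; first by do ![apply: agree_nset => //|apply: agree_rset => //].
    by rewrite /= /update /= r4.
  + split; first by move=> i ik; rewrite /= /update /= r4 d3 dur1.
    apply: eq_timing tm' _ _ _ _ => i ik.
    * by rewrite /= /update /= r4.
    * by rewrite /= /update /= r4.
    * by rewrite /= /update /= r4 k4 addn1 F3 /front' xE.
    * by rewrite /= /update /= r4 k4 addn1 H3 /shift'.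
  + by rewrite /= /update /= addn1 -[mkseq _ _]/(mkseq (nmem s4 aByEnd) (nmem s4 vPlaced 0).+1) e4'.
  + rewrite /= /update /= addn1 -[mkseq _ _]/(mkseq (nmem s4 aByEnd) (nmem s4 vPlaced 0).+1) e4'.
    by rewrite -[fun _ => _]/(rmem s4 rEnd) r4.
  + rewrite /= /update /= addn1 -[mkseq _ _]/(mkseq (nmem s4 aByEnd) (nmem s4 vPlaced 0).+1) e4'.
    by rewrite (n4 vh) // (n4 vAvail) // r4 h3 av3 cur3.
- apply: runs_rset_seq; first by rewrite /=; clear -leB; lia.
  apply: runs_rset; first by rewrite /=; clear -leB; lia.
  rewrite -/(neval _ next_).
  set front' := fun i => if i == k.+1 then rmem s1 rFront k else rmem s1 rFront i.
  set shift' := fun i => if i == k.+1 then rmem s1 rShift k + dur k else rmem s1 rShift i.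
  have tm' : timing m sz dur (rmem s1 rStart) (rmem s1 rEnd) front' shift' k.+1.
    have : timing m sz dur (rmem s1 rStart) (rmem s1 rEnd) front' shift' k.
      apply: eq_timing tm _ _ _ _ => i ik //.
      - by rewrite /front' (ltn_eqF (_ : i < k.+1)%N).
      - by rewrite /shift' (ltn_eqF (_ : i < k.+1)%N).
    case=> t1 t2 t3 t4 t5; split => // i; rewrite ltnS leq_eqVlt => /orP[/eqP->|ik].
    - by rewrite (negbTE kbig).
    - exact: t1.
    - by rewrite (negbTE kbig) /front' eqxx (ltn_eqF (ltnSn k)).
    - exact: t4.
    - by rewrite (negbTE kbig) /shift' eqxx (ltn_eqF (ltnSn k)).
    - exact: t5.
  apply: exitQ => //; split.
  + by split; first by do ![apply: agree_nset => //|apply: agree_rset => //].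
  + split; first by move=> i ik; rewrite /= /update /= dur1.
    apply: eq_timing tm' _ _ _ _ => i ik //.
    * by rewrite /= /update /= k1 addn1 /front'.
    * by rewrite /= /update /= k1 addn1 /shift' dur1.
  + by rewrite filter_iotaS (negbTE kbig) cats0.
  + by [].
  + by rewrite areaS (negbTE kbig) addr0.
Qed.

Lemma runs_timing_phase Q :
  (forall i, (i < n)%N -> 0 < dur i) ->
  (forall s, agree keepN [:: rRelease; rDeadline; rWork; rSpeed] s0 s ->
     rmem s vRatio 0 = ratio -> (forall i, (i < n)%N -> rmem s rDur i = dur i) ->
     timing m sz dur (rmem s rStart) (rmem s rEnd) (rmem s rFront) (rmem s rShift) n ->
     Q s) ->
  runs timing_phase s0 (500 * n.+1 ^ 2) Q.
Proof.
move=> dur0 exitQ.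
apply: runs_rset_seq; first by rewrite /=; clear; lia.
apply: runs_rset_seq; first by rewrite /=; clear; lia.
do 3 (apply: runs_nset_seq; first by rewrite /=; clear; lia).
do 2 (apply: runs_rset_seq; first by rewrite /=; clear; lia).
apply: (@runs_for _ _ _ _ (300 * n.+1) n timing_inv).
- by rewrite /=; clear; nia.
- by move=> i s [[ag _] _ _ _ _]; have /= E := agreeE ag; rewrite /= E.
- split => //=.
  + by split => //; rewrite /nset; do ![apply: agree_nset => //|apply: agree_rset => //].
  + rewrite /update /= /clock /= !big_nil; split => //=; rewrite ?addn0 //.
    split => //.
    by rewrite mul0r mul0r add0r /area big_ord0.
- move=> i s lt_in ki inv.
  apply: runs_weaken (runs_timing_body (dur0 _ lt_in) ki inv (Q := _) _) _ (fun _ => id).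
  + move=> s' k' [[a1 a1'] a2 a3 a4 a5]; split; first exact: k'.
    split => //; split => //; rewrite /nset.
    by do ![apply: agree_nset => //|apply: agree_rset => //].
  + by rewrite leq_mul // ltnS ltnW.
- by move=> s _ [[a1 a1'] [a2 a3] _ _ _]; apply: exitQ.
Qed.

End TimingPhase.

(** * Allocation of processors *)

Section Segments.
Context {R : realType} (m : nat).
Implicit Types (st ln : nat -> nat) (ld : nat -> R) (load : 'I_m -> R) (q g : nat).

Definition in_segment st ln g p := (st g <= p < st g + ln g)%N.

(** A partition of the processors into [q] intervals on each of which [load] is constant. Only the
    intervals are stored, which keeps the cost independent of the number of processors. *)
Record segments q st ln ld load : Prop := Segments {
  segment_bound : forall g, (g < q)%N -> (st g + ln g <= m)%N;
  segment_cover : forall p : 'I_m, exists2 g, (g < q)%N & in_segment st ln g p;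
  segment_disjoint : forall g g' (p : 'I_m), (g < q)%N -> (g' < q)%N ->
    in_segment st ln g p -> in_segment st ln g' p -> g = g';
  segment_load : forall g (p : 'I_m), (g < q)%N -> in_segment st ln g p -> ld g = load p }.

(** The [t] processors taken keep the index [g] and receive the load [C]. A nonempty remainder
    becomes segment [q] with the old load, so taking a whole segment creates no new one. *)
Lemma segments_take q st ln ld load q' st' ln' ld' load' g t C :
  segments q st ln ld load -> (g < q)%N -> (t <= ln g)%N ->
  q' = (q + (t < ln g))%N ->
  (forall x, (x < q)%N -> st' x = st x) ->
  (forall x, (x < q)%N -> ln' x = if x == g then t else ln x) ->
  (forall x, (x < q)%N -> ld' x = if x == g then C else ld x) ->
  ((t < ln g)%N -> [/\ st' q = st g + t, ln' q = ln g - t & ld' q = ld g]%N) ->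
  (forall p : 'I_m, load' p = if (st g <= p < st g + t)%N then C else load p) ->
  segments q' st' ln' ld' load'.
Proof.
move=> [bd cov dis lo] gq tl q'E st'E ln'E ld'E newE load'E.
have old x (p : 'I_m) : (x < q)%N ->
    in_segment st' ln' x p = if x == g then (st g <= p < st g + t)%N
                             else in_segment st ln x p.
  by move=> xq; rewrite /in_segment st'E // ln'E //; case: eqP => // ->.
have old_in x (p : 'I_m) : (x < q)%N -> in_segment st' ln' x p -> in_segment st ln x p.
  by move=> xq; rewrite old // /in_segment; case: eqP => // ->; lia.
have split_ x : (x < q')%N -> (x < q)%N \/ x = q /\ (t < ln g)%N.
  by rewrite q'E; case: (ltnP t (ln g)) => _; lia.
have new (p : 'I_m) : (t < ln g)%N ->
    in_segment st' ln' q p = (st g + t <= p < st g + ln g)%N.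
  by move=> tg; rewrite /in_segment; have [-> -> _] := newE tg; lia.
split.
- move=> x /split_[xq|[-> tg]]; last by have [-> -> _] := newE tg; have := bd g gq; lia.
  by rewrite st'E // ln'E //; case: eqP => [->|_]; have := bd _ gq; have := bd _ xq; lia.
- move=> p; have [x xq xp] := cov p.
  have [xg|xg] := eqVneq x g; last first.
    by exists x; rewrite ?old ?(negbTE xg) //; lia.
  subst x; case: (ltnP p (st g + t)) => pt.
    exists g; first by lia.
    by rewrite old // eqxx pt andbT; move: xp; rewrite /in_segment; lia.
  have tg : (t < ln g)%N by move: xp; rewrite /in_segment; lia.
  exists q; first by rewrite q'E tg; lia.
  by rewrite new //; move: xp; rewrite /in_segment; lia.
- have mixed x (p : 'I_m) : (x < q)%N -> (t < ln g)%N -> in_segment st' ln' x p ->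
      in_segment st' ln' q p -> False.
    move=> xq tg xp; rewrite new // => qp.
    have xg : x = g.
      by apply: (dis _ _ p xq gq (old_in _ _ xq xp)); rewrite /in_segment; lia.
    by move: xp; rewrite old // xg eqxx; lia.
  move=> x y p /split_[xq|[-> tg]] /split_[yq|[-> tg']] // xp yp.
  + by apply: (dis _ _ p xq yq); apply: old_in.
  + by case: (mixed x p).
  + by case: (mixed y p).
- move=> x p /split_[xq|[-> tg]] xp; last first.
    have [_ _ ->] := newE tg; move: xp; rewrite new // load'E => xp.
    rewrite ifN; last by lia.
    by apply: lo => //; rewrite /in_segment; lia.
  rewrite ld'E // load'E; move: (xp); rewrite old //.
  have [_|xg] := eqVneq x g; first by move=> ->.
  move=> xp'; rewrite (lo x p xq) ?old_in // ifN //.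
  apply/negP => pg; move/eqP: xg; apply; apply: (dis _ _ p) => //.
  by rewrite /in_segment; lia.
Qed.

End Segments.

(** The processor set that [output] reads off the blocks emitted so far. *)
Definition owners (R : realType) (m : nat) (s : memory R) (j : nat) : {set 'I_m} :=
  [set p : 'I_m | [exists l : 'I_(nmem s aCount 1),
     (nmem s aBlockJob l == j) &&
     (nmem s aBlockStart l <= p < nmem s aBlockStart l + nmem s aBlockLen l)%N]]%SET.

Definition interval_set (m a b : nat) : {set 'I_m} := [set p : 'I_m | (a <= p < b)%N]%SET.

Lemma in_interval_set m a b (p : 'I_m) : (p \in interval_set m a b) = (a <= p < b)%N.
Proof. by rewrite inE. Qed.

Lemma card_interval_set m a b : (a <= b <= m)%N -> #|interval_set m a b| = (b - a)%N.
Proof.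
move=> /andP[ab bm]; rewrite -sum1dep_card.
rewrite (big_ord_narrow_cond bm) /=.
rewrite -(big_mkord (fun i => (a <= i)%N) (fun=> 1%N)) /= (big_cat_nat (n := a)) //=.
rewrite big_nat_cond big_pred0; last by move=> i; lia.
rewrite add0n big_nat_cond (eq_bigl (fun i => ((a <= i < b) && true)%N)); last by move=> i; lia.
by rewrite -big_nat_cond sum_nat_const_nat muln1.
Qed.

Lemma owners_emit (R : realType) m (s s' : memory R) a st ln j :
  let L := nmem s aCount 1 in
  nmem s' aCount 1 = L.+1 ->
  (forall l, nmem s' aBlockJob l = if l == L then a else nmem s aBlockJob l) ->
  (forall l, nmem s' aBlockStart l = if l == L then st else nmem s aBlockStart l) ->
  (forall l, nmem s' aBlockLen l = if l == L then ln else nmem s aBlockLen l) ->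
  owners m s' j =
    if a == j then (owners m s j :|: interval_set m st (st + ln))%SET else owners m s j.
Proof.
move=> L LE jE sE lE.
have key (p : 'I_m) : (p \in owners m s' j) =
    (p \in owners m s j) || ((a == j) && (st <= p < st + ln)%N).
  rewrite !inE; apply/existsP/orP => [[[l /= lL]]|].
    rewrite jE sE lE; have [_|lN] := eqVneq l L; first by right.
    move=> h; left; apply/existsP.
    have lL' : (l < nmem s aCount 1)%N.
      by move: lL; rewrite LE ltnS leq_eqVlt (negbTE lN).
    by exists (Ordinal lL').
  case=> [/existsP[l h]|h].
    have lL : (l < nmem s' aCount 1)%N by rewrite LE ltnW // ltnS.
    by exists (Ordinal lL); rewrite /= jE sE lE (ltn_eqF (ltn_ord l)).
  have lL : (L < nmem s' aCount 1)%N by rewrite LE.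
  by exists (Ordinal lL); rewrite /= jE sE lE eqxx.
apply/setP => p; rewrite key; case: eqP => _ /=; rewrite ?orbF //.
by rewrite finset.in_setU in_interval_set.
Qed.

Lemma leq_card_bigcup (I T : finType) (P : pred I) (A : I -> {set T}) :
  (#|\bigcup_(i | P i) A i| <= \sum_(i | P i) #|A i|)%N.
Proof.
elim/big_rec2: _ => [|i n B _ le]; first by rewrite cards0.
by apply: leq_trans (leq_card_setU _ _) _; rewrite leq_add2l.
Qed.

(** * Program for the processor blocks *)

Definition blocks_ := NGet aCount (NConst 1).

Definition emit_block start len :=
  (NSet aBlockJob blocks_ job_ ;;
   NSet aBlockStart blocks_ start ;;
   NSet aBlockLen blocks_ len ;;
   NSet aCount (NConst 1) (NAdd blocks_ (NConst 1)))%cmd.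

(* With truncated subtraction, [len - (len - need)] is the minimum of [len] and [need]. *)
Definition segment_step :=
  (If (BLeR (RGet rSegLoad (Var vg)) (RGet rStart (Var vk)))
     (NSet vTake (NConst 0)
        (NSub (NGet aSegLen (Var vg)) (NSub (NGet aSegLen (Var vg)) (Var vNeed))) ;;
      If (BLeN (NGet aSegLen (Var vg)) (Var vNeed)) Skip
        (NSet aSegStart (Var vSegs) (NAdd (NGet aSegStart (Var vg)) (Var vTake)) ;;
         NSet aSegLen (Var vSegs) (NSub (NGet aSegLen (Var vg)) (Var vTake)) ;;
         RSet rSegLoad (Var vSegs) (RGet rSegLoad (Var vg)) ;;
         NSet vSegs (NConst 0) (NAdd (Var vSegs) (NConst 1))) ;;
      NSet aSegLen (Var vg) (Var vTake) ;;
      RSet rSegLoad (Var vg) (RGet rEnd (Var vk)) ;;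
      NSet vNeed (NConst 0) (NSub (Var vNeed) (Var vTake)) ;;
      emit_block (NGet aSegStart (Var vg)) (Var vTake))
     Skip ;;
   NSet vg (NConst 0) (NAdd (Var vg) (NConst 1)))%cmd.

(** A big job is alone on the machine while it runs, so any processors will do: it takes the first
    ones and leaves the segments as they are. *)
Definition block_body :=
  If small_
    (NSet vNeed (NConst 0) size_ ;;
     NSet vg (NConst 0) (NConst 0) ;;
     While (BLtN (NConst 0) (Var vNeed)) segment_step)%cmd
    (emit_block (NConst 0) size_).

Definition block_phase :=
  (NSet vSegs (NConst 0) (NConst 1) ;;
   NSet aSegStart (NConst 0) (NConst 0) ;;
   NSet aSegLen (NConst 0) nprocs_ ;;
   RSet rSegLoad (NConst 0) (ROfNat (NConst 0)) ;;
   NSet aCount (NConst 1) (NConst 0) ;;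
   For vk njobs_ block_body)%cmd.

Section BlockPhase.
Context {R : realType} (s0 : memory R).
Let n := nmem s0 aDim 0.
Let m := nmem s0 aDim 1.
Let job := nmem s0 aJob.
Let sz k := nmem s0 aSize (job k).
Let start := rmem s0 rStart.
Let finish := rmem s0 rEnd.
Let small k := (sz k + sz k <= m)%N.

Local Notation keepN := [:: aDim; aSize; aJob].
Local Notation keepR := [:: rRelease; rDeadline; rWork; rSpeed; vRatio;
  rDur; rStart; rEnd; rFront; rShift].
Local Notation segs_of s :=
  (segments (nmem s vSegs 0) (nmem s aSegStart) (nmem s aSegLen) (rmem s rSegLoad)).
Local Notation owners s j := (@owners R m s j).

Hypothesis job_inj : forall i k, (i < n)%N -> (k < n)%N -> job i = job k -> i = k.
Hypothesis m_gt0 : (0 < m)%N.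
Hypothesis sz_le : forall k, (k < n)%N -> (sz k <= m)%N.
Hypothesis start_ge0 : forall k, (k < n)%N -> small k -> 0 <= start k.
Hypothesis start_lt : forall k, (k < n)%N -> small k -> start k < finish k.
Hypothesis enough : forall k, (k < n)%N -> small k ->
  (sz k + \sum_(l < k | small l && (start k < finish l)%R) sz l <= m)%N.

(** [load p] is the completion time of the last small job on [p], or 0. Big jobs do not count,
    because all times here are those of the schedule of the small jobs alone. *)
Record blocks_upto k (s : memory R) (load : 'I_m -> R) : Prop := BlocksUpto {
  blocks_segs : segs_of s load;
  blocks_segn : (nmem s vSegs 0 <= k.+1)%N;
  blocks_card : forall i, (i < k)%N -> #|owners s (job i)| = sz i;
  blocks_new : forall i, (k <= i < n)%N -> owners s (job i) = finset.set0;
  blocks_load : forall i (p : 'I_m), (i < k)%N -> small i -> p \in owners s (job i) ->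
    finish i <= load p;
  blocks_last : forall p, load p = 0 \/
    exists i, [/\ (i < k)%N, small i, p \in owners s (job i) & load p = finish i];
  blocks_order : forall i i' (p : 'I_m), (i < i' < k)%N -> small i -> small i' ->
    p \in owners s (job i) -> p \in owners s (job i') -> finish i <= start i' }.

Definition block_inv k (s : memory R) :=
  agree keepN keepR s0 s /\ exists load, blocks_upto k s load.

(** A processor with load beyond [start k] belongs to a small job that is still running then, and
    the sizes of those jobs leave room for [sz k] by [enough]. *)
Lemma free_processors k s load : (k < n)%N -> small k -> blocks_upto k s load ->
  (sz k <= #|[set p | (load p <= start k)%R]%SET|)%N.
Proof.
move=> kn ksmall [_ _ card _ _ last _].
have : (#|[set p | (load p <= start k)%R]%SET| + #|~: [set p | (load p <= start k)%R]%SET| = m)%N.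
  by rewrite cardsC card_ord.
suff : (#|~: [set p | (load p <= start k)%R]%SET| <=
    \sum_(l < k | small l && (start k < finish l)%R) sz l)%N.
  by have := enough kn ksmall; lia.
have -> : (\sum_(l < k | small l && (start k < finish l)%R) sz l =
   \sum_(l < k | small l && (start k < finish l)%R) #|owners s (job l)|)%N.
  by apply: eq_bigr => l _; rewrite card.
apply: leq_trans (leq_card_bigcup _ _).
apply: subset_leq_card; apply/fintype.subsetP => p; rewrite !inE -ltNge => busy.
have [p0|[i [ik ismall ip pE]]] := last p.
  by move: busy; rewrite p0 ltNge start_ge0.
apply/bigcupP; exists (Ordinal ik) => //=.
by rewrite ismall -pE.
Qed.

(** The fuel [v] counts the segments still to be scanned. A segment is split only when it exceeds
    what is needed, so the number of segments can change only in the step that ends the loop. The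
    clause on segments [x] says that every free processor not yet taken lies at index [g] or
    later. *)
Definition step_inv k (sk : memory R) (load : 'I_m -> R) v (s : memory R) :=
  let taken := owners s (job k) in
  let q0 := nmem sk vSegs 0 in
  let q := nmem s vSegs 0 in let g := nmem s vg 0 in let need := nmem s vNeed 0 in
  [/\ agree keepN keepR s0 s /\ nmem s vk 0 = k,
     ((0 < need)%N -> (g + v)%N = q0 /\ q = q0) /\ (q <= q0.+1)%N,
     segs_of s (fun p => if p \in taken then finish k else load p),
     [/\ forall p, p \in taken -> load p <= start k,
       forall x (p : 'I_m), (0 < need)%N -> (x < q)%N -> load p <= start k -> p \notin taken ->
         in_segment (nmem s aSegStart) (nmem s aSegLen) x p -> (g <= x)%N &
       (#|taken| + need)%N = sz k] &
     forall j, j != job k -> owners s j = owners sk j].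

Lemma runs_segment_step k sk load v (s : memory R) :
  (k < n)%N -> small k -> blocks_upto k sk load ->
  step_inv k sk load v s -> (0 < nmem s vNeed 0)%N ->
  (0 < v)%N /\ runs segment_step s 200 (step_inv k sk load v.-1).
Proof.
move=> kn ksmall bk [[ag ks] [gv q1] segs [taken_free unseen card] others] need0.
have [gvE qE] := gv need0.
have /= E := agreeE ag.
set taken := owners s (job k) in segs taken_free unseen card.
have [g gE] : {g | nmem s vg 0 = g} by eexists.
have [q sE] : {q | nmem s vSegs 0 = q} by eexists.
rewrite gE sE in gvE qE q1 segs unseen.
(* The scan cannot run out of segments: fewer than [sz k] processors are taken and at least [sz k]
   are free, so some free processor is left, and its segment is not before [g]. *)
have g_lt : (g < q)%N.
  have : (#|taken| < #|[set p | (load p <= start k)%R]%SET|)%N.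
    by apply: leq_trans (free_processors kn ksmall bk); rewrite -card; lia.
  rewrite ltnNge => /negP nsub.
  have /fintype.subsetPn[p] : ~~ ([set p | (load p <= start k)%R]%SET \subset taken).
    by apply/negP => /subset_leq_card.
  rewrite inE => pfree ptaken.
  have [x xq xp] := segment_cover segs p.
  exact: leq_ltn_trans (unseen x p need0 xq pfree ptaken xp) xq.
have v0 : (0 < v)%N by lia.
split => //.
apply: (@runs_seq _ _ _ _ 180); first by [].
apply: runs_if => [//||].
- rewrite /= !E ks gE -/start => free.
  apply: runs_nset_seq => //=.
  set t := (nmem s _ _ - (_ - _))%N.
  have tE : t = minn (nmem s aSegLen g) (nmem s vNeed 0) by rewrite /t gE; clear; lia.
  pose st' x := if (x == q) && (t < nmem s aSegLen g)%N then (nmem s aSegStart g + t)%N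
                else nmem s aSegStart x.
  pose ln' x := if x == g then t else
                if (x == q) && (t < nmem s aSegLen g)%N then (nmem s aSegLen g - t)%N
                else nmem s aSegLen x.
  pose ld' x := if x == g then finish k else
                if (x == q) && (t < nmem s aSegLen g)%N then rmem s rSegLoad g
                else rmem s rSegLoad x.
  have gq : (g == q) = false by apply/negbTE; rewrite neq_ltn g_lt.
  have qg : (q == g) = false by rewrite eq_sym.
  (* [st'], [ln'] and [ld'] describe the segments after the step whether or not segment [g] is
     split, so the commands that follow the conditional are treated once. Cell [g] of the last two
     is still to be written. *)
  suff final s1 : agree keepN keepR s0 s1 -> nmem s1 vk 0 = k -> nmem s1 vg 0 = g ->
      nmem s1 aSegStart = st' -> nmem s1 vTake 0 = t ->
      (forall x, x != g -> nmem s1 aSegLen x = ln' x) ->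
      (forall x, x != g -> rmem s1 rSegLoad x = ld' x) ->
      nmem s1 vNeed 0 = nmem s vNeed 0 -> nmem s1 aCount = nmem s aCount ->
      nmem s1 aBlockJob = nmem s aBlockJob -> nmem s1 aBlockStart = nmem s aBlockStart ->
      nmem s1 aBlockLen = nmem s aBlockLen ->
      nmem s1 vSegs 0 = (q + (t < nmem s aSegLen g))%N ->
      runs (NSet aSegLen (Var vg) (Var vTake) ;;
            RSet rSegLoad (Var vg) (RGet rEnd (Var vk)) ;;
            NSet vNeed (NConst 0) (NSub (Var vNeed) (Var vTake)) ;;
            emit_block (NGet aSegStart (Var vg)) (Var vTake))%cmd s1 50
        (fun s2 => runs (NSet vg (NConst 0) (NAdd (Var vg) (NConst 1))) s2 20
           (step_inv k sk load v.-1)).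
    apply: (@runs_seq _ _ _ _ 46); first by [].
    apply: runs_if => [//||] /= cmp; rewrite /update /= gE in cmp.
    + apply: runs_skip => //.
      apply: (@runs_weaken _ _ _ 50 _ _ _ _ _ (fun _ => id)) => //.
      have tl : (t < nmem s aSegLen g)%N = false by rewrite tE; lia.
      apply: final => //=; rewrite /st' /ln' /ld' ?tl ?andbF ?addn0 //=.
      * by do ![apply: agree_nset => //|apply: agree_rset => //].
      * by apply: funext => x; rewrite andbF.
      * by move=> x /negbTE ->; rewrite andbF.
      * by move=> x /negbTE ->; rewrite andbF.
    + have tl : (t < nmem s aSegLen g)%N. by rewrite tE; lia.
      do 2 (apply: runs_nset_seq => //=); apply: runs_rset_seq => //=.
      apply: runs_nset => //=.
      apply: (@runs_weaken _ _ _ 50 _ _ _ _ _ (fun _ => id)) => //.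
      apply: final => //=; rewrite /st' /ln' /ld' ?tl ?andbT //=.
      * by do ![apply: agree_nset => //|apply: agree_rset => //].
      * apply: funext => x; by rewrite /update /= gE sE ?andbT; case: eqP.
      * by move=> x /negbTE xg; rewrite /update /= gE sE xg ?andbT.
      * by move=> x /negbTE xg; rewrite /update /= gE sE xg ?andbT.
      * by rewrite /update /= sE.
  move=> ag1 k1 g1 st1 take1 ln1 ld1 need1 count1 bj1 bs1 bl1 segs1.
  have /= E1 := agreeE ag1.
  apply: runs_nset_seq => //=; apply: runs_rset_seq => //=.
  do 4 (apply: runs_nset_seq => //=).
  apply: runs_nset => //=.
  apply: runs_nset => //=.
  set s2 := Memory _ _.
  have k2 : nmem s2 vk 0 = k by rewrite /= /update /=.
  have g2 : nmem s2 vg 0 = g.+1 by rewrite /= /update /= g1 addn1.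
  have need2 : nmem s2 vNeed 0 = (nmem s vNeed 0 - t)%N.
    by rewrite /= /update /= take1 need1.
  have segs2 : nmem s2 vSegs 0 = (q + (t < nmem s aSegLen g))%N.
    by rewrite /= /update /=.
  have st2 : nmem s2 aSegStart = st' by rewrite -st1.
  have ln2 x : nmem s2 aSegLen x = ln' x.
    rewrite /= /update /= g1 take1; case: (eqVneq x g) => [->|/ln1->//].
    by rewrite /ln' eqxx.
  have ld2 x : rmem s2 rSegLoad x = ld' x.
    rewrite /= /update /= g1 k1 !E1 -/finish; case: (eqVneq x g) => [->|/ld1->//].
    by rewrite /ld' eqxx.
  have ag2 : agree keepN keepR s0 s2.
    by do ![apply: agree_nset => //|apply: agree_rset => //].
  have own2 j : owners s2 j = if job k == j
      then (owners s j :|: interval_set m (nmem s aSegStart g) (nmem s aSegStart g + t))%SET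
      else owners s j.
    apply: owners_emit => [|l|l|l].
    - by rewrite /= /update /= count1 addn1.
    - by rewrite /= /update /= count1 bj1 k1 !E1.
    - by rewrite /= /update /= count1 bs1 g1 st1 /st' gq.
    - by rewrite /= /update /= count1 bl1 take1.
  have tlen : (t <= nmem s aSegLen g)%N by rewrite tE geq_minl.
  have bound := segment_bound segs g_lt.
  (* The load of a segment with a processor already taken is [finish k], which exceeds [start k]; a
     free segment contains none. *)
  have new_p (p : 'I_m) : (nmem s aSegStart g <= p < nmem s aSegStart g + t)%N ->
      p \notin taken /\ load p <= start k.
    move=> pin; have gp : in_segment (nmem s aSegStart) (nmem s aSegLen) g p.
      by rewrite /in_segment; lia.
    have := segment_load segs g_lt gp; case: ifP => [_ eq|_ eq]; last by rewrite -eq.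
    by move: free; rewrite eq leNgt start_lt.
  move: s2 k2 g2 need2 segs2 st2 ln2 ld2 ag2 own2 => s2 k2 g2 need2 segs2 st2 ln2 ld2 ag2 own2.
  have taken2 : owners s2 (job k) =
     (taken :|: interval_set m (nmem s aSegStart g) (nmem s aSegStart g + t))%SET.
    by rewrite own2 eqxx.
  have in2 p : p \in owners s2 (job k) =
     (p \in taken) || (nmem s aSegStart g <= p < nmem s aSegStart g + t)%N.
    by rewrite taken2 finset.in_setU in_interval_set.
  split.
  + by [].
  + rewrite need2 segs2 g2; split; last by clear -q1 qE; lia.
    by rewrite subn_gt0 tE => ?; lia.
  + apply: (segments_take (t := t) (C := finish k) segs g_lt tlen segs2).
    * by move=> x xq; rewrite st2 /st' (ltn_eqF xq).
    * by move=> x xq; rewrite ln2 /ln' (ltn_eqF xq).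
    * by move=> x xq; rewrite ld2 /ld' (ltn_eqF xq).
    * by move=> tl; rewrite st2 ln2 ld2 /st' /ln' /ld' eqxx qg tl.
    * by move=> p; rewrite in2; case: ifP; case: ifP => //=; case: (p \in taken).
  + split.
    * by move=> p; rewrite in2 => /orP[/taken_free//|/new_p[]].
    * move=> x p need2' xq pfree; rewrite in2 negb_or => /andP[pt pg].
      have tl : (t < nmem s aSegLen g)%N = false by move: need2'; rewrite need2 tE; lia.
      move: xq; rewrite segs2 tl addn0 => xq.
      rewrite /in_segment st2 ln2 /st' /ln' tl !andbF.
      have [->|xg] := eqVneq x g; first by rewrite (negbTE pg).
      move=> xp; rewrite g2 ltn_neqAle eq_sym xg /=.
      exact: unseen need0 xq pfree pt xp.
    * rewrite taken2 cardsU need2 card_interval_set; last by rewrite leq_addr /=; lia.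
      rewrite (_ : _ :&: _ = finset.set0)%SET ?cards0; first by rewrite -card; lia.
      apply/setP => p; rewrite finset.in_setI in_interval_set finset.in_set0.
      by apply/negP => /andP[pt /new_p[/negP]].
  + by move=> j jk; rewrite own2 eq_sym (negbTE jk) others.
- rewrite /= !E ks gE -/start -ltNge => busy.
  apply: runs_skip => //; apply: runs_nset => //=.
  set s1 := Memory _ _.
  have own1 j : owners s1 j = owners s j by [].
  split; rewrite ?own1 //=.
  + split; last by rewrite /update /=.
    by do ![apply: agree_nset => //|apply: agree_rset => //].
  + split; last by rewrite /update /= sE.
    by rewrite /update /= gE sE => _; split => //; lia.
  + by move: segs; rewrite -sE.
  + split; [exact: taken_free| |exact: card].
    rewrite /update /= sE => x p _ xq pfree pt xp; rewrite ?gE addn1 ltn_neqAle.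
    rewrite (unseen x p) // andbT; apply/eqP => gx.
    have := segment_load segs g_lt (p := p); rewrite gx => /(_ xp).
    by rewrite (negbTE pt) => eq; move: busy; rewrite gx eq ltNge pfree.
Qed.

Lemma block_inv_small k sk load v s : (k < n)%N -> small k -> blocks_upto k sk load ->
  step_inv k sk load v s -> nmem s vNeed 0 = 0%N -> block_inv k.+1 s.
Proof.
move=> kn ksmall [bsegs bn bcard bnew bload blast border].
move=> [[ag ks] [gv q1] segs [taken_free _ card] others] need0.
rewrite need0 addn0 in card.
have neq i : (i < n)%N -> i != k -> job i != job k.
  by move=> in_; apply: contra => /eqP e; apply/eqP; apply: job_inj.
split=> //; eexists; split; first exact: segs.
- by apply: leq_trans q1 _.
- move=> i; rewrite ltnS leq_eqVlt => /orP[/eqP->//|ik].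
  by rewrite others ?bcard ?neq ?(ltn_eqF ik) // (ltn_trans ik).
- move=> i /andP[ki in_]; rewrite others ?neq //; last by rewrite gtn_eqF.
  by rewrite bnew // in_ andbT ltnW.
- move=> i p; rewrite ltnS leq_eqVlt => /orP[/eqP->|ik] ismall ip; first by rewrite ip.
  have ipk : p \in owners sk (job i).
    by rewrite -others ?neq ?(ltn_eqF ik) // (ltn_trans ik).
  have le := bload _ _ ik ismall ipk; case: ifP => // /taken_free pf.
  by apply: le_trans le (le_trans pf (ltW (start_lt kn ksmall))).
- move=> p /=; case: ifP => [pt|_]; first by right; exists k; split.
  have [->|[i [ik ismall ip ->]]] := blast p; [by left|right].
  exists i; split => //; first exact: ltnW.
  by rewrite others ?neq ?(ltn_eqF ik) // (ltn_trans ik).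
- move=> i i' p /andP[ii']; rewrite ltnS leq_eqVlt => /orP[/eqP i'k|i'k] ismall i'small.
    subst i'; rewrite others ?neq ?(ltn_eqF ii') // ?(ltn_trans ii') //.
    move=> ip /taken_free; apply: le_trans.
    exact: bload ip.
  have ik := ltn_trans ii' i'k.
  rewrite !others ?neq ?(ltn_eqF ik) ?(ltn_eqF i'k) ?(ltn_trans _ kn) //.
  by apply: border => //; rewrite ii'.
Qed.

Lemma runs_block_body k s : (k < n)%N -> nmem s vk 0 = k -> block_inv k s ->
  runs block_body s (300 * k.+2) (fun s' => nmem s' vk 0 = k /\ block_inv k.+1 s').
Proof.
move=> kn ks [ag [load bk]].
have /= E := agreeE ag.
have smallE : beval s small_ = small k by rewrite /= ks !E.
have sizeE (s' : memory R) : nmem s' aJob = nmem s aJob -> nmem s' aSize = nmem s aSize ->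
    nmem s' vk 0 = k -> neval s' size_ = sz k.
  by move=> e1 e2 e3; rewrite /= e1 e2 e3 !E.
apply: runs_if; rewrite ?smallE; [|move=> ksmall|move=> kbig].
- by rewrite [bcost _]/=; clear; lia.
- apply: runs_nset_seq; first by rewrite /=; clear; lia.
  apply: runs_nset_seq; first by rewrite /=; clear; lia.
  rewrite sizeE //.
  set s1 := Memory _ _.
  have ag1 : agree keepN keepR s0 s1.
    by do ![apply: agree_nset => //|apply: agree_rset => //].
  have bk1 : blocks_upto k s1 load by case: bk.
  have k1 : nmem s1 vk 0 = k by [].
  have need1 : nmem s1 vNeed 0 = sz k by rewrite /= /update /=.
  have g1 : nmem s1 vg 0 = 0%N by [].
  clearbody s1.
  have segn := blocks_segn bk1.
  apply: (@runs_while _ (step_inv k s1 load) _ _ 200 (nmem s1 vSegs 0)).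
  + by rewrite /=; clear -segn; lia.
  + move=> v s2 inv; rewrite /= -leqNgt leqn0 => /eqP need0.
    split; first by case: inv => -[].
    exact: block_inv_small kn ksmall bk1 inv need0.
  + move=> v s2 inv; rewrite /= => need0.
    exact: runs_segment_step kn ksmall bk1 inv need0.
  + have tk : owners s1 (job k) = finset.set0 by rewrite (blocks_new bk1) // leqnn.
    split => //; rewrite ?tk.
    * by rewrite g1; split.
    * rewrite (_ : (fun p => _) = load); first by case: bk1.
      by apply: funext => p; rewrite finset.in_set0.
    * by split => [p|x p _ _ _ _ _|]; rewrite ?finset.in_set0 ?g1 ?cards0 ?need1.
- do 3 (apply: runs_nset_seq; first by rewrite /=; clear; lia).
  apply: runs_nset; first by rewrite /=; clear; lia.
  set s1 := Memory _ _.
  have k1 : nmem s1 vk 0 = k by rewrite /= /update /=.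
  have ag1 : agree keepN keepR s0 s1.
    by do ![apply: agree_nset => //|apply: agree_rset => //].
  have own1 j : owners s1 j = if job k == j
      then (owners s j :|: interval_set m 0 (0 + sz k))%SET else owners s j.
    apply: owners_emit => [|l|l|l]; rewrite /= /update /= ?addn1 //.
    - by rewrite ks E.
    - by rewrite ks !E.
  have segE : segs_of s1 = segs_of s by [].
  have segnE : nmem s1 vSegs 0 = nmem s vSegs 0 by [].
  clearbody s1; split => //; split => //; exists load.
  case: bk => [bsegs bn bcard bnew bload blast border].
  have neq i : (i < n)%N -> i != k -> (job k == job i) = false.
    by move=> in_; apply: contraNF => /eqP e; apply/eqP; apply: job_inj.
  split.
  + by rewrite segE.
  + by rewrite segnE leqW.
  + move=> i; rewrite ltnS leq_eqVlt => /orP[/eqP->|ik].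
      rewrite own1 eqxx bnew ?leqnn // finset.set0U card_interval_set ?subn0 ?add0n //=.
      exact: sz_le.
    by rewrite own1 neq ?bcard ?(ltn_eqF ik) // (ltn_trans ik).
  + move=> i /andP[ki in_]; rewrite own1 neq ?gtn_eqF //.
    by rewrite bnew // in_ andbT ltnW.
  + move=> i p; rewrite ltnS leq_eqVlt => /orP[/eqP->|ik]; first by rewrite (negbTE kbig).
    by rewrite own1 neq ?(ltn_eqF ik) ?(ltn_trans ik) //; apply: bload.
  + move=> p; have [->|[i [ik ismall ip ->]]] := blast p; [by left|right].
    exists i; split => //; first exact: ltnW.
    by rewrite own1 neq ?(ltn_eqF ik) // (ltn_trans ik).
  + move=> i i' p /andP[ii']; rewrite ltnS leq_eqVlt => /orP[/eqP->|i'k].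
      by rewrite (negbTE kbig).
    have ik := ltn_trans ii' i'k.
    rewrite !own1 !neq ?(ltn_eqF ik) ?(ltn_eqF i'k) ?(ltn_trans _ kn) //.
    by apply: border; rewrite ii'.
Qed.

Lemma runs_block_phase Q :
  (forall s, agree keepN keepR s0 s ->
     (forall i, (i < n)%N -> #|owners s (job i)| = sz i) ->
     (forall i i' (p : 'I_m), (i < i' < n)%N -> small i -> small i' ->
        p \in owners s (job i) -> p \in owners s (job i') -> finish i <= start i') ->
     Q s) ->
  runs block_phase s0 (1000 * n.+1 ^ 2) Q.
Proof.
move=> exitQ.
do 3 (apply: runs_nset_seq; first by rewrite /=; clear; lia).
apply: runs_rset_seq; first by rewrite /=; clear; lia.
apply: runs_nset_seq; first by rewrite /=; clear; lia.
apply: (@runs_for _ _ _ _ (600 * n.+1) n block_inv).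
- by rewrite /=; clear; nia.
- by move=> i s [ag _]; have /= E := agreeE ag; rewrite /= E.
- set s1 := nset _ _ _ _.
  have own1 j : owners s1 j = finset.set0.
    by apply/setP => p; rewrite !inE; apply/negbTE/negP => /existsP[[]].
  split; first by rewrite /s1 /nset; do ![apply: agree_nset => //|apply: agree_rset => //].
  exists (fun=> 0); split => //.
  + rewrite /s1 /= /update /=; split.
    * by move=> [|g] //= _; rewrite add0n.
    * by move=> p; exists 0%N; rewrite // /in_segment /= add0n ltn_ord.
    * by move=> [|g] [|g'].
    * by move=> [|g].
  + by move=> p; left.
  + by move=> i i' p; rewrite ltn0 andbF.
- move=> k s kn ks inv.
  apply: (runs_weaken (runs_block_body kn ks inv)); first by clear -kn; lia.
  move=> s' [k' [ag' [load bk]]]; split => //.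
  split; first by rewrite /nset; do ![apply: agree_nset => //|apply: agree_rset => //].
  by exists load; case: bk.
- move=> s _ [ag [load [_ _ card _ _ _ order]]].
  exact: exitQ.
Qed.

End BlockPhase.

(** * Execution pieces *)

Definition clamp (R : realType) (a b x : R) := Num.min (Num.max x a) b.

Lemma clamp_homo (R : realType) (a b x y : R) : x <= y -> clamp a b x <= clamp a b y.
Proof. by move=> xy; rewrite /clamp le_min2 // le_max2. Qed.

(** Slot c is the time from [front c + shift c] to [front c.+1 + shift c.+1]. If c is small, the
    slot replays the times from [front c] to [front c.+1] of the schedule of the small jobs; if c is
    big, it holds the run of job c. A small job i meets slot c in the intersection with its own
    interval, a big one only in slot c = i; every other piece is empty. *)
Definition slot_start (R : realType) (small : pred nat) (start finish front shift : nat -> R) i c :=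
  (if small i then clamp (start i) (finish i) (front c) else front c) + shift c.

Definition slot_end (R : realType) (small : pred nat) (dur start finish front shift : nat -> R) i c :=
  if small i then clamp (start i) (finish i) (front c.+1) + shift c
  else front c + shift c + if c == i then dur i else 0.

Section Slots.
Context {R : realType} (m n : nat) (sz : nat -> nat).
Context (dur start finish front shift : nat -> R).
Let small i := (sz i + sz i <= m)%N.
Hypothesis tm : timing m sz dur start finish front shift n.
Hypothesis dur_gt0 : forall i, (i < n)%N -> 0 < dur i.
Local Notation reach c := (front c + shift c).
Local Notation lo := (slot_start small start finish front shift).
Local Notation hi := (slot_end small dur start finish front shift).

Lemma front_le i : (i < n)%N -> front i <= front i.+1.
Proof.
by move=> ik; rewrite (timing_front tm ik); case: ifP => // _; rewrite le_max lexx.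
Qed.

Lemma shift_le i : (i < n)%N -> shift i <= shift i.+1.
Proof.
move=> ik; rewrite (timing_shift tm ik); case: ifP => // _.
by rewrite lerDl ltW ?dur_gt0.
Qed.

Lemma reach_le c d : (c <= d)%N -> (d <= n)%N -> reach c <= reach d.
Proof.
elim: d => [|d IH]; first by rewrite leqn0 => /eqP->.
rewrite leq_eqVlt => /orP[/eqP->//|cd] dn.
by apply: le_trans (IH cd (ltnW dn)) _; rewrite lerD ?front_le ?shift_le.
Qed.

Lemma front_ge0 i : (i <= n)%N -> 0 <= front i.
Proof.
elim: i => [|i IH] ik; first by rewrite (timing_front0 tm).
exact: le_trans (IH (ltnW ik)) (front_le ik).
Qed.

Lemma shift_ge0 i : (i <= n)%N -> 0 <= shift i.
Proof.
elim: i => [|i IH] ik; first by rewrite (timing_shift0 tm).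
exact: le_trans (IH (ltnW ik)) (shift_le ik).
Qed.

Lemma slot_le i c : (i < n)%N -> (c <= i)%N -> lo i c <= hi i c.
Proof.
move=> ik ci; rewrite /slot_start /slot_end; case: ifP => _.
  by rewrite lerD2r clamp_homo // front_le // (leq_ltn_trans ci).
by rewrite lerDl; case: eqP => // _; rewrite ltW ?dur_gt0.
Qed.

(** For a small job the sum telescopes, since [front 0] is 0 and [front i.+1] is at least
    [finish i]. So slots up to the job's own rank suffice. *)
Lemma slot_sum i : (i < n)%N -> \sum_(c < i.+1) (hi i c - lo i c) = dur i.
Proof.
move=> ik; rewrite /slot_start /slot_end.
have [ismall|ibig] := boolP (small i); last first.
  rewrite big_ord_recr /= big1 => [|c _]; last by rewrite (ltn_eqF (ltn_ord c)) addr0 subrr.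
  by rewrite eqxx add0r; ring.
under eq_bigr => c _ do rewrite opprD addrACA subrr addr0.
rewrite -(big_mkord xpredT (fun c => clamp _ _ (front c.+1) - clamp _ _ (front c))).
rewrite telescope_sumr // (timing_front0 tm).
have [S0 CE _ _] := timing_start tm ik ismall.
have SC : start i <= finish i by rewrite CE lerDl ltW ?dur_gt0.
rewrite (timing_front tm ik) -/(small i) ismall.
rewrite /clamp [Num.max 0 _]max_r // [Num.min (start i) _]min_l //.
rewrite min_r; last by rewrite !le_max lexx !orbT.
by rewrite CE; ring.
Qed.

(** Emptiness must be excluded: an empty piece may lie outside its slot, because clamping moves it
    to an end of the job's interval. In particular no small job has a nonempty piece in a slot of a
    big job. *)
Lemma slot_in i c : (i < n)%N -> (c <= i)%N -> lo i c < hi i c ->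
  [/\ reach c <= lo i c, hi i c <= reach c.+1 &
      if small i then [/\ small c, start i + shift c <= lo i c & hi i c <= finish i + shift c]
      else c = i].
Proof.
move=> ik ci; have cn := leq_ltn_trans ci ik.
have := timing_front tm cn; have := timing_shift tm cn.
rewrite /slot_start /slot_end.
have [ismall|ibig] := boolP (small i); last first.
  have [-> sE fE _|_ _ _] := eqVneq c i; last by rewrite addr0 ltxx.
  by rewrite fE sE -/(small i) (negbTE ibig) addrA.
have [S0 CE _ _] := timing_start tm ik ismall.
have SC : start i <= finish i by rewrite CE lerDl ltW ?dur_gt0.
have := shift_le cn; have := front_le cn.
rewrite -/(small c); case: ifP => csmall; last first.
  by move=> _ _ _ ->; rewrite ltxx.
move=> f_le s_le sE fE; rewrite ltrD2r /clamp => lt.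
have : Num.max (front c) (start i) < finish i.
  rewrite ltNge; apply/negP => C_le; move: lt.
  by rewrite [ltLHS]min_r // ltNge ge_min lexx orbT.
move=> ltC; rewrite [ltLHS]min_l ?ltW // in lt.
have ltF : start i < front c.+1.
  rewrite ltNge; apply/negP => F_le; move: lt; rewrite [Num.max (front c.+1) _]max_r //.
  by rewrite lt_min ltNge le_max lexx orbT.
rewrite (min_l (ltW ltC)) (max_l (ltW ltF)).
split.
- by rewrite lerD2r le_max lexx.
- by rewrite sE lerD2r ge_min lexx.
- split; [by []|by rewrite lerD2r le_max lexx orbT|by rewrite lerD2r ge_min lexx orbT].
Qed.

(** Reversal of time turns intervals closed on the left into intervals closed on the right. *)
Definition in_piece (rev : bool) (x a b : R) := if rev then a < x <= b else a <= x < b.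

Lemma in_piece_lt rev x a b : in_piece rev x a b -> a < b.
Proof.
by case: rev => /andP[? ?]; [apply: lt_le_trans|apply: le_lt_trans]; eassumption.
Qed.

Lemma in_piece_sub rev x a b a' b' :
  in_piece rev x a b -> a' <= a -> b <= b' -> in_piece rev x a' b'.
Proof. by case: rev => /andP[? ?] ? ?; apply/andP; split; lra. Qed.

Lemma in_piece_disjoint rev x a b a' b' :
  in_piece rev x a b -> in_piece rev x a' b' -> b <= a' -> False.
Proof. by case: rev => /andP[? ?] /andP[? ?] ?; lra. Qed.

(** Distinct slots are disjoint. Within one slot the small jobs are all translated by the same
    [shift c], so two that run together already overlap in the schedule of the small jobs, where the
    allocation of processors separates them. *)
Lemma slot_conflict rev x i c i' c' :
  (i < n)%N -> (c <= i)%N -> (i' < n)%N -> (c' <= i')%N ->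
  in_piece rev x (lo i c) (hi i c) -> in_piece rev x (lo i' c') (hi i' c') ->
  c = c' /\ (i = i' \/ [/\ small i, small i', ~ (finish i <= start i') &
                           ~ (finish i' <= start i)]).
Proof.
move=> ik ci ik' ci' xi xi'.
have [r1 r2 r3] := slot_in ik ci (in_piece_lt xi).
have [r1' r2' r3'] := slot_in ik' ci' (in_piece_lt xi').
have xr := in_piece_sub xi r1 r2; have xr' := in_piece_sub xi' r1' r2'.
have cE : c = c'.
  case: (ltngtP c c') => // cc; exfalso.
    by apply: (in_piece_disjoint xr xr'); apply: reach_le cc _; apply: ltnW; apply: leq_ltn_trans ci' ik'.
  by apply: (in_piece_disjoint xr' xr); apply: reach_le cc _; apply: ltnW; apply: leq_ltn_trans ci ik.
subst c'; split => //.
move: r3 r3'; case: ifP => ismall; case: ifP => ismall'.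
- move=> [_ s1 s2] [_ s1' s2']; right; split => //.
    move=> fs; apply: (in_piece_disjoint (in_piece_sub xi s1 s2) (in_piece_sub xi' s1' s2')).
    by rewrite lerD2r.
  move=> fs; apply: (in_piece_disjoint (in_piece_sub xi' s1' s2') (in_piece_sub xi s1 s2)).
  by rewrite lerD2r.
- by move=> [csmall _ _] cE; move: ismall'; rewrite -cE csmall.
- by move=> cE [csmall _ _]; move: ismall; rewrite -cE csmall.
- by move=> <- <-; left.
Qed.

Lemma shiftE i : (i <= n)%N -> shift i = \sum_(l < i | ~~ small l) dur l.
Proof.
elim: i => [|i IH] ik; first by rewrite big_ord0 (timing_shift0 tm).
have := IH (ltnW ik); rewrite big_mkcond => IHE.
rewrite [RHS]big_mkcond [RHS]big_ord_recr /= -IHE (timing_shift tm ik) -/(small i).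
by case: (small i); rewrite /= ?addr0.
Qed.

Lemma front_cases i : (i <= n)%N ->
  front i = 0 \/ exists l, [/\ (l < i)%N, small l & front i = finish l].
Proof.
elim: i => [|i IH] ik; first by left; rewrite (timing_front0 tm).
have old : front i = 0 \/ exists l, [/\ (l < i.+1)%N, small l & front i = finish l].
  have [->|[l [li ls ->]]] := IH (ltnW ik); [by left|right].
  by exists l; split => //; apply: ltnW.
rewrite (timing_front tm ik) -/(small i); case: ifP => // ismall.
by case: (leP (front i) (finish i)) => // _; right; exists i.
Qed.

(** Let l be the last small job to end and d = D i / ratio. Then m+1 times the completion time is at
    most 2 (small_area - dur l) + 2 big_area + (m+1) dur l, hence at most 2md + (m-1) dur l and so
    (3m-1) d. The quotient (3m-1)/(m+1) is the ratio; the estimate is worst for a last job of size 1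
    and duration d. *)
Lemma completion_bound (D : nat -> R) i : (0 < m)%N -> (i < n)%N ->
  let ratio : R := 3 - 4 / (m + 1)%:R in
  (forall l, (l <= i)%N -> (0 < sz l)%N) ->
  (forall l, (l <= i)%N -> dur l <= D l / ratio) ->
  (forall l, (l <= i)%N -> D l <= D i) ->
  \sum_(l < i.+1) (sz l)%:R * dur l <= m%:R * D i / ratio ->
  reach i.+1 <= D i.
Proof.
move=> m0 ik ratio sz0 durD Dle area.
have M1 : 1 <= m%:R :> R by rewrite ler1n.
have m1E : (m + 1)%:R = m%:R + 1 :> R by rewrite natrD.
have m1_gt0 : 0 < m%:R + 1 :> R by lra.
have ratioE : ratio = (3 * m%:R - 1) / (m%:R + 1).
  by rewrite /ratio m1E; field; rewrite gt_eqF.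
have ratio0 : 0 < ratio by rewrite ratioE divr_gt0 //; lra.
pose d := D i / ratio; have DE : D i = d * ratio by rewrite /d divfK ?gt_eqF.
have {}area : \sum_(l < i.+1) (sz l)%:R * dur l <= m%:R * d by rewrite /d mulrA.
have durd l : (l <= i)%N -> dur l <= d.
  move=> li; apply: le_trans (durD l li) _.
  by rewrite ler_pM2r ?invr_gt0 // Dle.
have d0 : 0 <= d by apply: le_trans (durd i (leqnn i)); rewrite ltW ?dur_gt0.
have dur0 l : (l < i.+1)%N -> 0 < dur l by move=> li; rewrite dur_gt0 // (leq_trans li).
set big_area := \sum_(l < i.+1 | ~~ small l) (sz l)%:R * dur l.
set small_area := \sum_(l < i.+1 | small l) (sz l)%:R * dur l.
have areaE : \sum_(l < i.+1) (sz l)%:R * dur l = small_area + big_area.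
  by rewrite (bigID (fun l : 'I_i.+1 => small l)).
(* A big job occupies at least (m+1)/2 processors, because twice its size is an integer above m. *)
have shift_area : shift i.+1 * (m%:R + 1) <= 2 * big_area.
  rewrite shiftE // mulr_suml mulr_sumr; apply: ler_sum => l lbig.
  rewrite [leRHS](_ : _ = dur l * ((sz l)%:R + (sz l)%:R)); last by ring.
  rewrite ler_pM2l ?dur0 // natr1 -natrD ler_nat.
  by move: lbig; rewrite /small -ltnNge.
have small0 : 0 <= small_area.
  by apply: sumr_ge0 => l _; rewrite mulr_ge0 // ltW // dur0.
rewrite DE -(ler_pM2r m1_gt0).
have -> : d * ratio * (m%:R + 1) = d * (3 * m%:R - 1).
  by rewrite ratioE; field; rewrite gt_eqF.
have [->|[l [li lsmall ->]]] := front_cases ik.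
  rewrite add0r; apply: le_trans shift_area _; nra.
have [S0 -> Sarea _] := timing_start tm (leq_trans li ik) lsmall.
have sz1 : 1 <= (sz l)%:R :> R by rewrite ler1n sz0.
have small_split : \sum_(j < l | small j) (sz j)%:R * dur j + dur l <= small_area.
  rewrite /small_area -(big_mkord small (fun j => (sz j)%:R * dur j)).
  rewrite -[in leRHS](big_mkord small (fun j => (sz j)%:R * dur j)).
  rewrite (@big_cat_nat _ _ _ l.+1 0 i.+1) //= big_mkcond [X in _ <= X + _]big_mkcond.
  rewrite big_nat_recr //= lsmall -addrA lerD2l.
  have tail0 : 0 <= \sum_(l.+1 <= j < i.+1 | small j) (sz j)%:R * dur j.
    rewrite big_nat_cond; apply: sumr_ge0 => j /andP[/andP[_ ji] _].
    by rewrite mulr_ge0 // ltW // dur0.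
  rewrite -[leLHS]addr0 lerD //.
  by rewrite ler_peMl // ltW // dur0.
have := durd l li; have := dur0 l li.
move: Sarea; rewrite -natr1 => Sarea durl0 durld.
have := dur_gt0 (leq_trans li ik).
nra.
Qed.

End Slots.

(** * Program for the execution pieces *)

Definition pieces_ := NGet aCount (NConst 0).

Definition emit_piece (rev : bool) lo hi :=
  (NSet aPieceJob pieces_ job_ ;;
   RSet rPieceStart pieces_
     (if rev then RSub (RGet rDeadline job_) hi else RAdd (RGet rRelease job_) lo) ;;
   RSet rPieceEnd pieces_
     (if rev then RSub (RGet rDeadline job_) lo else RAdd (RGet rRelease job_) hi) ;;
   RSet rPieceSpeed pieces_ (RMul (RVar vRatio) (RGet rSpeed (Var vk))) ;;
   NSet aCount (NConst 0) (NAdd pieces_ (NConst 1)))%cmd.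

(** The clamped front that ends one piece also begins the next, up to the shift, so it is handed on
    in [vLo]. Empty pieces are emitted as well: they are harmless, and a job of rank k has at most k
    + 1 pieces. *)
Definition small_piece rev :=
  (RSet vHi (NConst 0) (RGet rFront (NAdd (Var vg) (NConst 1))) ;;
   If (BLeR (RVar vHi) (RGet rStart (Var vk)))
      (RSet vHi (NConst 0) (RGet rStart (Var vk))) Skip ;;
   If (BLeR (RGet rEnd (Var vk)) (RVar vHi))
      (RSet vHi (NConst 0) (RGet rEnd (Var vk))) Skip ;;
   emit_piece rev (RAdd (RVar vLo) (RGet rShift (Var vg)))
                  (RAdd (RVar vHi) (RGet rShift (Var vg))) ;;
   RSet vLo (NConst 0) (RVar vHi))%cmd.

Definition piece_body rev :=
  If small_
    (RSet vLo (NConst 0) (RGet rStart (Var vk)) ;; For vg next_ (small_piece rev))%cmd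
    (RSet vLo (NConst 0) (RAdd (RGet rFront (Var vk)) (RGet rShift (Var vk))) ;;
     RSet vHi (NConst 0) (RAdd (RVar vLo) (RGet rDur (Var vk))) ;;
     emit_piece rev (RVar vLo) (RVar vHi))%cmd.

Definition piece_phase rev :=
  (NSet aCount (NConst 0) (NConst 0) ;; For vk njobs_ (piece_body rev))%cmd.

Definition piece_speed (R : realType) (s : memory R) j t : R :=
  \sum_(k < nmem s aCount 0 | (nmem s aPieceJob k == j) &&
     (rmem s rPieceStart k <= t < rmem s rPieceEnd k)) rmem s rPieceSpeed k.

Lemma piece_speed_emit (R : realType) (s s' : memory R) i a b v j t :
  let K := nmem s aCount 0 in
  nmem s' aCount 0 = K.+1 ->
  (forall l, nmem s' aPieceJob l = if l == K then i else nmem s aPieceJob l) ->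
  (forall l, rmem s' rPieceStart l = if l == K then a else rmem s rPieceStart l) ->
  (forall l, rmem s' rPieceEnd l = if l == K then b else rmem s rPieceEnd l) ->
  (forall l, rmem s' rPieceSpeed l = if l == K then v else rmem s rPieceSpeed l) ->
  piece_speed s' j t =
    piece_speed s j t + (if i == j then if a <= t < b then v else 0 else 0).
Proof.
move=> K KE jE aE bE vE.
rewrite /piece_speed KE big_mkcond big_ord_recr /= jE aE bE vE eqxx.
congr (_ + _); last by case: (i == j).
rewrite [RHS]big_mkcond; apply: eq_bigr => l _.
by rewrite jE aE bE vE (ltn_eqF (ltn_ord l)).
Qed.

Section PiecePhase.
Context {R : realType} (rev : bool) (s0 : memory R).
Let n := nmem s0 aDim 0.
Let m := nmem s0 aDim 1.
Let job := nmem s0 aJob.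
Let sz k := nmem s0 aSize (job k).
Let dur := rmem s0 rDur.
Let start := rmem s0 rStart.
Let finish := rmem s0 rEnd.
Let front := rmem s0 rFront.
Let shift := rmem s0 rShift.
Let small k := (sz k + sz k <= m)%N.
Let sigma k := rmem s0 vRatio 0 * rmem s0 rSpeed k.

Local Notation keepN := [:: aDim; aSize; aJob; aBlockJob; aBlockStart; aBlockLen].
Local Notation keepR := [:: rRelease; rDeadline; rWork; rSpeed; vRatio;
  rDur; rStart; rEnd; rFront; rShift].

Let slot_lo := slot_start small start finish front shift.
Let slot_hi := slot_end small dur start finish front shift.
Definition piece_lo i c :=
  if rev then rmem s0 rDeadline (job i) - slot_hi i c
  else rmem s0 rRelease (job i) + slot_lo i c.
Definition piece_hi i c :=
  if rev then rmem s0 rDeadline (job i) - slot_lo i c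
  else rmem s0 rRelease (job i) + slot_hi i c.
Definition piece_at i c t := if piece_lo i c <= t < piece_hi i c then sigma i else 0.

Definition piece_inv k (s : memory R) :=
  [/\ agree keepN keepR s0 s, nmem s aCount 1 = nmem s0 aCount 1 &
      forall j t, piece_speed s j t =
        \sum_(i < k | job i == j) \sum_(c < i.+1) piece_at i c t].

Definition slot_inv k c (s : memory R) :=
  [/\ agree keepN keepR s0 s, nmem s aCount 1 = nmem s0 aCount 1,
      nmem s vk 0 = k, rmem s vLo 0 = clamp (start k) (finish k) (front c) &
      forall j t, piece_speed s j t =
        \sum_(i < k | job i == j) \sum_(c < i.+1) piece_at i c t +
        if job k == j then \sum_(d < c) piece_at k d t else 0].

Hypothesis shape : forall k, (k < n)%N -> small k -> 0 <= start k <= finish k.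
Hypothesis front0 : front 0%N = 0.

(** The two ends are evaluated after some of the piece has been written, at a point that depends on
    [rev]. Their values are therefore required in every memory that agrees with [s] on what they
    read. *)
Lemma runs_emit_piece k c (s : memory R) lo hi Q :
  agree keepN keepR s0 s -> nmem s aCount 1 = nmem s0 aCount 1 -> nmem s vk 0 = k ->
  (rcost lo <= 10)%N -> (rcost hi <= 10)%N ->
  (forall s', nmem s' aCount = nmem s aCount -> nmem s' vk = nmem s vk ->
     nmem s' vg = nmem s vg -> rmem s' vLo = rmem s vLo -> rmem s' vHi = rmem s vHi ->
     agree keepN keepR s0 s' -> reval s' lo = slot_lo k c) ->
  (forall s', nmem s' aCount = nmem s aCount -> nmem s' vk = nmem s vk ->
     nmem s' vg = nmem s vg -> rmem s' vLo = rmem s vLo -> rmem s' vHi = rmem s vHi ->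
     agree keepN keepR s0 s' -> reval s' hi = slot_hi k c) ->
  (forall s', agree keepN keepR s0 s' -> nmem s' aCount 1 = nmem s0 aCount 1 ->
     nmem s' vk = nmem s vk -> nmem s' vg = nmem s vg -> rmem s' vHi = rmem s vHi ->
     (forall j t, piece_speed s' j t = piece_speed s j t +
        if job k == j then piece_at k c t else 0) -> Q s') ->
  runs (emit_piece rev lo hi) s 100 Q.
Proof.
move=> ag cnt1 ks clo chi loE hiE exitQ.
have /= E := agreeE ag.
apply: runs_nset_seq => //.
set s1 := Memory _ _.
have ag1 : agree keepN keepR s0 s1.
  by do ![apply: agree_nset => //|apply: agree_rset => //].
apply: runs_rset_seq; first by case: (rev); rewrite /=; clear -clo chi; lia.
set s2 := Memory _ _.
have ag2 : agree keepN keepR s0 s2.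
  by do ![apply: agree_nset => //|apply: agree_rset => //].
apply: runs_rset_seq; first by case: (rev); rewrite /=; clear -clo chi; lia.
set s3 := Memory _ _.
have ag3 : agree keepN keepR s0 s3.
  by do ![apply: agree_nset => //|apply: agree_rset => //].
apply: runs_rset_seq; first by case: (rev); rewrite /=; clear -clo chi; lia.
apply: runs_nset; first by case: (rev); rewrite /=; clear -clo chi; lia.
set s4 := Memory _ _.
have ag4 : agree keepN keepR s0 s4.
  by do ![apply: agree_nset => //|apply: agree_rset => //].
have lo1 : reval s1 lo = slot_lo k c by apply: loE.
have hi1 : reval s1 hi = slot_hi k c by apply: hiE.
have lo2 : reval s2 lo = slot_lo k c by apply: loE.
have hi2 : reval s2 hi = slot_hi k c by apply: hiE.
apply: exitQ => //.
move=> j t; apply: (@piece_speed_emit _ _ _ (job k) (piece_lo k c) (piece_hi k c) (sigma k)).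
- by rewrite /= /update /= addn1.
- by move=> l; rewrite /= /update /= ks E.
- move=> l.
  rewrite -[rmem s4 _ l]/(if l == nmem s aCount 0 then _ else rmem s rPieceStart l).
  case: eqP => // _; rewrite /piece_lo; case: (rev).
    by rewrite -[LHS]/(rmem s1 rDeadline (nmem s1 aJob (nmem s vk 0)) - reval s1 hi) hi1 ks
      (agree_rmem ag1) // (agree_nmem ag1).
  by rewrite -[LHS]/(rmem s1 rRelease (nmem s1 aJob (nmem s vk 0)) + reval s1 lo) lo1 ks
      (agree_rmem ag1) // (agree_nmem ag1).
- move=> l.
  rewrite -[rmem s4 _ l]/(if l == nmem s aCount 0 then _ else rmem s rPieceEnd l).
  case: eqP => // _; rewrite /piece_hi; case: (rev).
    by rewrite -[LHS]/(rmem s1 rDeadline (nmem s1 aJob (nmem s vk 0)) - reval s2 lo) lo2 ks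
      (agree_rmem ag1) // (agree_nmem ag1).
  by rewrite -[LHS]/(rmem s1 rRelease (nmem s1 aJob (nmem s vk 0)) + reval s2 hi) hi2 ks
      (agree_rmem ag1) // (agree_nmem ag1).
- move=> l; rewrite /= /update /= /sigma.
  by case: eqP => // _; rewrite ks !E.
Qed.

Lemma runs_small_piece k c (s : memory R) :
  small k -> start k <= finish k -> nmem s vg 0 = c -> slot_inv k c s ->
  runs (small_piece rev) s 200
    (fun s' => nmem s' vg 0 = c /\ slot_inv k c.+1 (nset s' vg 0 c.+1)).
Proof.
move=> ksmall SC gc [ag cnt1 ks lo spd].
have /= E := agreeE ag.
suff final s1 : agree keepN keepR s0 s1 -> nmem s1 aCount = nmem s aCount ->
    nmem s1 vk = nmem s vk -> nmem s1 vg = nmem s vg -> rmem s1 vLo = rmem s vLo ->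
    (forall j t, piece_speed s1 j t = piece_speed s j t) ->
    rmem s1 vHi 0 = clamp (start k) (finish k) (front c.+1) ->
    runs (emit_piece rev (RAdd (RVar vLo) (RGet rShift (Var vg)))
                  (RAdd (RVar vHi) (RGet rShift (Var vg))) ;;
          RSet vLo (NConst 0) (RVar vHi))%cmd s1 120
      (fun s' => nmem s' vg 0 = c /\ slot_inv k c.+1 (nset s' vg 0 c.+1)).
  apply: runs_rset_seq => //.
  set s1 := Memory _ _.
  have hi1 : rmem s1 vHi 0 = front c.+1.
    by rewrite /= /update /= !E gc addn1.
  have ag1 : agree keepN keepR s0 s1.
    by do ![apply: agree_nset => //|apply: agree_rset => //].
  have /= E1 := agreeE ag1.
  apply: (@runs_seq _ _ _ _ 20) => //.
  have next s2 : agree keepN keepR s0 s2 -> nmem s2 aCount = nmem s aCount ->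
      nmem s2 vk = nmem s vk -> nmem s2 vg = nmem s vg -> rmem s2 vLo = rmem s vLo ->
      (forall j t, piece_speed s2 j t = piece_speed s j t) ->
      rmem s2 vHi 0 = Num.max (front c.+1) (start k) ->
      runs (If (BLeR (RGet rEnd (Var vk)) (RVar vHi))
             (RSet vHi (NConst 0) (RGet rEnd (Var vk))) Skip ;;
           emit_piece rev (RAdd (RVar vLo) (RGet rShift (Var vg)))
                  (RAdd (RVar vHi) (RGet rShift (Var vg))) ;;
           RSet vLo (NConst 0) (RVar vHi))%cmd s2 150
       (fun s' => nmem s' vg 0 = c /\ slot_inv k c.+1 (nset s' vg 0 c.+1)).
    move=> ag2 c2 k2 g2 lo2 spd2 hi2; have /= E2 := agreeE ag2.
    apply: (@runs_seq _ _ _ _ 20) => //.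
    apply: runs_if => //=; rewrite hi2 !E2 k2 ks -/finish => cmp.
    - apply: runs_rset => //=.
      apply: (@runs_weaken _ _ _ 120 _ _ _ _ _ (fun _ => id)) => //.
      apply: final => //=.
        by do ![apply: agree_nset => //|apply: agree_rset => //].
      by rewrite /update /= !E2 k2 ks /clamp min_r.
    - apply: runs_skip => //.
      apply: (@runs_weaken _ _ _ 120 _ _ _ _ _ (fun _ => id)) => //.
      apply: final => //=.
      by rewrite hi2 /clamp min_l // ltW // ltNge.
  have bE : beval s1 (BLeR (RVar vHi) (RGet rStart (Var vk))) = (front c.+1 <= start k).
    by rewrite /= -hi1 /update /= !E ks.
  apply: runs_if => //; rewrite bE => cmp.
  - apply: runs_rset => //.
    apply: (@runs_weaken _ _ _ 150 _ _ _ _ _ (fun _ => id)) => //.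
    apply: next => //=.
      by do ![apply: agree_nset => //|apply: agree_rset => //].
    by rewrite /update /= !E ks max_r.
  - apply: runs_skip => //.
    apply: (@runs_weaken _ _ _ 150 _ _ _ _ _ (fun _ => id)) => //.
    apply: next => //.
    by rewrite hi1 max_l // ltW // ltNge.
move=> ag1 c1 k1 g1 lo1 spd1 hi1.
apply: (@runs_seq _ _ _ _ 100) => //.
apply: (@runs_emit_piece k c) => //.
- by rewrite c1.
- by rewrite k1.
- move=> s2 _ k2 g2 lo2 hi2 ag2; have /= E2 := agreeE ag2.
  by rewrite /= lo2 lo1 lo g2 g1 gc !E2 /slot_lo /slot_start ksmall.
- move=> s2 _ k2 g2 lo2 hi2 ag2; have /= E2 := agreeE ag2.
  by rewrite /= hi2 hi1 g2 g1 gc !E2 /slot_hi /slot_end ksmall.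
move=> s2 ag2 cnt2 k2 g2 hi2 spd2; apply: runs_rset => //.
rewrite -[nmem (Memory _ _) vg 0]/(nmem s2 vg 0) g2 g1; split => //; split.
- by rewrite /nset; do ![apply: agree_nset => //|apply: agree_rset => //].
- by [].
- by rewrite -[LHS]/(nmem s2 vk 0) k2 k1.
- by rewrite -[LHS]/(rmem s2 vHi 0) hi2.
- move=> j t; rewrite -[LHS]/(piece_speed s2 j t) spd2 spd1 spd.
  by case: eqP => _; rewrite ?addr0 // big_ord_recr /= addrA.
Qed.

Lemma runs_piece_body k (s : memory R) :
  (k < n)%N -> nmem s vk 0 = k -> piece_inv k s ->
  runs (piece_body rev) s (300 * k.+2)
    (fun s' => nmem s' vk 0 = k /\ piece_inv k.+1 s').
Proof.
move=> kn ks [ag cnt1 spd].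
have /= E := agreeE ag.
have smallE : beval s small_ = small k by rewrite /= ks !E.
apply: runs_if; rewrite ?smallE; [|move=> ksmall|move=> kbig].
- by rewrite [bcost _]/=; clear; lia.
- have /andP[S0 SC] := shape kn ksmall.
  apply: runs_rset_seq; first by rewrite /=; clear; lia.
  apply: (@runs_for _ _ _ _ 200 k.+1 (slot_inv k)).
  + by rewrite /=; clear; lia.
  + by move=> c s1 [_ _ k1 _ _]; rewrite /= k1 addn1.
  + split => //=.
    * by rewrite /nset; do ![apply: agree_nset => //|apply: agree_rset => //].
    * by rewrite /update /= ks !E front0 /clamp max_r // min_l.
    * move=> j t; rewrite -[LHS]/(piece_speed s j t) spd.
      by case: eqP => _; rewrite ?big_ord0 addr0.
  + by move=> c s1 _ gc inv; apply: runs_small_piece.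
  + move=> s1 _ [ag1 c1 k1 _ spd1]; split => //; split => // j t.
    by rewrite spd1 big_mkcond [RHS]big_mkcond [RHS]big_ord_recr.
- do 2 (apply: runs_rset_seq; first by rewrite /=; clear; lia).
  set s1 := Memory _ _.
  have ag1 : agree keepN keepR s0 s1.
    by do ![apply: agree_nset => //|apply: agree_rset => //].
  have lo1 : rmem s1 vLo 0 = front k + shift k by rewrite /= /update /= !E ks.
  have hi1 : rmem s1 vHi 0 = front k + shift k + dur k by rewrite /= /update /= !E ks.
  apply: (@runs_weaken _ _ _ 100 _ _ _ _ _ (fun _ => id)); last first.
    by rewrite /=; clear; lia.
  apply: (@runs_emit_piece k k) => //.
  + by move=> s2 _ _ _ lo2 _ _; rewrite /= lo2 lo1 /slot_lo /slot_start (negbTE kbig).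
  + by move=> s2 _ _ _ _ hi2 _; rewrite /= hi2 hi1 /slot_hi /slot_end (negbTE kbig) eqxx.
  move=> s2 ag2 c2 k2 _ _ spd2; split; first by rewrite k2.
  split => // j t; rewrite spd2 -[piece_speed s1 j t]/(piece_speed s j t) spd.
  rewrite big_mkcond [RHS]big_mkcond [RHS]big_ord_recr /=; congr (_ + _).
  (* Only one piece was emitted, while the invariant sums over all slots up to [k]; the earlier
     pieces of a big job have equal ends and contribute 0. *)
  case: eqP => // _; rewrite big_ord_recr /= big1 ?add0r // => c _.
  rewrite /piece_at /piece_lo /piece_hi /slot_lo /slot_start /slot_hi /slot_end (negbTE kbig).
  rewrite (ltn_eqF (ltn_ord c)) addr0; case: ifP => // /andP[a b].
  by move: b; case: (rev) a => a b; have := le_lt_trans a b; rewrite ltxx.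
Qed.

Lemma runs_piece_phase Q :
  (forall s, agree keepN keepR s0 s -> nmem s aCount 1 = nmem s0 aCount 1 ->
     (forall j t, piece_speed s j t =
        \sum_(i < n | job i == j) \sum_(c < i.+1) piece_at i c t) -> Q s) ->
  runs (piece_phase rev) s0 (1000 * n.+1 ^ 2) Q.
Proof.
move=> exitQ; apply: runs_nset_seq; first by rewrite /=; clear; lia.
apply: (@runs_for _ _ _ _ (600 * n.+1) n piece_inv).
- by rewrite /=; clear; nia.
- by move=> i s [ag _ _]; have /= E := agreeE ag; rewrite /= E.
- split => //=.
  + rewrite /nset; do ![apply: agree_nset => //|apply: agree_rset => //].
  + by move=> j t; rewrite /piece_speed big_ord0 big1 // => -[].
- move=> k s kn ks inv.
  apply: (runs_weaken (runs_piece_body kn ks inv)); first by clear -kn; lia.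
  move=> s' [k' [ag1 c1 spd1]]; split => //; split => //.
  by rewrite /nset; do ![apply: agree_nset => //|apply: agree_rset => //].
- by move=> s _ [ag c1 spd]; apply: exitQ.
Qed.

End PiecePhase.

(** * Energy *)

Section Exclusive.
Context {R : realType} {I : finType} (P : pred I) (u : I -> R).
Hypothesis u_ge0 : forall i, 0 <= u i.
Hypothesis u_excl : forall i j, P i -> P j -> 0 < u i -> 0 < u j -> i = j.

(** This is the situation of the jobs of one processor at one instant, and of the pieces of one job:
    a sum with at most one positive term commutes with powers. *)
Lemma exclusiveP : (forall i, P i -> u i = 0) \/
  exists i, [/\ P i, 0 < u i & forall j, P j -> j != i -> u j = 0].
Proof.
have [[i /andP[Pi ui]]|none] := pselect (exists i, P i && (0 < u i)).
  right; exists i; split => // j Pj ji; apply/eqP; rewrite eq_le u_ge0 andbT leNgt.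
  by apply: contra ji => uj; apply/eqP; apply: u_excl.
left=> i Pi; apply/eqP; rewrite eq_le u_ge0 andbT leNgt; apply/negP => ui.
by apply: none; exists i; rewrite Pi.
Qed.

Lemma powR_sum_exclusive (a : R) : a != 0 ->
  (\sum_(i | P i) u i) `^ a = \sum_(i | P i) u i `^ a.
Proof.
move=> a0; have [z|[i [Pi _ z]]] := exclusiveP.
  by rewrite !big1 ?powR0 // => i /z ->; rewrite ?powR0.
rewrite (bigD1 i) //= [RHS](bigD1 i) //= !big1 ?addr0 // => j /andP[Pj ji].
  by rewrite z // powR0.
by rewrite z.
Qed.

Lemma sum_exclusive_le (g : I -> R) (c : R) : 0 <= c ->
  (forall i, P i -> u i = 0 -> g i = 0) -> (forall i, P i -> g i <= c) ->
  \sum_(i | P i) g i <= c.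
Proof.
move=> c0 g0 gc; have [z|[i [Pi _ z]]] := exclusiveP.
  by rewrite big1 // => i Pi; apply: g0; rewrite ?z.
rewrite (bigD1 i) //= big1 ?addr0 ?gc // => j /andP[Pj ji].
by apply: g0 => //; apply: z.
Qed.

End Exclusive.

Lemma tangent_powR (R : realType) (a s u : R) : 1 < a -> 0 < s -> 0 <= u ->
  a * s `^ (a - 1) * u <= u `^ a + (a - 1) * s `^ a.
Proof.
move=> a1 s0 u0; have a0 : 0 < a by lra.
have am0 : 0 < a - 1 by lra.
have q0 : 0 < a / (a - 1) by rewrite divr_gt0.
have pq : a^-1 + (a / (a - 1))^-1 = 1 by field; rewrite !gt_eqF.
have := conjugate_powR u0 (powR_ge0 s (a - 1)) a0 q0 pq.
have -> : (s `^ (a - 1)) `^ (a / (a - 1)) = s `^ a.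
  by rewrite -powRrM mulrCA divff ?gt_eqF // mulr1.
move=> h; have -> : u `^ a + (a - 1) * s `^ a =
    a * (u `^ a / a + s `^ a / (a / (a - 1))).
  by field; rewrite !gt_eqF.
by rewrite -mulrA [s `^ _ * u]mulrC ler_pM2l.
Qed.

(** Double counting: energy is summed over processors, whereas the estimates are per job. *)
Lemma sum_card_mul (R : realType) (I T : finType) (A : I -> {set T}) (c : I -> R) (P : pred I) :
  \sum_(p : T) \sum_(j | P j && (p \in A j)) c j = \sum_(j | P j) #|A j|%:R * c j.
Proof.
rewrite (exchange_big_dep P) /=; last by move=> p j _ /andP[].
apply: eq_bigr => j Pj; rewrite (eq_bigl (mem (A j))) => [|p]; last by rewrite Pj.
by rewrite sumr_const mulr_natl.
Qed.

(** * Integrals of finite sums and of step functions *)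

Section Integrals.
Context {R : realType}.
Local Notation mu := (@lebesgue_measure R).
Implicit Types (f g : R -> R) (D : set R).

Lemma integral_sum_fin (I : finType) (P : pred I) (F : I -> R -> R) D :
  measurable D ->
  (forall i, measurable_fun setT (F i)) -> (forall i t, 0 <= F i t) ->
  (\int[mu]_(t in D) (\sum_(i | P i) F i t)%:E =
   \sum_(i | P i) \int[mu]_(t in D) (F i t)%:E)%E.
Proof.
move=> mD mF F0.
rewrite -big_filter -ge0_integral_sum //.
- by apply: eq_integral => t _; rewrite -sumEFin big_filter.
- by move=> i; apply/measurable_EFinP; apply: measurable_funS (mF i).
- by move=> i t _; rewrite lee_fin.
Qed.

(** The inclusion in [D] is asked only of nonempty intervals, since an empty piece may lie outside
    the window of its job. *)
Lemma integral_itv_step (c a b : R) D : measurable D -> 0 <= c -> a <= b ->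
  (a < b -> `[a, b[ `<=` D)%classic ->
  (\int[mu]_(t in D) (if a <= t < b then c else 0)%:E = (c * (b - a))%:E)%E.
Proof.
move=> mD c0 ab sub.
under eq_integral => t _.
  rewrite (_ : (if a <= t < b then c else 0) = c * \1_(`[a, b[%classic) t); last first.
    by rewrite indicE mem_setE in_itv /=; case: ifP; rewrite ?mulr1 ?mulr0.
  rewrite EFinM; over.
rewrite ge0_integralZl_EFin //; last first.
  by apply/measurable_EFinP; apply: measurable_indic.
rewrite integral_indic //= setIidl; last first.
  by move: ab; rewrite le_eqVlt => /orP[/eqP->|/sub//]; rewrite set_itvco0.
rewrite lebesgue_measure_itv /= lte_fin; case: ltP => [_|ba].
  by rewrite -EFinD -EFinM.
have -> : b = a by apply/eqP; rewrite eq_le ab ba.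
by rewrite subrr mulr0 mule0.
Qed.

Lemma measurable_step (c a b : R) :
  measurable_fun setT (fun t : R => if a <= t < b then c else 0).
Proof.
rewrite (_ : (fun _ => _) = (fun t => c * \1_(`[a, b[%classic) t)); last first.
  apply: funext => t.
  by rewrite indicE mem_setE in_itv /=; case: ifP; rewrite ?mulr1 ?mulr0.
by apply: measurable_funM => //; apply: measurable_indic.
Qed.

Lemma measurable_sum_fin (I : finType) (P : pred I) (F : I -> R -> R) :
  (forall i, measurable_fun setT (F i)) ->
  measurable_fun setT (fun t => \sum_(i | P i) F i t).
Proof.
move=> mF.
rewrite (_ : (fun _ => _) = (fun t => \sum_(i <- [seq i <- index_enum I | P i]) F i t)).
  exact: measurable_sum.
by apply: funext => t; rewrite big_filter.
Qed.

End Integrals.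

(** * Energy and capacity of a schedule without conflicts *)

Section ScheduleEnergy.
Context {R : realType} (n m : nat) (S : schedule R n m) (alpha : R).
Hypothesis alpha_gt1 : 1 < alpha.
Hypothesis S_meas : forall j, measurable_fun setT (speed S j).
Hypothesis S_ge0 : forall j t, 0 <= speed S j t.
Hypothesis S_excl : forall t (p : 'I_m) i j, p \in procs S i -> p \in procs S j ->
  0 < speed S i t -> 0 < speed S j t -> i = j.
Local Notation mu := (@lebesgue_measure R).

Lemma measurable_speed_powR j : measurable_fun setT (fun t => speed S j t `^ alpha).
Proof. exact: (measurableT_comp (measurable_powR alpha) (S_meas j)). Qed.

Lemma proc_energy (p : 'I_m) :
  (\int[mu]_t ((proc_speed S p t) `^ alpha)%:E =
   \sum_(j < n | p \in procs S j) \int[mu]_t (speed S j t `^ alpha)%:E)%E.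
Proof.
rewrite -integral_sum_fin //.
- apply: eq_integral => t _; congr _%:E; apply: powR_sum_exclusive => //.
    by move=> i j; apply: S_excl.
  by rewrite gt_eqF // (lt_trans ltr01).
- by move=> j; apply: measurable_speed_powR.
- by move=> j t; apply: powR_ge0.
Qed.

Lemma energy_lower_bound (c : 'I_n -> R) :
  (forall j, ((c j)%:E <= \int[mu]_t (speed S j t `^ alpha)%:E)%E) ->
  ((\sum_(j < n) #|procs S j|%:R * c j)%:E <= energy alpha S)%E.
Proof.
move=> cj; rewrite -(sum_card_mul (procs S) c xpredT) /= -sumEFin /energy.
apply: lee_sum => p _; rewrite proc_energy -sumEFin.
exact: lee_sum.
Qed.

Lemma energyE (c : 'I_n -> R) :
  (forall j, (\int[mu]_t (speed S j t `^ alpha)%:E = (c j)%:E)%E) ->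
  energy alpha S = (\sum_(j < n) #|procs S j|%:R * c j)%:E.
Proof.
move=> cj; rewrite -(sum_card_mul (procs S) c xpredT) /= -sumEFin /energy.
apply: eq_bigr => p _; rewrite proc_energy -sumEFin.
exact: eq_bigr.
Qed.

Definition busy_set j : set R := [set t | 0 < speed S j t].

Lemma measurable_busy j : measurable (busy_set j).
Proof.
rewrite (_ : busy_set j = setT `&` speed S j @^-1` `]0, +oo[)%classic.
  by apply: S_meas.
by rewrite setTI; apply/seteqP; split => t /=; rewrite in_itv /= andbT.
Qed.

(** On a fixed processor at most one job is busy at a time, so the indicators of the busy sets of
    its jobs sum to at most the indicator of [[a, b[]. Integrate and sum over the processors. *)
Lemma busy_capacity (P : pred 'I_n) (y : 'I_n -> R) (a b : R) : a <= b ->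
  (forall j, mu (busy_set j) = (y j)%:E) ->
  (forall j, P j -> busy_set j `<=` `[a, b[)%classic ->
  \sum_(j < n | P j) #|procs S j|%:R * y j <= m%:R * (b - a).
Proof.
move=> ab yE sub; rewrite -(sum_card_mul (procs S) y P).
rewrite -[m in leRHS]card_ord mulr_natl -sumr_const; apply: ler_sum => p _.
rewrite -lee_fin -sumEFin.
rewrite (eq_bigr (fun j => \int[mu]_t (\1_(busy_set j) t)%:E)%E); last first.
  by move=> j _; rewrite integral_indic //= ?setIT ?yE //; apply: measurable_busy.
rewrite -integral_sum_fin //; last first.
  by move=> j; apply: measurable_indic; apply: measurable_busy.
have <- : (\int[mu]_t (\1_(`[a, b[%classic) t)%:E = (b - a)%:E)%E.
  rewrite integral_indic //= setIT lebesgue_measure_itv /= lte_fin.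
  case: ltP => [_|ba]; first by rewrite -EFinD.
  by have -> : b = a; [apply/eqP; rewrite eq_le ab ba|rewrite subrr].
apply: ge0_le_integral => //.
- by move=> t _; rewrite lee_fin sumr_ge0.
- apply/measurable_EFinP; apply: measurable_sum_fin => j.
  by apply: measurable_indic; apply: measurable_busy.
- by apply/measurable_EFinP; apply: measurable_indic.
move=> t _; rewrite lee_fin.
apply: (@sum_exclusive_le _ _ _ (fun j => speed S j t)) => //.
- by move=> i j /andP[_ ip] /andP[_ jp]; apply: S_excl ip jp.
- by move=> i _ z; rewrite indicE memNset // /busy_set /= z ltxx.
- move=> j /andP[Pj _]; rewrite !indicE ler_nat.
  case: (boolP (t \in busy_set j)) => // tj.
  by rewrite (_ : t \in `[a, b[%classic) //; apply/mem_set/(sub j Pj)/set_mem.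
Qed.

(** The tangent inequality is integrated over the busy set; elsewhere the speed is 0 and nothing is
    subtracted. The negative term is moved to the other side first, so that all integrands are
    nonnegative. *)
Lemma job_energy_lower_bound j (s W y : R) : 0 < s ->
  (\int[mu]_t (speed S j t)%:E = W%:E)%E -> mu (busy_set j) = y%:E ->
  ((alpha * s `^ (alpha - 1) * W - (alpha - 1) * s `^ alpha * y)%:E <=
   \int[mu]_t (speed S j t `^ alpha)%:E)%E.
Proof.
move=> s0 WE yE.
have c1 : 0 <= alpha * s `^ (alpha - 1).
  by rewrite mulr_ge0 ?powR_ge0 // ltW // (lt_trans ltr01).
have c2 : 0 <= (alpha - 1) * s `^ alpha.
  by rewrite mulr_ge0 ?powR_ge0 // subr_ge0 ltW.
rewrite EFinB leeBlDr //.
have <- : (\int[mu]_t ((alpha - 1) * s `^ alpha * \1_(busy_set j) t)%:E =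
    ((alpha - 1) * s `^ alpha * y)%:E)%E.
  under eq_integral => t _ do rewrite EFinM.
  rewrite ge0_integralZl_EFin //; last first.
    by apply/measurable_EFinP; apply: measurable_indic; apply: measurable_busy.
  by rewrite integral_indic //= ?setIT ?yE //; apply: measurable_busy.
have <- : (\int[mu]_t (alpha * s `^ (alpha - 1) * speed S j t)%:E =
    (alpha * s `^ (alpha - 1) * W)%:E)%E.
  under eq_integral => t _ do rewrite EFinM.
  rewrite ge0_integralZl_EFin ?WE //; first by move=> t _; rewrite lee_fin.
  by apply/measurable_EFinP; apply: S_meas.
have m2 : measurable_fun setT (fun t => ((alpha - 1) * s `^ alpha * \1_(busy_set j) t)%:E).
  apply/measurable_EFinP; apply: measurable_funM => //.
  by apply: measurable_indic; apply: measurable_busy.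
have m1 : measurable_fun setT (fun t => (speed S j t `^ alpha)%:E).
  by apply/measurable_EFinP; apply: measurable_speed_powR.
rewrite -ge0_integralD //; last 2 first.
- by move=> t _; rewrite lee_fin powR_ge0.
- by move=> t _; rewrite lee_fin mulr_ge0.
apply: ge0_le_integral => //.
- by move=> t _; rewrite lee_fin mulr_ge0.
- by apply/measurable_EFinP; apply: measurable_funM => //; apply: S_meas.
- exact: emeasurable_funD.
move=> t _; rewrite -EFinD lee_fin indicE.
have [tj|tj] := boolP (t \in busy_set j).
  by rewrite mulr1; apply: tangent_powR.
have -> : speed S j t = 0.
  apply/eqP; rewrite eq_le S_ge0 andbT leNgt; apply: contra tj => tj.
  exact/mem_set.
by rewrite mulr0 addr_ge0 ?powR_ge0 // mulr_ge0.
Qed.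

End ScheduleEnergy.

(** * Comparison of the constructed schedule with the optimum *)

Definition common_end (R : realType) (rev : bool) (I : instance R) :=
  if rev then common_deadline I else common_release I.

Lemma tabulate_ord (T : Type) (x0 : T) n (f : 'I_n -> T) (k : 'I_n) :
  tabulate x0 f k = f k.
Proof. by rewrite /tabulate valK. Qed.

Lemma powR_predM (R : realType) (a s : R) : 0 < s -> s `^ a = s `^ (a - 1) * s.
Proof.
move=> s0; rewrite -{1}(subrK 1 a) (@powRD _ s (a - 1) 1) ?powRr1 ?ltW //.
by rewrite (gt_eqF s0) implybT.
Qed.

Lemma approximation_ratio_ge1 (R : realType) m : (0 < m)%N -> 1 <= 3 - 4 / (m + 1)%:R :> R.
Proof.
move=> m0; have M1 : 1 <= m%:R :> R by rewrite ler1n.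
rewrite natrD; suff : 4 / (m%:R + 1) <= 2 :> R by lra.
by rewrite ler_pdivrMr; lra.
Qed.

Section Plan.
Context {R : realType} (alpha : R) (I : instance R) (rev : bool).
Hypothesis alpha_gt1 : 1 < alpha.
Hypothesis I_valid : valid I.
Hypothesis I_common : common_end rev I.
Let n := njobs I.
Let m := nprocs I.
Context (pos at_ : 'I_n -> 'I_n) (posK : cancel pos at_) (at_K : cancel at_ pos).
Context (sz : nat -> nat) (W D sp : nat -> R).
Hypothesis szE : forall j, sz (pos j) = size_of j.
Hypothesis WE : forall j, W (pos j) = work j.
Hypothesis DE : forall j, D (pos j) = deadline j - release j.
Hypothesis D_sorted : forall i k, (i <= k < n)%N -> D i <= D k.
Let w k := (sz k)%:R * W k.
Let cap k := (sz k)%:R * D k.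
Let T k := m%:R * D k.
Hypothesis levels : optimal_levels w cap T sp n.

Let job_valid (j : 'I_n) : [/\ (0 < size_of j <= m)%N, release j < deadline j & 0 < work j].
Proof. by case: I_valid => _ _. Qed.

Let sp_gt0 (k : 'I_n) : 0 < sp k.
Proof. by case: levels => + _ _ _; apply. Qed.

Let sum_pos (F : nat -> R) : \sum_(k < n) F k = \sum_(j < n) F (pos j).
Proof.
by rewrite (reindex pos) //; exists at_ => ? _; [apply: posK|apply: at_K].
Qed.

Lemma window_sub i k : (pos i <= pos k)%N ->
  release k <= release i /\ deadline i <= deadline k.
Proof.
move=> ik; have : D (pos i) <= D (pos k) by apply: D_sorted; rewrite ik /=.
rewrite !DE; move: I_common; rewrite /common_end; case: (rev) => -[x xE].
  by rewrite !xE => ?; split => //; lra.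
by rewrite !xE => ?; split => //; lra.
Qed.

Definition relaxed_energy := \sum_(j < n) (size_of j)%:R * (work j * sp (pos j) `^ (alpha - 1)).

(** Tangents at the levels bound the energy below by [relaxed_energy] minus (alpha - 1) times the
    sum of s^alpha (X - w/s), where [X] are the processor times of [S]. They satisfy the relaxed
    constraints, so that sum is at most 0 by the optimality clause. *)
Lemma relaxed_energy_le (S : schedule R n m) : @feasible R I S ->
  ((relaxed_energy)%:E <= energy alpha S)%E.
Proof.
move=> [card meas win excl workE].
have S_meas j : measurable_fun setT (speed S j) by case: (meas j).
have S_ge0 j t : 0 <= speed S j t by case: (meas j).
have S_excl t (p : 'I_m) i j : p \in procs S i -> p \in procs S j ->
  0 < speed S i t -> 0 < speed S j t -> i = j by apply: excl.
have busy_sub j : (busy_set S j `<=` `[release j, deadline j[)%classic.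
  by move=> t /= /win; rewrite in_itv.
have busy_le j : (lebesgue_measure (busy_set S j) <= (deadline j - release j)%:E)%E.
  have [_ rd _] := job_valid j.
  have -> : (deadline j - release j)%:E = lebesgue_measure (`[release j, deadline j[%classic : set R).
    by rewrite lebesgue_measure_itv /= lte_fin rd EFinD.
  apply: le_measure; [|by rewrite inE|exact: busy_sub].
  by rewrite inE; apply: measurable_busy.
pose y j := fine (lebesgue_measure (busy_set S j)).
have yE j : lebesgue_measure (busy_set S j) = (y j)%:E.
  rewrite /y fineK // ge0_fin_numE ?measure_ge0 //.
  exact: le_lt_trans (busy_le j) (ltry _).
have y_le j : y j <= deadline j - release j by rewrite -lee_fin -yE.
pose X := tabulate 0 (fun k : 'I_n => (size_of (at_ k))%:R * y (at_ k)).
have XE j : X (pos j) = (size_of j)%:R * y j by rewrite /X tabulate_ord posK.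
have workE' j : (\int[@lebesgue_measure R]_t (speed S j t)%:E = (work j)%:E)%E.
  rewrite -workE [RHS]integral_mkcond; apply: eq_integral => t _.
  rewrite patchE; case: ifPn => // /negP tw; congr _%:E.
  apply/eqP; rewrite eq_le S_ge0 andbT leNgt; apply/negP => /win tin.
  by apply: tw; rewrite inE /= in_itv.
have lb j := job_energy_lower_bound alpha_gt1 S_meas S_ge0 (sp_gt0 (pos j)) (workE' j) (yE j).
apply: le_trans (energy_lower_bound alpha_gt1 S_meas S_ge0 S_excl lb).
rewrite lee_fin.
have [_ _ _ opt] := levels.
(* The maximum with 0 makes the power nondecreasing on the whole line, as the optimality clause
   requires. *)
pose f u := (Num.max u 0) `^ alpha.
have f_homo : {homo f : u v / u <= v}.
  move=> u v uv; apply: ge0_ler_powR.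
  - by rewrite ltW // (lt_trans ltr01).
  - by rewrite nnegrE le_max lexx orbT.
  - by rewrite nnegrE le_max lexx orbT.
  - by rewrite le_max2.
have fE j : f (sp (pos j)) = sp (pos j) `^ (alpha - 1) * sp (pos j).
  by rewrite /f max_l ?ltW // powR_predM.
have := opt f X f_homo (fun u => powR_ge0 _ _) _ _.
have X_cap i : (i < n)%N -> X i <= cap i.
  move=> ik; rewrite -[i]/(nat_of_ord (Ordinal ik)) -[Ordinal ik]at_K XE /cap szE DE.
  by rewrite ler_wpM2l.
(* All jobs of rank at most [i] run inside the window of the job of rank [i], as the windows are
   nested. *)
have X_T i : (i < n)%N -> \sum_(l < i.+1) X l <= T i.
  move=> ik; rewrite -(big_mkord xpredT X) big_nat_cond.
  rewrite (big_nat_widen _ _ n) //= big_mkord.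
  rewrite (eq_bigl (fun k : 'I_n => (k <= i)%N)) => [|k]; last by rewrite andbT ltnS andbb.
  rewrite (reindex pos) /=; last first.
    by exists at_ => ? _; [apply: posK|apply: at_K].
  have -> : i = pos (at_ (Ordinal ik)) by rewrite at_K.
  rewrite /T DE; have [_ rd _] := job_valid (at_ (Ordinal ik)).
  apply: le_trans (busy_capacity S_meas S_ge0 S_excl (ltW rd) yE _).
    by rewrite le_eqVlt; apply/orP; left; apply/eqP/eq_bigr => j _; rewrite XE card.
  move=> j /window_sub[w1 w2] t /busy_sub /=; rewrite !in_itv /= => /andP[t1 t2].
  by rewrite (le_trans w1 t1) (lt_le_trans t2 w2).
move=> /(_ X_cap X_T).
rewrite (sum_pos (fun i => f (sp i) * (X i - w i / sp i))) => opt_le.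
rewrite /relaxed_energy -subr_ge0 -sumrB.
have am0 : 0 <= alpha - 1 by rewrite subr_ge0 ltW.
have := mulr_ge0_le0 am0 opt_le; rewrite -oppr_ge0 mulr_sumr -sumrN.
set A := \sum_(j < n) _; set B := \sum_(j < n) _ => A0; suff -> : B = A by [].
apply: eq_bigr => j _; rewrite card XE fE /w szE WE.
rewrite [in LHS](powR_predM alpha (sp_gt0 _)).
have s0 : sp (pos j) != 0 by rewrite gt_eqF.
by field.
Qed.

Context (dur start finish front shift : nat -> R) (S : schedule R n m).
Let ratio : R := 3 - 4 / (m + 1)%:R.
Let small i := (sz i + sz i <= m)%N.
Hypothesis durE : forall k, (k < n)%N -> dur k = W k / (ratio * sp k).
Hypothesis tm : timing m sz dur start finish front shift n.
Hypothesis card_procs : forall j, #|procs S j| = size_of j.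
Hypothesis procs_order : forall i j (p : 'I_m), (pos i < pos j)%N -> small (pos i) -> small (pos j) ->
  p \in procs S i -> p \in procs S j -> finish (pos i) <= start (pos j).
Local Notation lo := (slot_start small start finish front shift).
Local Notation hi := (slot_end small dur start finish front shift).
Let piece_lo j c := if rev then deadline j - hi (pos j) c else release j + lo (pos j) c.
Let piece_hi j c := if rev then deadline j - lo (pos j) c else release j + hi (pos j) c.
Let sigma j := ratio * sp (pos j).
Hypothesis speedE : forall j t, speed S j t =
  \sum_(c < (pos j).+1) if piece_lo j c <= t < piece_hi j c then sigma j else 0.

Let m_gt0 : (0 < m)%N. Proof. by case: I_valid. Qed.

Let ratio_ge1 : 1 <= ratio. Proof. exact: approximation_ratio_ge1. Qed.

Let sigma_gt0 j : 0 < sigma j.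
Proof. by rewrite mulr_gt0 // (lt_le_trans ltr01). Qed.

Let dur_gt0 i : (i < n)%N -> 0 < dur i.
Proof.
move=> ik; rewrite durE // -[i]/(nat_of_ord (Ordinal ik)) -[Ordinal ik]at_K WE.
by have [_ _ w0] := job_valid (at_ (Ordinal ik)); rewrite divr_gt0 // sigma_gt0.
Qed.

Let sz_gt0 l : (l < n)%N -> (0 < sz l)%N.
Proof.
move=> ln; rewrite -[l]/(nat_of_ord (Ordinal ln)) -[Ordinal ln]at_K szE.
by case: (job_valid (at_ (Ordinal ln))) => /andP[].
Qed.

Let dur_pos j : sigma j * dur (pos j) = work j.
Proof. by rewrite durE // WE mulrC divfK // gt_eqF ?sigma_gt0. Qed.

(** Divided by [ratio], the relaxed constraints on processor times become the premises of
    [completion_bound] on durations. *)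
Let reach_le_span j : front (pos j).+1 + shift (pos j).+1 <= deadline j - release j.
Proof.
rewrite -DE; have r0 : 0 < ratio by rewrite (lt_le_trans ltr01).
have lt_n l : (l <= pos j)%N -> (l < n)%N by move=> lj; apply: leq_ltn_trans lj (ltn_ord _).
apply: (completion_bound tm dur_gt0 m_gt0 (ltn_ord _)).
- by move=> l /lt_n; apply: sz_gt0.
- move=> l /lt_n ln; rewrite durE // invfM mulrCA [D l / _]mulrC ler_pM2l ?invr_gt0 //.
  have [_ + _ _] := levels => /(_ l ln); rewrite /w /cap -mulrA ler_pM2l //.
  by rewrite ltr0n sz_gt0.
- by move=> l lj; apply: D_sorted; rewrite lj /=.
- have [_ _ + _] := levels => /(_ (pos j) (ltn_ord _)); rewrite /w /T => le.
  rewrite ler_pdivlMr // mulr_suml; apply: le_trans le; apply: ler_sum => l _.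
  have ln : (l < n)%N by apply: lt_n; rewrite -ltnS.
  rewrite durE // invfM -!mulrA ler_wpM2l // [ratio^-1 * _]mulrCA mulVf ?gt_eqF //.
  by rewrite mulr1.
Qed.

Let piece_le j (c : 'I_(pos j).+1) : piece_lo j c <= piece_hi j c.
Proof.
have := slot_le tm dur_gt0 (ltn_ord (pos j)) (_ : (c <= pos j)%N).
rewrite -ltnS => /(_ (ltn_ord c)); rewrite /piece_lo /piece_hi -/(small _) => le.
by case: (rev); rewrite ?lerD2l ?lerN2.
Qed.

Let piece_len j (c : 'I_(pos j).+1) :
  piece_hi j c - piece_lo j c = hi (pos j) c - lo (pos j) c.
Proof. by rewrite /piece_lo /piece_hi; case: (rev); ring. Qed.

Let piece_window j (c : 'I_(pos j).+1) : piece_lo j c < piece_hi j c ->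
  release j <= piece_lo j c /\ piece_hi j c <= deadline j.
Proof.
move=> lt; have ci : (c <= pos j)%N by rewrite -ltnS.
have lt' : lo (pos j) c < hi (pos j) c by rewrite -subr_gt0 -piece_len subr_gt0.
have [r1 r2 _] := slot_in tm dur_gt0 (ltn_ord _) ci lt'.
have cn : (c < n)%N by apply: leq_ltn_trans ci (ltn_ord _).
have r0 : 0 <= front c + shift c.
  by rewrite addr_ge0 ?(front_ge0 tm (ltnW cn)) ?(shift_ge0 tm dur_gt0 (ltnW cn)).
have := reach_le tm dur_gt0 (_ : (c.+1 <= (pos j).+1)%N) (ltn_ord _).
move=> /(_ ci); have := reach_le_span j.
rewrite /piece_lo /piece_hi; case: (rev) => h1 h2; split; lra.
Qed.

Let piece_conflict i j (c : 'I_(pos i).+1) (d : 'I_(pos j).+1) t :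
  piece_lo i c <= t < piece_hi i c -> piece_lo j d <= t < piece_hi j d ->
  c = d :> nat /\ (i = j \/ [/\ small (pos i), small (pos j),
    ~ (finish (pos i) <= start (pos j)) & ~ (finish (pos j) <= start (pos i))]).
Proof.
move=> ti tj.
(* Times are measured from the common end of the windows, backwards if this is the deadline; both
   pieces are then slots on the same axis. *)
have [x [xi xj]] : exists x, in_piece rev x (lo (pos i) c) (hi (pos i) c) /\
    in_piece rev x (lo (pos j) d) (hi (pos j) d).
  move: I_common ti tj; rewrite /common_end /piece_lo /piece_hi /in_piece.
  case: (rev) => -[x0 x0E]; rewrite !x0E => /andP[? ?] /andP[? ?].
    by exists (x0 - t); split; apply/andP; split; lra.
  by exists (t - x0); split; apply/andP; split; lra.
have ci : (c <= pos i)%N by rewrite -ltnS.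
have dj : (d <= pos j)%N by rewrite -ltnS.
have [cd] := slot_conflict tm dur_gt0 (ltn_ord _) ci (ltn_ord _) dj xi xj.
case=> [ij|h]; split => //; [left|by right].
by apply: (can_inj posK); apply: val_inj.
Qed.

Let speed_gt0 j t : 0 < speed S j t ->
  exists c : 'I_(pos j).+1, piece_lo j c <= t < piece_hi j c.
Proof.
move=> spos; have [//|none] := pselect (exists c : 'I_(pos j).+1, piece_lo j c <= t < piece_hi j c).
move: spos; rewrite speedE big1 ?ltxx // => c _; case: ifP => // tc.
by case: none; exists c.
Qed.

Let step_meas (c a b : R) :
  measurable_fun setT (fun t : R => if a <= t < b then c else 0).
Proof. exact: measurable_step. Qed.

Let S_meas j : measurable_fun setT (speed S j).
Proof.
rewrite (_ : speed S j = fun t => \sum_(c < (pos j).+1)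
    if piece_lo j c <= t < piece_hi j c then sigma j else 0).
  by apply: measurable_sum_fin => c; apply: measurable_step.
by apply: funext => t; apply: speedE.
Qed.

Let S_ge0 j t : 0 <= speed S j t.
Proof. by rewrite speedE sumr_ge0 // => c _; case: ifP => // _; rewrite ltW. Qed.

Let S_excl t (p : 'I_m) i j : p \in procs S i -> p \in procs S j ->
  0 < speed S i t -> 0 < speed S j t -> i = j.
Proof.
move=> ip jp /speed_gt0[c tc] /speed_gt0[d td].
have [_ [//|[si sj nij nji]]] := piece_conflict tc td.
case: (ltngtP (pos i) (pos j)) => [ij|ji|/val_inj/(can_inj posK)//].
  by case: nij; apply: procs_order ij si sj ip jp.
by case: nji; apply: procs_order ji sj si jp ip.
Qed.

Lemma plan_feasible : @feasible R I S.
Proof.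
split => //.
- move=> j t /speed_gt0[c /andP[t1 t2]].
  have [w1 w2] := piece_window (le_lt_trans t1 t2).
  by rewrite (le_trans w1 t1) (lt_le_trans t2 w2).
- move=> j.
  under eq_integral => t _ do rewrite speedE.
  rewrite integral_sum_fin //; last by move=> c t; case: ifP => // _; rewrite ltW.
  rewrite (eq_bigr (fun c : 'I_(pos j).+1 => (sigma j * (hi (pos j) c - lo (pos j) c))%:E)).
    rewrite sumEFin -mulr_sumr (slot_sum tm dur_gt0) ?ltn_ord //.
    by rewrite dur_pos.
  move=> c _; rewrite -piece_len; apply: integral_itv_step => //; first exact: ltW.
  move=> /piece_window[w1 w2] t /=; rewrite !in_itv /= => /andP[t1 t2].
  by rewrite (le_trans w1 t1) (lt_le_trans t2 w2).
Qed.

(** Each job runs at the constant speed [sigma j] for the time [dur], so it uses sigma^alpha dur =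
    sigma^(alpha-1) W per processor, and the ratio factors out. *)
Lemma plan_energy : energy alpha S = (ratio `^ (alpha - 1) * relaxed_energy)%:E.
Proof.
have a0 : alpha != 0 by rewrite gt_eqF // (lt_trans ltr01).
rewrite (@energyE _ _ _ _ _ alpha_gt1 S_meas S_ge0 S_excl
   (fun j => sigma j `^ alpha * dur (pos j))); last first.
  move=> j; under eq_integral => t _.
    rewrite speedE powR_sum_exclusive //; last first.
    - move=> c d _ _; case: ifP => [tc _|_]; last by rewrite ltxx.
      case: ifP => [td _|_]; last by rewrite ltxx.
      by apply: val_inj; case: (piece_conflict tc td).
    - by move=> c; case: ifP => // _; rewrite ltW.
    rewrite (eq_bigr (fun c : 'I_(pos j).+1 =>
       if piece_lo j c <= t < piece_hi j c then sigma j `^ alpha else 0)); last first.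
      by move=> c _; case: ifP => // _; rewrite powR0.
    over.
  rewrite integral_sum_fin //; last by move=> c t; case: ifP => // _; apply: powR_ge0.
  rewrite (eq_bigr (fun c : 'I_(pos j).+1 =>
      (sigma j `^ alpha * (hi (pos j) c - lo (pos j) c))%:E)).
    by rewrite sumEFin -mulr_sumr (slot_sum tm dur_gt0) ?ltn_ord.
  by move=> c _; rewrite -piece_len; apply: integral_itv_step; rewrite ?powR_ge0.
congr _%:E; rewrite /relaxed_energy mulr_sumr; apply: eq_bigr => j _.
rewrite card_procs powR_predM ?sigma_gt0 // -mulrA dur_pos /sigma powRM ?ltW //; last first.
  by rewrite (lt_le_trans ltr01).
by ring.
Qed.

Lemma plan_approximation :
  (energy alpha S <= (ratio `^ (alpha - 1))%:E * min_energy alpha I)%E.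
Proof.
rewrite plan_energy EFinM; apply: lee_wpmul2l; first by rewrite lee_fin powR_ge0.
by apply/ereal_infP => _ [S' feas <-]; apply: relaxed_energy_le.
Qed.

End Plan.

(** * The algorithm *)

Definition algorithm rev :=
  (sort_phase ;; level_phase ;; timing_phase ;; block_phase ;; piece_phase rev)%cmd.

Lemma runs_algorithm (R : realType) (alpha : R) (alpha_gt1 : 1 < alpha) (rev : bool)
    (I : instance R) : valid I -> common_end rev I ->
  runs (algorithm rev) (input alpha I) (3100 * (njobs I).+1 ^ 2) (fun s =>
    let S := output (njobs I) (nprocs I) s in
    feasible S /\
    (energy alpha S <= ((3 - 4 / (nprocs I + 1)%:R) `^ (alpha - 1))%:E * min_energy alpha I)%E).
Proof.
move=> vI cI; set n := njobs I; set m := nprocs I.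
have [n0 m0 jobs] := vI.
pose q := (n.+1 ^ 2)%N.
rewrite (_ : 3100 * _ = 100 * q + (500 * q + (500 * q + (1000 * q + 1000 * q))))%N; last first.
  by rewrite /q; lia.
have tail a b : (a <= a + b)%N by rewrite leq_addr.
apply: (runs_seq (tail _ _)); rewrite addKn.
apply: runs_sort_phase => s1 ag1 span perm1 sort1.
have /= E1 := agreeE ag1.
rewrite -[nmem _ aDim 0]/n in span perm1 sort1.
set job := nmem s1 aJob in perm1 sort1.
have inl k : (k \in mkseq job n) = (k < n)%N by rewrite (perm_mem perm1) mem_iota.
have szl : size (mkseq job n) = n by rewrite size_mkseq.
have job_lt k : (k < n)%N -> (job k < n)%N.
  by move=> kn; rewrite -inl; apply/mapP; exists k; rewrite ?mem_iota.
have pos_lt (j : 'I_n) : (index (j : nat) (mkseq job n) < n)%N.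
  by rewrite -[ltnRHS]szl index_mem inl.
pose at_ (k : 'I_n) := Ordinal (job_lt k (ltn_ord k)).
pose pos (j : 'I_n) := Ordinal (pos_lt j).
have job_pos (j : 'I_n) : job (pos j) = j.
  by rewrite -(nth_mkseq 0%N job (pos_lt j)) nth_index // inl.
have posK : cancel pos at_ by move=> j; apply: val_inj; rewrite /= job_pos.
have at_K : cancel at_ pos.
  move=> k; apply: val_inj => /=.
  rewrite -(nth_mkseq 0%N job (ltn_ord k)) index_uniq ?szl //.
  by rewrite (perm_uniq perm1) iota_uniq.
have ordE k (kn : (k < n)%N) : k = pos (at_ (Ordinal kn)) by rewrite at_K.
pose sz k := nmem s1 aSize (job k); pose W k := rmem s1 rWork (job k).
pose D k := rmem s1 rSpan (job k).
have szE (j : 'I_n) : sz (pos j) = size_of j.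
  by rewrite /sz job_pos E1 /= tabulate_ord.
have WE (j : 'I_n) : W (pos j) = work j by rewrite /W job_pos E1 /= tabulate_ord.
have DE (j : 'I_n) : D (pos j) = deadline j - release j.
  by rewrite /D job_pos span //= !tabulate_ord.
have D_sorted i k : (i <= k < n)%N -> D i <= D k.
  move=> /andP[]; rewrite leq_eqVlt => /orP[/eqP->//|ik] kn.
  have iN := ltn_trans ik kn.
  have /(pairwiseP 0%N)/(_ i k) := sort1; rewrite !inE szl !nth_mkseq // => /(_ iN kn ik) /=.
  by rewrite /D !span ?job_lt.
have pos_data k : (k < n)%N -> [/\ (0 < sz k)%N, 0 < W k & 0 < D k].
  move=> kn; rewrite (ordE k kn) szE WE DE subr_gt0.
  by have [/andP[? ?] ? ?] := jobs (at_ (Ordinal kn)).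
have dim1 : nmem s1 aDim = nmem (input alpha I) aDim by rewrite E1.
apply: (runs_seq (tail _ _)); rewrite addKn.
have -> : (500 * q = 500 * (nmem s1 aDim 0).+1 ^ 2)%N by rewrite dim1.
apply: runs_level_phase; rewrite ?dim1 // => s2 ag2 levels.
have /= E2 := agreeE ag2.
rewrite -[nmem _ aDim 0]/n -[nmem _ aDim 1]/m in levels.
apply: (runs_seq (tail _ _)); rewrite addKn.
have -> : (500 * q = 500 * (nmem s2 aDim 0).+1 ^ 2)%N by rewrite E2 dim1.
pose ratio : R := 3 - 4 / (m + 1)%:R.
pose sp := rmem s2 rSpeed.
have ratio_gt0 : 0 < ratio.
  exact: lt_le_trans ltr01 (approximation_ratio_ge1 R m0).
pose dur k := W k / (ratio * sp k).
have dur_gt0 k : (k < n)%N -> 0 < dur k.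
  move=> kn; have [_ W0 _] := pos_data k kn.
  by rewrite divr_gt0 // mulr_gt0 //; case: levels => + _ _ _; apply.
apply: runs_timing_phase; rewrite !E2 dim1 //.
move=> s3 ag3 ratioE durE tm; rewrite -/job in ratioE durE tm.
have /= E3 := agreeE ag3.
have {}durE k : (k < n)%N -> rmem s3 rDur k = dur k by apply: durE.
have {}tm : timing m sz dur (rmem s3 rStart) (rmem s3 rEnd) (rmem s3 rFront) (rmem s3 rShift) n.
  exact: tm.
have dim3 : nmem s3 aDim = nmem (input alpha I) aDim by rewrite E3 E2.
have job3 : nmem s3 aJob = job by rewrite E3 E2.
have size3 : nmem s3 aSize = nmem s1 aSize by rewrite E3 E2.
apply: (runs_seq (tail _ _)); rewrite addKn.
have -> : (1000 * q = 1000 * (nmem s3 aDim 0).+1 ^ 2)%N by rewrite dim3.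
have job_inj i k : (i < n)%N -> (k < n)%N -> job i = job k -> i = k.
  move=> iN kN e; rewrite [LHS](ordE i iN) [RHS](ordE k kN); congr (nat_of_ord (pos _)).
  exact: val_inj.
have sz_le k : (k < n)%N -> (sz k <= m)%N.
  by move=> kn; rewrite (ordE k kn) szE; have [/andP[]] := jobs (at_ (Ordinal kn)).
apply: runs_block_phase; rewrite ?dim3 ?job3 ?size3 //.
- by move=> k kn ks; have [] := timing_start tm kn ks.
- move=> k kn ks; have [_ -> _ _] := timing_start tm kn ks.
  by rewrite ltrDl dur_gt0.
- by move=> k kn ks; have [] := timing_start tm kn ks.
move=> s4 ag4 card order.
have /= E4 := agreeE ag4.
have dim4 : nmem s4 aDim = nmem (input alpha I) aDim by rewrite E4 dim3.
have -> : (1000 * q = 1000 * (nmem s4 aDim 0).+1 ^ 2)%N by rewrite dim4.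
apply: runs_piece_phase.
- rewrite dim4 !E4 job3 size3 => k kn ks.
  have [-> -> _ _] := timing_start tm kn ks.
  by rewrite lerDl ltW ?dur_gt0.
- by rewrite E4 (timing_front0 tm).
move=> s5 ag5 cnt5 spd.
have /= E5 := agreeE ag5.
have owners5 (j : nat) : owners m s5 j = owners m s4 j.
  by rewrite /owners cnt5 !E5.
set S := output n m s5.
have procsE (j : 'I_n) : procs S j = owners m s4 (job (pos j)).
  by rewrite job_pos -owners5.
have cardS (j : 'I_n) : #|procs S j| = size_of j.
  by rewrite procsE card ?ltn_ord // -szE.
have orderS (i j : 'I_n) (p : 'I_m) : (pos i < pos j)%N ->
    (sz (pos i) + sz (pos i) <= m)%N -> (sz (pos j) + sz (pos j) <= m)%N ->
    p \in procs S i -> p \in procs S j -> rmem s3 rEnd (pos i) <= rmem s3 rStart (pos j).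
  rewrite !procsE => ij si sj; apply: order => //.
  by rewrite ij /=.
have durS k : (k < n)%N -> rmem s3 rDur k = W k / (ratio * sp k) by apply: durE.
(* The stored durations agree with the formula only at ranks below [n], so the record is transferred
   entry by entry. *)
have tm3 : timing m sz (rmem s3 rDur) (rmem s3 rStart) (rmem s3 rEnd) (rmem s3 rFront)
    (rmem s3 rShift) n.
  have durl (i l : nat) : (i < n)%N -> (l < i)%N -> rmem s3 rDur l = dur l.
    by move=> iN li; rewrite durE // (ltn_trans li).
  case: tm => t1 t2 t3 t4 t5; split => //.
  - move=> i iN si; have [a1 a2 a3 a4] := t1 i iN si; rewrite durE //; split => //.
    by under eq_bigr => l _ do rewrite (durl i) //.
  - by move=> i iN; rewrite durE // t5.
pose small i := (sz i + sz i <= m)%N.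
pose lo := slot_start small (rmem s3 rStart) (rmem s3 rEnd) (rmem s3 rFront) (rmem s3 rShift).
pose hi := slot_end small (rmem s3 rDur) (rmem s3 rStart) (rmem s3 rEnd) (rmem s3 rFront)
  (rmem s3 rShift).
have speedS j t : speed S j t = \sum_(c < (pos j).+1)
    if (if rev then deadline j - hi (pos j) c else release j + lo (pos j) c) <= t <
       (if rev then deadline j - lo (pos j) c else release j + hi (pos j) c)
    then ratio * sp (pos j) else 0.
  rewrite -[LHS]/(piece_speed s5 j t) spd dim4 E4 job3.
  rewrite (big_pred1 (pos j)) /= => [|i].
    apply: eq_bigr => c _; rewrite /piece_at /piece_lo /piece_hi !E4 ratioE dim3 job3 size3.
    rewrite job_pos [rmem s3 rSpeed]E3.
    have -> : rmem s3 rDeadline j = deadline j by rewrite E3 E2 E1 /= tabulate_ord.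
    by have -> : rmem s3 rRelease j = release j by rewrite E3 E2 E1 /= tabulate_ord.
  apply/eqP/eqP => [ji|->]; last exact: job_pos.
  by apply: (can_inj at_K); apply: val_inj; rewrite /= ji job_pos.
split.
  exact: (plan_feasible vI cI posK at_K szE WE DE D_sorted levels durS tm3 cardS orderS speedS).
exact: (plan_approximation alpha_gt1 vI cI posK at_K szE WE DE D_sorted levels durS tm3
  cardS orderS speedS).
Qed.

Lemma quadratic_time_algorithm (R : realType) (alpha : R) (rev : bool) : 1 < alpha ->
  quadratic_time_approximation alpha (@common_end R rev)
    (fun m : nat => (3 - 4 / (m + 1)%:R) `^ (alpha - 1)).
Proof.
move=> alpha_gt1; exists (algorithm rev), (3100 * 4)%N => I vI cI.
have [t [s [e tB [feas en]]]] := runs_algorithm alpha_gt1 vI cI.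
exists t, s; split => //; apply: leq_trans tB _.
have [n0 _ _] := vI.
(* As n is positive, n + 1 is at most 2n; this is the origin of the factor 4. *)
by rewrite -mulnA leq_mul2l -[4%N]/(2 ^ 2)%N -expnMn leq_exp2r //; lia.
Qed.

Theorem theorem2 (R : realType) (alpha : R) (alpha_gt1 : 1 < alpha) :
  quadratic_time_approximation alpha (@common_release R)
    (fun m : nat => (3 - 4 / (m + 1)%:R) `^ (alpha - 1)) /\
  quadratic_time_approximation alpha (@common_deadline R)
    (fun m : nat => (3 - 4 / (m + 1)%:R) `^ (alpha - 1)).
Proof.
by split; [apply: (@quadratic_time_algorithm R alpha false)
          |apply: (@quadratic_time_algorithm R alpha true)].
Qed.
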